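(* Fix $p\in[1,2]$. For each $n$ let $K_n=\omega_n\ell_p^n\subset\mathbb{R}^n$ be the $\ell_p$ ball of unit volume, and let $d_n(\varepsilon)$ be the supremum of all possible distances between two subsets of $K_n$ of volume $\varepsilon$. There is a constant $C_p$, determined by $p$ only, such that for every $\varepsilon\in(0,\frac12)$ $$-2\Psi_p^{-1}(\varepsilon)\ \le\ \liminf_{n\to\infty} d_n(\varepsilon)\ \le\ \limsup_{n\to\infty} d_n(\varepsilon)\ \le\ C_p(-\ln\varepsilon)^{\frac1p}.$$ Moreover, the function $-2\Psi_p^{-1}(\varepsilon)$ is asymptotically equivalent to $$\frac{1}{e^{\frac1p}\,\Gamma\left(1+\frac1p\right)}(-\ln\varepsilon)^{\frac1p}$$ as $\varepsilon\to0^+$ (the ratio tends to $1$).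
   Context: $\ell_p^n=\{x\in\mathbb{R}^n : |x_1|^p+\dots+|x_n|^p\le1\}$ and $\omega_n=\frac{\Gamma(1+\frac np)^{1/n}}{2\Gamma(1+\frac1p)}$, so that $\omega_n\ell_p^n$ has Lebesgue measure $1$. The function $\Psi_p:\mathbb{R}\to(0,1)$ is $$\Psi_p(a)=\int_{-\infty}^{a}e^{\frac1p}\,e^{-\left(2\Gamma\left(1+\frac1p\right)e^{\frac1p}|x|\right)^p}\,dx,$$ an increasing bijection, with inverse $\Psi_p^{-1}$. The distance between non-empty sets $A,B$ is $\operatorname{dist}(A,B)=\inf_{x\in A,\,y\in B}\|x-y\|_2$ (Euclidean distance), and $d_n(\varepsilon)=\sup\{\operatorname{dist}(A,B)\}$ over Lebesgue measurable $A,B\subseteq K_n$ of volume exactly $\varepsilon$. *)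

(* Defs.v *)
From HB Require Import structures.
From mathcomp Require Import all_boot all_order all_algebra.
From mathcomp Require Import all_classical all_reals all_analysis.

Set Implicit Arguments.
Unset Strict Implicit.
Unset Printing Implicit Defensive.

Import Order.TTheory GRing.Theory Num.Theory.
Import numFieldNormedType.Exports.

Local Open Scope classical_set_scope.
Local Open Scope ring_scope.

(** Points of R^n are [n.-tuple R]; the sigma-algebra that the library puts on
    this type is generated by the coordinates, i.e. it is the Borel one.
    [lebesgue_tuple n] is the n-fold product of [lebesgue_measure] on Borel
    sets, obtained by transporting [lebesgue_measure \x lebesgue_tuple n] along
    (t, x) |-> t :: x. *)

Section lebesgue_cons.
Context {R : realType} (n : nat).
Variable mu : {sigma_finite_measure set (n.-tuple R) -> \bar R}.
Local Open Scope ereal_scope.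

Definition cons_pair (tx : R * n.-tuple R) : n.+1.-tuple R :=
  [tuple of tx.1 :: tx.2].

Lemma measurable_cons_pair : measurable_fun [set: R * n.-tuple R] cons_pair.
Proof. exact: measurable_cons. Qed.

Definition lebesgue_cons : set (n.+1.-tuple R) -> \bar R :=
  pushforward (@lebesgue_measure R \x mu) cons_pair.

Let mpreimage A : measurable A -> measurable (cons_pair @^-1` A).
Proof.
by move=> mA; rewrite -[X in measurable X]setTI; exact: measurable_cons_pair.
Qed.

Let lebesgue_cons0 : lebesgue_cons set0 = 0.
Proof. by rewrite /lebesgue_cons /pushforward preimage_set0 measure0. Qed.

Let lebesgue_cons_ge0 A : 0 <= lebesgue_cons A.
Proof. exact: (measure_ge0 (@lebesgue_measure R \x mu)). Qed.

Let lebesgue_cons_sigma_additive : semi_sigma_additive lebesgue_cons.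
Proof.
move=> F mF tF mUF; rewrite /lebesgue_cons /pushforward preimage_bigcup.
apply: measure_semi_sigma_additive.
- by move=> i; exact: mpreimage.
- apply/trivIsetP => i j _ _ ij; rewrite -preimage_setI.
  by move/trivIsetP : tF => /(_ _ _ _ _ ij) ->//; rewrite preimage_set0.
- by rewrite -preimage_bigcup; exact: mpreimage.
Qed.

HB.instance Definition _ := isMeasure.Build _ _ _
  lebesgue_cons lebesgue_cons0 lebesgue_cons_ge0 lebesgue_cons_sigma_additive.

Let lebesgue_cons_sigma_finite :
  sigma_finite [set: n.+1.-tuple R] lebesgue_cons.
Proof.
have /sigma_finiteP[F [TF ndF Foo]] := sigma_finiteT (@lebesgue_measure R).
have /sigma_finiteP[G [TG ndG Goo]] := sigma_finiteT mu.
pose S i : set (n.+1.-tuple R) :=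
  (fun y => thead y) @^-1` F i `&`
  (fun y : n.+1.-tuple R => [tuple of behead y] : n.-tuple R) @^-1` G i.
have mS i : measurable (S i).
  apply: measurableI; rewrite -[X in measurable X]setTI.
    by apply: measurable_tnth => //; have [] := Foo i.
  by apply: measurable_behead => //; have [] := Goo i.
exists S => [|i].
  apply/esym; rewrite -subTset => y _.
  have [k _ Fk] : (\bigcup_i F i) (thead y) by rewrite -TF.
  have [l _ Gl] : (\bigcup_i G i) [tuple of behead y] by rewrite -TG.
  exists (maxn k l) => //; split.
    have /subsetPset := ndF _ _ (leq_maxl k l); exact.
  have /subsetPset := ndG _ _ (leq_maxr k l); exact.
split; first exact: mS.
rewrite /lebesgue_cons /pushforward (_ : _ @^-1` _ = F i `*` G i).
  have [? ?] := Foo i; have [? ?] := Goo i.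
  by rewrite product_measure1E// lte_mul_pinfty// ge0_fin_numE.
apply/seteqP; split=> -[t x] /=; rewrite /S /= theadE.
  by move=> [Ft Gx]; split=> //; move: Gx; congr (G i _); exact/val_inj.
by move=> [Ft Gx]; split=> //; move: Gx; congr (G i _); exact/val_inj.
Qed.

HB.instance Definition _ := Measure_isSigmaFinite.Build _ _ _
  lebesgue_cons lebesgue_cons_sigma_finite.

End lebesgue_cons.

Fixpoint lebesgue_tuple {R : realType} (n : nat) :
    {sigma_finite_measure set (n.-tuple R) -> \bar R} :=
  match n with
  | 0 => \d_([tuple] : 0.-tuple R)
  | m.+1 => lebesgue_cons (lebesgue_tuple m)
  end.

(** Completing the Borel measure gives the Lebesgue measurable sets of R^n
    (in Caratheodory's sense, as the library does on R) and their volume. *)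

Definition lebesgue_measurable {R : realType} (n : nat) : set (set (n.-tuple R)) :=
  ((lebesgue_tuple n)^*)%mu.-cara.-measurable.

Definition volume {R : realType} (n : nat) : set (n.-tuple R) -> \bar R :=
  @completed_measure_extension _ _ _ (lebesgue_tuple n).

Definition eucl_dist {R : realType} (n : nat) (x y : n.-tuple R) : R :=
  Num.sqrt (\sum_(i < n) (tnth x i - tnth y i) ^+ 2).

Definition set_dist {R : realType} (n : nat) (A B : set (n.-tuple R)) : \bar R :=
  ereal_inf [set (eucl_dist x y)%:E | x in A & y in B].

Definition Gamma {R : realType} (s : R) : R :=
  \int[@lebesgue_measure R]_(t in `]0, +oo[) (t `^ (s - 1) * expR (- t)).

Definition lp_ball {R : realType} (p : R) (n : nat) : set (n.-tuple R) :=
  [set x | \sum_(i < n) `|tnth x i| `^ p <= 1].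
Arguments lp_ball {R} p n.

Definition omega {R : realType} (p : R) (n : nat) : R :=
  Gamma (1 + n%:R / p) `^ n%:R^-1 / (2 * Gamma (1 + p^-1)).

Definition unit_lp_ball {R : realType} (p : R) (n : nat) : set (n.-tuple R) :=
  [set [tuple omega p n * tnth x i | i < n] | x in lp_ball p n].
Arguments unit_lp_ball {R} p n.

(** The supremum is taken in the extended reals; in the degenerate dimension 0,
    where no set has volume [e] in ]0, 1[, it is -oo. *)
Definition max_dist {R : realType} (p : R) (e : R) (n : nat) : \bar R :=
  ereal_sup [set d | exists A B : set (n.-tuple R),
    [/\ lebesgue_measurable A, A `<=` unit_lp_ball p n & volume A = e%:E] /\
    [/\ lebesgue_measurable B, B `<=` unit_lp_ball p n & volume B = e%:E] /\
    d = set_dist A B].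

Definition Psi {R : realType} (p a : R) : R :=
  \int[@lebesgue_measure R]_(x in `]-oo, a])
    (expR p^-1 *
     expR (- (2 * Gamma (1 + p^-1) * expR p^-1 * `|x|) `^ p)).

(** [Psi p] is a bijection from R to ]0, 1[; outside of ]0, 1[ its inverse takes
    the default value 0. *)
Definition Psi_inv {R : realType} (p : R) : R -> R :=
  'pinv_(fun=> 0) [set: R] (Psi p).

(* Main.v *)
From HB Require Import structures.
Require Import Defs.
From mathcomp Require Import all_boot all_order all_algebra.
From mathcomp Require Import all_classical all_reals all_analysis.
From mathcomp Require Import measurable_realfun ring lra.

Import Order.TTheory GRing.Theory Num.Theory.
Import numFieldNormedType.Exports.

Local Open Scope classical_set_scope.
Local Open Scope ring_scope.

Set Implicit Arguments.
Unset Strict Implicit.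
Unset Printing Implicit Defensive.

(** Let Z be the integral of e^(-|x|^p) over R. A random vector with independent
    coordinates of density e^(-|x|^p) / Z ([lp_density]) is a mixture of uniform
    vectors in the balls [lball p n t], where t follows a Gamma law of mean n/p + 1
    and standard deviation sqrt (n/p + 1). Up to the scaling by omega, which is of
    order n^(1/p), the ball of unit volume is thus governed by a product law.

    Upper bound. The product law is concentrated: if the Euclidean distance of A and
    B is at least d >= 1, then the product of their probabilities is at most
    e^(- k d^p), with k > 0 independent of n ([concentration]). This is Talagrand's
    inequality, obtained here from Maurey's property (tau): for functions with
    u(x) v(y) <= C e^(k c(x, y)), where the cost c(x, y) is the sum over coordinates
    of min (d^2, |d|^p), the product of the integrals is at most C. This property is
    stable under products of measures ([property_tau]). In dimension one it follows
    from the Prekopa-Leindler inequality after the monotone transport from the law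
    of density (cos a) / 2 ([property_tau1]): for that law, the square of the
    density at the midpoint exceeds the product of the densities at the end points
    by a factor that is a function of the odds ratio of the two transported points
    ([cosine_gain]), and the tails of e^(-|x|^p) make that factor exponential in the
    cost ([gain_ratio]). If A is a subset of the ball of unit volume, of volume at
    least 3 e / 4, a neighbourhood of radius at most 193 of its inflation has probability
    at least 3 e / 8 ([lp_prob_envelope]): the Gamma law lies in a window of relative
    width n^(-1/2), in which the points of norm O(sqrt n) of the inflated set move
    by O(1), and the other points have a volume that tends to 0
    ([lebesgue_large_norm_le], again by concentration). Hence two such sets at
    distance C (- ln e)^(1/p), which the inflation multiplies by at least a constant,
    contradict concentration ([upper_borel]).

    Lower bound. Opposite half-spaces have the required volumes. The volume of the
    part of the ball where x_1 <= a is a quotient of integrals of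
    (1 - |t|^p / omega^p)^((n - 1) / p). As omega^p / n tends to 1 / (p e Z^p), by
    Stirling's formula to first order ([slice_rate_cvg]), these functions converge
    to a multiple of the density of Psi p, and dominated convergence shows that the
    volume tends to Psi p a ([slab_cdf_cvg]).

    Asymptotics. Psi p is the distribution function of e^(-|x|^p) / Z up to scaling
    ([PsiE]), whose tail at y lies between e^(- (y + 1)^p) / Z and e^(- y^p)
    ([lp_quantile_bounds]). *)

(** * Affine changes of variables and integration over the first coordinate *)

Section affine.
Context {R : realType}.
Local Notation mu := (@lebesgue_measure R).

Lemma measurable_affine (a b : R) :
  measurable_fun [set: R] (fun x : R => a * x + b).
Proof. by apply: measurable_funD => //; exact: measurable_funM. Qed.

Lemma preimage_affine_ocitv (a b c d : R) : 0 < a ->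
  (fun x : R => a * x + b) @^-1` `]c, d]%classic =
  `](c - b) / a, (d - b) / a]%classic.
Proof.
move=> a0; apply/seteqP; split => x; rewrite /= !in_itv/=;
by rewrite ltr_pdivrMr// ler_pdivlMr// lerBrDr ltrBlDr mulrC.
Qed.

Lemma lebesgue_measure_affine (a b : R) (A : set R) : 0 < a -> measurable A ->
  mu ((fun x : R => a * x + b) @^-1` A) = (a^-1%:E * mu A)%E.
Proof.
move=> a0 mA.
have a0' : 0 <= a by exact: ltW.
pose phi := (fun x : R => a * x + b) : measurableTypeR R -> measurableTypeR R.
have mphi : measurable_fun setT phi by exact: measurable_affine.
pose nu := measure_function_pushforward__canonical__measure_function_Measure
  (mu : {measure set (measurableTypeR R) -> \bar R}) mphi.
have := @lebesgue_measure_unique R (mscale (NngNum a0') nu).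
move=> /(_ _ A mA) /= ->; last first.
  move=> _ [[c d]] _ <- /=.
  rewrite /mscale /= /nu /pushforward /= preimage_affine_ocitv//.
  rewrite !lebesgue_measure_itv/= !lte_fin ltr_pM2r ?invr_gt0// ltrD2r.
  case: ifPn => // _; last by rewrite mule0.
  by rewrite -!EFinB -EFinM; congr EFin; field; rewrite gt_eqF.
by rewrite /mscale /= muleA -EFinM mulVf ?gt_eqF// mul1e.
Qed.

Lemma ge0_integral_affine (a b : R) (f : R -> \bar R) : 0 < a ->
  measurable_fun setT f -> (forall x, 0 <= f x)%E ->
  (\int[mu]_x f (a * x + b)%R = a^-1%:E * \int[mu]_x f x)%E.
Proof.
move=> a0 mf f0.
have a0' : 0 <= a^-1 by rewrite invr_ge0 ltW.
pose phi := (fun x : R => a * x + b) : measurableTypeR R -> measurableTypeR R.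
have mphi : measurable_fun setT phi by exact: measurable_affine.
rewrite -[RHS](ge0_integral_mscale _ measurableT (NngNum a0'))//.
rewrite -[LHS]/(\int[mu]_(x in phi @^-1` setT) (f \o phi) x)%E.
rewrite -ge0_integral_pushforward//.
by apply: eq_measure_integral => /= A mA _; exact: lebesgue_measure_affine.
Qed.

Lemma ge0_integral_oppr (f : R -> \bar R) :
  measurable_fun setT f -> (forall x, 0 <= f x)%E ->
  (\int[mu]_x f (- x)%R = \int[mu]_x f x)%E.
Proof.
move=> mf f0.
pose phi := (-%R : R -> measurableTypeR R).
have mphi : measurable_fun setT (phi : measurableTypeR R -> measurableTypeR R).
  exact: measurable_funN.
rewrite -[LHS]/(\int[mu]_(x in phi @^-1` setT) (f \o phi) x)%E.
rewrite -ge0_integral_pushforward//.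
by apply: eq_measure_integral => /= A mA _; exact: lebesgue_measureN.
Qed.

End affine.

Lemma integral_setT_indic d (T : measurableType d) (R : realType)
    (m : {measure set T -> \bar R}) (A : set T) : measurable A ->
  (\int[m]_x (\1_A x)%:E = m A)%E.
Proof. by move=> mA; rewrite integral_indic// setIT. Qed.

Section tuples.
Context {R : realType}.
Local Notation mu := (@lebesgue_measure R).
Local Notation lam n := (@lebesgue_tuple R n).

Definition tcons n (t : R) (x : n.-tuple R) : n.+1.-tuple R :=
  [tuple of t :: x].

Lemma tnth_tcons0 n t (x : n.-tuple R) : tnth (tcons t x) ord0 = t.
Proof. exact: tnth0. Qed.

Lemma tnth_tconsS n t (x : n.-tuple R) i :
  tnth (tcons t x) (lift ord0 i) = tnth x i.
Proof. exact: tnthS. Qed.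

Lemma integral_lebesgue_tupleS n (f : n.+1.-tuple R -> \bar R) :
  measurable_fun setT f -> (forall x, 0 <= f x)%E ->
  (\int[lam n.+1]_x f x =
   \int[mu]_t \int[lam n]_x f (tcons t x))%E.
Proof.
move=> mf f0.
pose m2 : {measure set (measurableTypeR R * n.-tuple R)%type -> \bar R} :=
  (mu \x lam n)%E.
have mc : measurable_fun setT
    (@cons_pair R n : (measurableTypeR R * n.-tuple R)%type -> n.+1.-tuple R).
  exact: measurable_cons_pair.
rewrite -[LHS]/(\int[pushforward m2 (@cons_pair R n)]_x f x)%E.
rewrite (ge0_integral_pushforward mc)//.
rewrite preimage_setT fubini_tonelli1//; last first.
  by move=> x; exact: f0.
exact: measurableT_comp.
Qed.

Lemma measurable_cons_fix d (T : measurableType d) n (t : R)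
    (f : n.+1.-tuple R -> T) :
  measurable_fun setT f ->
  measurable_fun setT (fun x : n.-tuple R => f (tcons t x)).
Proof. by move=> mf; apply: measurableT_comp => //; exact: measurable_cons. Qed.

Lemma measurable_fun_fiber n (f : n.+1.-tuple R -> \bar R) :
  measurable_fun setT f -> (forall x, 0 <= f x)%E ->
  measurable_fun setT (fun t : R => \int[lam n]_x f (tcons t x))%E.
Proof.
move=> mf f0.
have mc : measurable_fun setT
    (@cons_pair R n : (measurableTypeR R * n.-tuple R)%type -> n.+1.-tuple R).
  exact: measurable_cons_pair.
have mF := measurableT_comp mf mc.
have F0 x : (0 <= (f \o @cons_pair R n) x)%E by exact: f0.
exact: (measurable_fun_fubini_tonelli_F (m2 := lam n) _ mF F0).
Qed.

Definition tscale n (a : R) (x : n.-tuple R) : n.-tuple R :=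
  [tuple a * tnth x i | i < n].

Lemma tnth_tscale n a (x : n.-tuple R) i : tnth (tscale a x) i = a * tnth x i.
Proof. by rewrite tnth_mktuple. Qed.

Lemma measurable_tscale n a : measurable_fun setT (@tscale n a).
Proof.
apply/measurable_fun_tnthP => i /=.
rewrite (_ : _ \o _ = fun x => a * tnth x i).
  by apply: measurable_funM => //; exact: measurable_tnth.
by apply/funext => x /=; rewrite tnth_tscale.
Qed.

Lemma tscale_cons n a t (x : n.-tuple R) :
  tscale a (tcons t x) = (tcons (a * t) (tscale a x)).
Proof.
apply: eq_from_tnth => i; rewrite tnth_tscale.
have [j ->|->] := unliftP ord0 i; last by rewrite !tnth_tcons0.
by rewrite !tnth_tconsS tnth_tscale.
Qed.

Lemma integral_tscale n (a : R) (f : n.-tuple R -> \bar R) : 0 < a ->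
  measurable_fun setT f -> (forall x, 0 <= f x)%E ->
  (\int[lam n]_x f (tscale a x) = (a ^- n)%:E * \int[lam n]_x f x)%E.
Proof.
move=> a0; elim: n f => [|n IH] f mf f0.
  rewrite expr0 invr1 mul1e; apply: eq_integral => x _; congr f.
  by apply: eq_from_tnth => -[].
rewrite !integral_lebesgue_tupleS//; last first.
  by apply: measurableT_comp => //; exact: measurable_tscale.
under eq_integral.
  move=> t _.
  under eq_integral do rewrite tscale_cons.
  rewrite (IH (fun x => f (tcons (a * t) x)))//; last first.
    exact: measurable_cons_fix.
  over.
pose g t := (\int[lam n]_x f (tcons t x))%E.
have mg : measurable_fun setT g by exact: measurable_fun_fiber.
have g0 t : (0 <= g t)%E by apply: integral_ge0.
have mga : measurable_fun setT (fun t : R => g (a * t)).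
  by apply: (measurableT_comp mg); exact: measurable_funM.
have an0 : (0 <= (a ^- n)%:E)%E by rewrite lee_fin invr_ge0 exprn_ge0// ltW.
transitivity (\int[mu]_t ((a ^- n)%:E * g (a * t)%R))%E => //.
rewrite (ge0_integralZl mu measurableT mga (fun t _ => g0 (a * t)) an0).
have -> : (\int[mu]_t g (a * t)%R = a^-1%:E * \int[mu]_t g t)%E.
  rewrite -(ge0_integral_affine 0 a0 mg g0).
  by apply: eq_integral => t _; rewrite addr0.
rewrite muleA -EFinM; congr (_%:E * _)%E.
by rewrite exprS invfM mulrC.
Qed.

Lemma lebesgue_tscale n (a : R) (A : set (n.-tuple R)) : 0 < a ->
  measurable A ->
  lam n (tscale a @^-1` A) = ((a ^- n)%:E * lam n A)%E.
Proof.
move=> a0 mA.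
have mA' : measurable (tscale a @^-1` A).
  by rewrite -[X in measurable X]setTI; exact: measurable_tscale.
rewrite -[LHS]integral_setT_indic// -[in RHS]integral_setT_indic//.
have m1 : measurable_fun setT (fun x : n.-tuple R => (\1_A x : R)%:E).
  by apply/measurable_EFinP; exact: measurable_indic.
by rewrite -(integral_tscale a0 m1)// => x; rewrite lee_fin.
Qed.

End tuples.

(** * Layer-cake formulas *)

Section layers.
Context {R : realType} d (T : measurableType d)
  (m : {sigma_finite_measure set T -> \bar R}).
Local Notation mu := (@lebesgue_measure R).

Lemma integral_layers (S : set (T * measurableTypeR R)) (k : R -> R) :
  measurable S -> measurable_fun setT k -> (forall t, 0 <= k t) ->
  (\int[m]_x \int[mu]_t ((\1_S (x, t) : R) * k t)%:E =
   \int[mu]_t ((k t)%:E * m (ysection S t)))%E.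
Proof.
move=> mS mk k0.
pose F (z : T * measurableTypeR R) : \bar R := ((\1_S z : R) * k z.2)%:E.
have mF : measurable_fun setT F.
  apply/measurable_EFinP; apply: measurable_funM; first exact: measurable_indic.
  by apply: measurableT_comp.
have F0 z : (0 <= F z)%E by rewrite lee_fin mulr_ge0.
rewrite [LHS](fubini_tonelli (m1 := m) (m2 := mu) _ mF F0).
apply: eq_integral => t _.
have mSt : measurable (ysection S t) by exact: measurable_ysection.
transitivity (\int[m]_x ((k t)%:E * (\1_(ysection S t) x)%:E))%E.
  apply: eq_integral => x _; rewrite /F -EFinM mulrC /=; congr (_ * _)%:E.
  by rewrite !indicE; congr (_%:R); rewrite mem_ysection.
have mi : measurable_fun setT (fun x => (\1_(ysection S t) x : R)%:E).
  by apply/measurable_EFinP; exact: measurable_indic.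
have i0 x : setT x -> (0 <= (\1_(ysection S t) x : R)%:E)%E by rewrite lee_fin.
have kt0 : (0 <= (k t)%:E)%E by rewrite lee_fin.
by rewrite (ge0_integralZl m measurableT mi i0 kt0) integral_setT_indic.
Qed.

Lemma integral_expRN (a : R) :
  (\int[mu]_(t in `[a, +oo[) (expR (- t))%:E = (expR (- a))%:E)%E.
Proof.
have c1 : continuous (fun x : R => expR (- x)).
  move=> x; apply: (@continuous_comp _ _ _ -%R expR).
    exact: opp_continuous.
  exact: continuous_expR.
have dF (x : R) : is_derive x (1 : R) (fun x : R => - expR (- x)) (expR (- x)).
  by apply: is_derive_eq; rewrite mulrN1 opprK.
rewrite (@ge0_continuous_FTC2y _ (fun x => expR (- x)) (fun x : R => - expR (- x)) a 0).
- by rewrite sub0e EFinN oppeK.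
- by move=> x _; exact: expR_ge0.
- by apply: continuous_subspaceT.
- by rewrite -[X in _ --> X]oppr0; apply: cvgN; exact: cvgr_expR.
- by move=> x _; exact: ex_derive.
- apply: cvg_at_right_filter; apply: cvgN; exact: c1.
- by move=> x _; rewrite derive1E derive_val.
Qed.

Lemma measurable_epigraph (E : set T) (g : T -> R) :
  measurable E -> measurable_fun setT g ->
  measurable [set z : T * measurableTypeR R | E z.1 /\ g z.1 <= z.2].
Proof.
move=> mE mg; rewrite (_ : mkset _ = fst @^-1` E `&`
    (fun z : T * measurableTypeR R => g z.1 <= z.2) @^-1` [set true]).
  apply: measurableI; rewrite -[X in measurable X]setTI.
    exact: measurable_fst.
  apply: (@measurable_fun_ler _ _ _ setT (fun z : T * measurableTypeR R => g z.1) snd) => //.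
  by apply: measurableT_comp.
by apply/seteqP; split => z.
Qed.

Lemma integral_expRN_layers (E : set T) (g : T -> R) :
  measurable E -> measurable_fun setT g ->
  (\int[m]_(x in E) (expR (- g x))%:E =
   \int[mu]_t ((expR (- t))%:E * m (E `&` [set x | (g x <= t)%R])))%E.
Proof.
move=> mE mg.
pose S : set (T * measurableTypeR R) := [set z | E z.1 /\ g z.1 <= z.2].
have mS : measurable S by exact: measurable_epigraph.
have := integral_layers mS (k := fun t => expR (- t)).
have -> : (fun t => (expR (- t))%:E * m (E `&` [set x | (g x <= t)%R]))%E =
    (fun t => (expR (- t))%:E * m (ysection S t))%E.
  apply/funext => t; congr (_ * m _)%E; apply/seteqP; split => x.
    by move=> [Ex gx]; rewrite /ysection /= inE.
  by rewrite /ysection /= inE.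
move=> <-; first last.
- by move=> t; exact: expR_ge0.
- by apply: measurableT_comp => //; exact: measurable_funN.
rewrite integral_mkcond; apply: eq_integral => x _; rewrite patchE.
case: ifPn => xE.
  rewrite -integral_expRN integral_mkcond; apply: eq_integral => t _.
  rewrite patchE indicE mem_setE in_itv/= andbT.
  have -> : ((x, t) \in S) = (g x <= t).
    by apply/idP/idP => [/[!inE] -[]//|gt]; rewrite inE; split => //; exact: set_mem.
  by case: ifPn => _; rewrite ?mul1r ?mul0r.
rewrite (eq_integral (fun=> 0%E)) ?integral0// => t _.
rewrite indicE memNset ?mul0r// => -[/= Ex _].
by move: xE; rewrite notin_setE.
Qed.

Lemma measurable_sublevels (E : set T) (g : T -> R) :
  measurable E -> measurable_fun setT g ->
  measurable_fun (setT : set R) (fun t : R => m (E `&` [set x | (g x <= t)%R])).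
Proof.
move=> mE mg.
pose S : set (T * measurableTypeR R) := [set z | E z.1 /\ g z.1 <= z.2].
have mS : measurable S by exact: measurable_epigraph.
have := measurable_fun_ysection m mS.
rewrite (_ : m \o ysection S = fun t : R => m (E `&` [set x | (g x <= t)%R]))//.
apply/funext => t /=; congr (m _); apply/seteqP; split => x;
by rewrite /ysection/= inE.
Qed.

Lemma ge0_integral_expRN_layers (E : set T) (g : T -> R) :
  measurable E -> measurable_fun setT g -> (forall x, 0 <= g x) ->
  (\int[m]_(x in E) (expR (- g x))%:E =
   \int[mu]_(t in `]0%R, +oo[)
     ((expR (- t))%:E * m (E `&` [set x | (g x <= t)%R])))%E.
Proof.
move=> mE mg g0; rewrite integral_expRN_layers//.
rewrite integral_itv_obnd_cbnd; last first.
  apply: measurable_funTS; apply: emeasurable_funM.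
    apply/measurable_EFinP; apply: (measurableT_comp (@measurable_expR R)).
    exact: (@oppr_measurable R setT).
  exact: measurable_sublevels.
rewrite [RHS]integral_mkcond; apply: eq_integral => t _.
rewrite patchE mem_setE in_itv/= andbT; case: ifPn => // t0.
rewrite (_ : _ `&` _ = set0) ?measure0 ?mule0//.
apply/seteqP; split => x //= -[_ gt].
by move: t0; rewrite (le_trans (g0 x) gt).
Qed.

Lemma integral_superlevels (g : T -> R) :
  measurable_fun setT g -> (forall x, 0 <= g x) ->
  (\int[m]_x (g x)%:E =
   \int[mu]_(s in `[0%R, +oo[) m [set x | (s < g x)%R])%E.
Proof.
move=> mg g0.
pose S : set (T * measurableTypeR R) := [set z | 0 <= z.2 < g z.1].
have mS : measurable S.
  rewrite (_ : S = (fun z : T * measurableTypeR R => 0 <= z.2) @^-1` [set true] `&`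
      (fun z : T * measurableTypeR R => z.2 < g z.1) @^-1` [set true]).
    apply: measurableI; rewrite -[X in measurable X]setTI.
      exact: (@measurable_fun_ler _ _ _ setT (fun=> 0) snd).
    apply: (@measurable_fun_ltr _ _ _ setT snd (fun z : T * measurableTypeR R => g z.1)) => //.
    exact: measurableT_comp.
  by apply/seteqP; split => z /= => [/andP[-> ->]|[? ?]]; [|apply/andP].
have SE x (s : R) : ((x, s) \in S) = (0 <= s < g x).
  by apply/idP/idP; rewrite inE.
have m1 : measurable_fun (setT : set R) (fun _ : R => 1 : R).
  exact: measurable_cst.
have := integral_layers mS (k := fun=> 1) m1 (fun=> ler01).
have -> : (\int[m]_x \int[mu]_t ((\1_S (x, t) : R) * 1)%:E = \int[m]_x (g x)%:E)%E.
  apply: eq_integral => x _.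
  transitivity (\int[mu]_t (\1_(`[0%R, g x[%classic : set R) t)%:E)%E.
    apply: eq_integral => t _; rewrite mulr1 !indicE SE mem_setE.
    by rewrite in_itv.
  rewrite integral_setT_indic//= lebesgue_measure_itv/= lte_fin.
  case: ltP => [_|g1]; first by rewrite -EFinB subr0.
  by congr EFin; apply/eqP; rewrite eq_le g0 g1.
move=> ->; rewrite [RHS]integral_mkcond; apply: eq_integral => s _.
rewrite mul1e patchE mem_setE in_itv/= andbT; case: ifPn => s0.
  by congr (m _); apply/seteqP; split => x; rewrite /ysection/= SE s0.
rewrite (_ : ysection S s = set0) ?measure0//.
by apply/seteqP; split => x //; rewrite /ysection/= SE (negbTE s0).
Qed.

Lemma measurable_superlevels (g : T -> R) : measurable_fun setT g ->
  measurable_fun (setT : set R) (fun s : R => m [set x | (s < g x)%R]).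
Proof.
move=> mg.
pose S : set (T * measurableTypeR R) := [set z | z.2 < g z.1].
have mS : measurable S.
  rewrite -[X in measurable X]setTI.
  apply: (@measurable_fun_ltr _ _ _ setT snd (fun z : T * measurableTypeR R => g z.1) _ _ measurableT [set true]) => //.
  exact: measurableT_comp.
have := measurable_fun_ysection m mS.
rewrite (_ : m \o ysection S = fun s : R => m [set x | (s < g x)%R])//.
apply/funext => s /=; congr (m _); apply/seteqP; split => x;
by rewrite /ysection/= inE.
Qed.

End layers.

(** * The Gamma function *)

Section gamma.
Context {R : realType}.
Local Notation mu := (@lebesgue_measure R).
Implicit Types N t : R.

Definition gamma_kernel N t : R := t `^ N * expR (- t).
Local Notation phi := gamma_kernel.

Lemma gamma_kernel_ge0 N t : 0 <= phi N t.
Proof. by rewrite mulr_ge0// ?powR_ge0// expR_ge0. Qed.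

Lemma measurable_expRN : measurable_fun setT (fun t : R => expR (- t)).
Proof.
apply: (measurableT_comp (@measurable_expR R)).
exact: (@oppr_measurable R setT).
Qed.

Lemma measurable_gamma_kernel N : measurable_fun setT (phi N).
Proof.
apply: measurable_funM; first exact: measurable_powR.
exact: measurable_expRN.
Qed.

Definition gamma_integral N := (\int[mu]_(t in `]0%R, +oo[) (phi N t)%:E)%E.
Local Notation eG := gamma_integral.

Lemma GammaE N : Gamma (1 + N) = fine (eG N).
Proof.
rewrite /Gamma /Rintegral; congr fine; apply: eq_integral => t _.
by rewrite addrAC subrr add0r.
Qed.

(** At fixed l, the function t^N e^(-l t) is maximal at t = N / l. *)
Lemma gamma_kernel_le N l t : 0 < N -> 0 < l < 1 -> 0 < t ->
  phi N t <= (N / (l * expR 1)) `^ N * expR (- ((1 - l) * t)).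
Proof.
move=> N0 /andP[l0 l1] t0; rewrite /phi.
have -> : - t = - (l * t) + - ((1 - l) * t) by ring.
rewrite expRD mulrA ler_pM2r ?expR_gt0//.
have h : l * t / N <= expR (l * t / N - 1).
  by have := expR_ge1Dx (l * t / N - 1); rewrite addrC subrK.
have h2 : (l * t / N) `^ N <= expR (l * t - N).
  have -> : expR (l * t - N) = expR (l * t / N - 1) `^ N.
    by rewrite -expRM; congr expR; field; rewrite gt_eqF.
  by rewrite ge0_ler_powR ?nnegrE ?expR_ge0// ?ltW// !mulr_gt0// invr_gt0.
have -> : t `^ N = (l * t / N) `^ N * (N / l) `^ N.
  rewrite -powRM ?divr_ge0 ?mulr_ge0// ?ltW//; congr (_ `^ _).
  by field; rewrite !gt_eqF.
have -> : (N / (l * expR 1)) `^ N = expR (- N) * (N / l) `^ N.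
  rewrite invfM mulrA powRM ?divr_ge0 ?invr_ge0 ?expR_ge0 ?ltW//.
  by rewrite mulrC -expRN -expRM mulN1r.
rewrite mulrAC ler_wpM2r ?powR_ge0//.
by rewrite -ler_pdivlMr ?expR_gt0// -expRN opprK -expRD addrC.
Qed.

Lemma integral_expR_scaled (l : R) : 0 < l ->
  (\int[mu]_(t in `]0%R, +oo[) (expR (- (l * t)))%:E = (l^-1)%:E)%E.
Proof.
move=> l0; rewrite integral_mkcond.
pose f (t : R) : \bar R := ((fun t => (expR (- t))%:E) \_ `]0%R, +oo[) t.
have mf : measurable_fun setT f.
  apply/(measurable_restrictT _ _).1 => //; apply/measurable_EFinP.
  exact: measurable_funTS measurable_expRN.
have f0 t : (0 <= f t)%E by apply: erestrict_ge0 => x _; rewrite lee_fin expR_ge0.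
transitivity (\int[mu]_t f (l * t + 0)%R)%E.
  apply: eq_integral => t _; rewrite /f addr0 !patchE !mem_setE !in_itv/= !andbT.
  by rewrite pmulr_rgt0.
rewrite ge0_integral_affine// /f -integral_mkcond.
rewrite integral_itv_obnd_cbnd ?integral_expRN; last first.
  apply/measurable_EFinP; exact: measurable_funTS measurable_expRN.
by rewrite oppr0 expR0 mule1.
Qed.

Lemma gamma_integral_le N l : 0 < N -> 0 < l < 1 ->
  (eG N <= ((N / (l * expR 1)) `^ N / (1 - l))%:E)%E.
Proof.
move=> N0 l01; have /andP[l0 l1] := l01.
have mE : measurable_fun (`]0%R, +oo[%classic : set R)
    (fun t : R => (expR (- ((1 - l) * t)))%:E).
  apply/measurable_EFinP; apply: measurable_funTS.
  by apply: (measurableT_comp measurable_expRN); exact: measurable_funM.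
rewrite EFinM -integral_expR_scaled ?subr_gt0//.
have c0 : (0 <= ((N / (l * expR 1)) `^ N)%:E)%E by rewrite lee_fin powR_ge0.
have E0 t : `]0%R, +oo[%classic t -> (0 <= (expR (- ((1 - l) * t)))%:E)%E.
  by rewrite lee_fin expR_ge0.
rewrite -(ge0_integralZl mu _ mE E0 c0)//.
apply: ge0_le_integral => //.
- by move=> t _; rewrite lee_fin gamma_kernel_ge0.
- by apply/measurable_EFinP; apply: measurable_funTS; exact: measurable_gamma_kernel.
- apply: measurable_funeM => //.
- move=> t /=; rewrite in_itv/= andbT => t0.
  by rewrite -EFinM lee_fin gamma_kernel_le.
Qed.

Lemma gamma_integral_fin N : 0 < N -> eG N \is a fin_num.
Proof.
move=> N0; rewrite ge0_fin_numE.
  by apply: (le_lt_trans (gamma_integral_le (l := 2^-1) N0 _)); rewrite ?ltry//; lra.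
by apply: integral_ge0 => t _; rewrite lee_fin gamma_kernel_ge0.
Qed.

Lemma gamma_integralE N : 0 < N -> eG N = (Gamma (1 + N))%:E.
Proof. by move=> N0; rewrite GammaE fineK// gamma_integral_fin. Qed.

Lemma Gamma_le N l : 0 < N -> 0 < l < 1 ->
  Gamma (1 + N) <= (N / (l * expR 1)) `^ N / (1 - l).
Proof. by move=> N0 l01; rewrite -lee_fin -gamma_integralE// gamma_integral_le. Qed.

(** The integrand is bounded below by its crudest bound on ]N, N + 1]. *)
Lemma Gamma_ge N : 0 < N -> N `^ N * expR (- (N + 1)) <= Gamma (1 + N).
Proof.
move=> N0; rewrite -lee_fin -gamma_integralE//.
have mphi D : measurable_fun D (fun t : R => (phi N t)%:E).
  apply: measurable_funTS; apply/measurable_EFinP; exact: measurable_gamma_kernel.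
have phi0 t : (0 <= (phi N t)%:E)%E by rewrite lee_fin gamma_kernel_ge0.
apply: (@le_trans _ _ (\int[mu]_(t in `]N, (N + 1)%R]) (phi N t)%:E)%E); last first.
  apply: ge0_subset_integral => //; first exact: mphi.
  by move=> t /=; rewrite !in_itv/= andbT => /andP[+ _]; exact: lt_trans.
have -> : (N `^ N * expR (- (N + 1)))%:E =
    (\int[mu]_(t in `]N, (N + 1)%R]) (cst (N `^ N * expR (- (N + 1)))%:E) t)%E.
  rewrite integral_cst//= lebesgue_measure_itv/= lte_fin ltrDl ltr01.
  by rewrite -EFinB addrAC subrr add0r mule1.
apply: ge0_le_integral => //.
  by move=> t _; rewrite lee_fin mulr_ge0 ?powR_ge0 ?expR_ge0.
  exact: mphi.
move=> t /=; rewrite in_itv/= => /andP[Nt tN].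
rewrite lee_fin ler_pM ?powR_ge0 ?expR_ge0//.
  by rewrite ge0_ler_powR ?nnegrE// ltW// (lt_trans N0).
by rewrite ler_expR lerN2.
Qed.

Lemma Gamma_gt0 N : 0 < N -> 0 < Gamma (1 + N).
Proof.
by move=> N0; apply: lt_le_trans (Gamma_ge N0); rewrite mulr_gt0 ?powR_gt0 ?expR_gt0.
Qed.

Lemma powR_continuous_at (q x : R) : 0 < x ->
  (fun y : R => y `^ q) @ x --> x `^ q.
Proof.
move=> x0.
have /derivable1_diffP/differentiable_continuous : derivable (@powR R ^~ q) x 1.
  by apply: derivable_powR; rewrite in_itv/= andbT.
exact.
Qed.

Lemma powR_norm_continuous (q : R) : 0 < q -> continuous (fun x : R => `|x| `^ q).
Proof.
move=> q0 x; have [->|x0] := eqVneq x 0; last first.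
  apply: (@continuous_comp R R R (fun y => `|y|) (fun y => y `^ q)).
    exact: norm_continuous.
  by apply: powR_continuous_at; rewrite normr_gt0.
rewrite /continuous_at /= normr0 powR0 ?gt_eqF//.
apply/cvgrPdist_le => /= e e0.
have h : \forall y \near (0 : R), `|y| < e `^ q^-1.
  by apply: nbhs0_lt; exact: powR_gt0.
apply: filterS h => y hy.
rewrite sub0r normrN ger0_norm ?powR_ge0//.
have -> : e = (e `^ q^-1) `^ q by rewrite -powRrM mulVf ?gt_eqF// powRr1// ltW.
by rewrite ge0_ler_powR ?nnegrE ?powR_ge0 ?(ltW q0)// ltW.
Qed.

Lemma integral_powR N t : 0 < N -> 0 <= t ->
  (\int[mu]_(x in `[0%R, t]) ((N + 1) * x `^ N)%:E = (t `^ (N + 1))%:E)%E.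
Proof.
move=> N0; rewrite le_eqVlt => /predU1P[<-|t0].
  by rewrite set_itv1 integral_set1 powR0// gt_eqF// addr_gt0.
have N10 : 0 < N + 1 by rewrite addr_gt0.
have cN (q : R) : 0 < q -> continuous (fun x : R => `|x| `^ q).
  exact: powR_norm_continuous.
transitivity (\int[mu]_(x in `[0%R, t]) ((N + 1) * `|x| `^ N)%:E)%E.
  apply: eq_integral => x; rewrite inE/= in_itv/= => /andP[x0 _].
  by rewrite ger0_norm.
rewrite (@continuous_FTC2 _ _ (fun x => x `^ (N + 1)))//.
- by rewrite powR0 ?gt_eqF// sube0.
- apply: continuous_subspaceT => x.
  by apply: cvgM; [exact: cvg_cst|exact: cN].
- split => [x||].
  + rewrite in_itv/= => /andP[x0 _].
    by apply: derivable_powR; rewrite in_itv/= andbT.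
  + by rewrite powR0 ?gt_eqF//; exact: powR_cvg0.
  + by apply: cvg_at_left_filter; exact: powR_continuous_at.
- move=> x; rewrite in_itv/= => /andP[x0 _].
  by rewrite powR_derive1 ?in_itv/= ?andbT// addrK gtr0_norm.
Qed.

(** Fubini applied to t^(N+1) = int_0^t (N+1) x^N dx replaces an improper
    integration by parts. *)
Lemma gamma_integralS N : 0 < N -> eG (N + 1) = ((N + 1)%:E * eG N)%E.
Proof.
move=> N0.
have N10 : 0 < N + 1 by rewrite addr_gt0.
pose S : set (measurableTypeR R * measurableTypeR R) := [set z | 0 < z.1 <= z.2].
have mS : measurable S.
  rewrite (_ : S = (fun z => 0 < z.1) @^-1` [set true] `&`
      (fun z => z.1 <= z.2) @^-1` [set true]).
    apply: measurableI; rewrite -[X in measurable X]setTI.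
      exact: (@measurable_fun_ltr _ _ _ setT (fun=> 0) fst).
    exact: (@measurable_fun_ler _ _ _ setT fst snd).
  by apply/seteqP; split => z /= => [/andP[-> ->]|[? ?]]; [|apply/andP].
pose F (z : measurableTypeR R * measurableTypeR R) : \bar R :=
  ((\1_S z : R) * ((N + 1) * z.1 `^ N) * expR (- z.2))%:E.
have mF : measurable_fun setT F.
  apply/measurable_EFinP; apply: measurable_funM.
    apply: measurable_funM; first exact: measurable_indic.
    apply: measurable_funM => //.
    exact: (measurableT_comp (@measurable_powR R N) measurable_fst).
  exact: (measurableT_comp measurable_expRN measurable_snd).
have F0 z : (0 <= F z)%E.
  by rewrite lee_fin !mulr_ge0 ?powR_ge0 ?expR_ge0 ?(ltW N10).
have FE (x t : R) : F (x, t) =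
    ((((0 < x) && (x <= t))%:R * ((N + 1) * x `^ N) * expR (- t))%:E).
  rewrite /F indicE (_ : ((x, t) \in S) = (0 < x <= t))//.
  by apply/idP/idP; rewrite inE.
have := fubini_tonelli (m1 := mu) (m2 := mu) _ mF F0.
have -> : (\int[mu]_x \int[mu]_y F (x, y) = (N + 1)%:E * eG N)%E.
  have m1 : measurable_fun (`]0%R, +oo[%classic : set R)
      (fun t : R => (phi N t)%:E).
    apply: measurable_funTS; apply/measurable_EFinP.
    exact: measurable_gamma_kernel.
  have p1 t : `]0%R, +oo[%classic t -> (0 <= (phi N t)%:E)%E.
    by rewrite lee_fin gamma_kernel_ge0.
  have p2 : (0 <= (N + 1)%:E)%E by rewrite lee_fin ltW.
  rewrite -(ge0_integralZl mu _ m1 p1 p2)// [RHS]integral_mkcond.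
  apply: eq_integral => x _; rewrite patchE mem_setE in_itv/= andbT.
  case: ifPn => x0; last first.
    rewrite (eq_integral (fun=> 0%E)) ?integral0// => t _.
    by rewrite FE (negbTE x0) !mul0r.
  have c0 : (0 <= ((N + 1) * x `^ N)%:E)%E.
    by rewrite lee_fin mulr_ge0 ?powR_ge0 ?(ltW N10).
  have m2 : measurable_fun (`[x, +oo[%classic : set R)
      (fun t : R => (expR (- t))%:E).
    apply: measurable_funTS; apply/measurable_EFinP; exact: measurable_expRN.
  have p3 t : `[x, +oo[%classic t -> (0 <= (expR (- t))%:E)%E.
    by rewrite lee_fin expR_ge0.
  transitivity (((N + 1) * x `^ N)%:E * \int[mu]_(t in `[x, +oo[) (expR (- t))%:E)%E.
    rewrite -(ge0_integralZl mu _ m2 p3 c0)// [RHS]integral_mkcond.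
    apply: eq_integral => t _; rewrite FE x0/= patchE mem_setE in_itv/= andbT.
    by case: ifPn => _; rewrite ?mul1r ?mul0r// EFinM.
  by rewrite integral_expRN -!EFinM mulrA.
have -> : (\int[mu]_y \int[mu]_x F (x, y) = eG (N + 1))%E.
  rewrite [RHS]integral_mkcond; apply: eq_integral => t _.
  rewrite patchE mem_setE in_itv/= andbT.
  case: ifPn => t0; last first.
    rewrite (eq_integral (fun=> 0%E)) ?integral0// => x _; rewrite FE.
    rewrite (_ : _ && _ = false) ?mul0r//.
    by apply/negP => /andP[x0 xt]; move: t0; rewrite (lt_le_trans x0).
  have c0 : (0 <= (expR (- t))%:E)%E by rewrite lee_fin expR_ge0.
  have m2 : measurable_fun (`]0%R, t]%classic : set R)
      (fun x : R => ((N + 1) * x `^ N)%:E).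
    apply: measurable_funTS; apply/measurable_EFinP.
    by apply: measurable_funM => //; exact: measurable_powR.
  have p3 x : `]0%R, t]%classic x -> (0 <= ((N + 1) * x `^ N)%:E)%E.
    by rewrite lee_fin mulr_ge0 ?powR_ge0 ?(ltW N10).
  transitivity ((expR (- t))%:E * \int[mu]_(x in `]0%R, t]) ((N + 1) * x `^ N)%:E)%E.
    rewrite -(ge0_integralZl mu _ m2 p3 c0)// [RHS]integral_mkcond.
    apply: eq_integral => x _; rewrite FE patchE mem_setE in_itv/=.
    by case: ifPn => _; rewrite ?mul1r ?mul0r// -EFinM mulrC.
  rewrite integral_itv_obnd_cbnd// integral_powR ?(ltW t0)//.
  by rewrite -EFinM mulrC.
by [].
Qed.

Definition gamma_window N : set R :=
  [set t | 0 < t /\ `|t - (N + 1)| <= 2 * Num.sqrt (N + 1)].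

Lemma measurable_gamma_window N : measurable (gamma_window N).
Proof.
rewrite (_ : gamma_window N = `]0%R, +oo[%classic `&`
  `[N + 1 - 2 * Num.sqrt (N + 1), N + 1 + 2 * Num.sqrt (N + 1)]%classic).
  exact: measurableI.
by apply/seteqP; split => t; rewrite /gamma_window /= !in_itv/= andbT ler_distl.
Qed.

(** The Gamma law of parameter N+1 has mean and variance N+1; this is Chebyshev's
    inequality for it at twice the standard deviation. *)
Lemma gamma_window_ge N : 0 < N ->
  ((3 / 4 * Gamma (1 + N))%:E <=
   \int[mu]_(t in gamma_window N) (phi N t)%:E)%E.
Proof.
move=> N0.
set t0 := N + 1; set G := Gamma (1 + N).
have t00 : 0 < t0 by rewrite addr_gt0.
pose D := (`]0%R, +oo[%classic : set R).
have mD : measurable D by exact: measurable_itv.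
have mphi M E : measurable_fun E (fun t : R => (phi M t)%:E).
  apply: measurable_funTS; apply/measurable_EFinP; exact: measurable_gamma_kernel.
have p0 M t : (0 <= (phi M t)%:E)%E by rewrite lee_fin gamma_kernel_ge0.
have G0 : (\int[mu]_(t in D) (phi N t)%:E = G%:E)%E by exact: gamma_integralE.
have phiS M t : 0 < t -> phi (M + 1) t = t * phi M t.
  move=> tp; rewrite /phi powRD; last by rewrite (gt_eqF tp) implybT.
  by rewrite powRr1 ?(ltW tp)// mulrA (mulrC t).
have G1 : (\int[mu]_(t in D) (phi (N + 1) t)%:E = (t0 * G)%:E)%E.
  by rewrite -/(eG (N + 1)) gamma_integralS// /gamma_integral G0 -EFinM.
have G2 : (\int[mu]_(t in D) (phi (N + 1 + 1) t)%:E = ((t0 + 1) * (t0 * G))%:E)%E.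
  by rewrite -/(eG (N + 1 + 1)) gamma_integralS// /gamma_integral G1 -EFinM.
pose q t := (t - t0) ^+ 2 * phi N t.
have q0 t : (0 <= (q t)%:E)%E by rewrite lee_fin mulr_ge0 ?sqr_ge0 ?gamma_kernel_ge0.
have mq E : measurable_fun E (fun t : R => (q t)%:E).
  apply: measurable_funTS; apply/measurable_EFinP.
  apply: measurable_funM; last exact: measurable_gamma_kernel.
  by apply: measurable_funX; apply: measurable_funB.
have J : (\int[mu]_(t in D) (q t)%:E = (t0 * G)%:E)%E.
  have h : (\int[mu]_(t in D) (q t)%:E + (2 * t0)%:E * (t0 * G)%:E =
      ((t0 + 1) * (t0 * G))%:E + (t0 ^+ 2)%:E * G%:E)%E.
    have c1 : (0 <= (2 * t0)%:E)%E by rewrite lee_fin mulr_ge0 ?ltW.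
    have c2 : (0 <= (t0 ^+ 2)%:E)%E by rewrite lee_fin sqr_ge0.
    have mM c M : measurable_fun D (fun t : R => c%:E * (phi M t)%:E)%E.
      by apply: measurable_funeM.
    have z1 := ge0_integralZl mu mD (mphi (N + 1) D) (fun t _ => p0 _ t) c1.
    have z2 := ge0_integralZl mu mD (mphi N D) (fun t _ => p0 _ t) c2.
    rewrite -G1 -z1 -G2 -G0 -z2.
    have -> := esym (ge0_integralD mu mD (fun t _ => q0 t) (mq D)
      (fun t _ => mule_ge0 c1 (p0 _ t)) (mM _ _)).
    have -> := esym (ge0_integralD mu mD (fun t _ => p0 (N + 1 + 1) t) (mphi _ D)
      (fun t _ => mule_ge0 c2 (p0 _ t)) (mM _ _)).
    apply: eq_integral => t; rewrite inE /D /= in_itv/= andbT => tp.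
    by rewrite -!EFinM -!EFinD !phiS// /q; congr EFin; ring.
  move: h; rewrite -!EFinM -EFinD => h.
  have fq : (\int[mu]_(t in D) (q t)%:E)%E \is a fin_num.
    have := congr1 (fun x => x \is a fin_num) h.
    by rewrite fin_numD => /andP[].
  move: h; rewrite -(fineK fq) -EFinD => -[] h; congr EFin.
  by apply: (addIr (2 * t0 * (t0 * G))); rewrite h; ring.
have mW := measurable_gamma_window N.
have WD : gamma_window N `<=` D by move=> t [tp _]; rewrite /D /= in_itv/= andbT.
have mDW : measurable (D `\` gamma_window N) by exact: measurableD.
have split_D : (\int[mu]_(t in D) (phi N t)%:E =
    \int[mu]_(t in gamma_window N) (phi N t)%:E +
    \int[mu]_(t in D `\` gamma_window N) (phi N t)%:E)%E.
  rewrite -[in LHS](setDUK WD) ge0_integral_setU//.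
    exact: mphi.
  by apply/disj_setPS => t [] ? [].
have tail : ((4 * t0)%:E * \int[mu]_(t in D `\` gamma_window N) (phi N t)%:E <=
    (t0 * G)%:E)%E.
  have c1 : (0 <= (4 * t0)%:E)%E by rewrite lee_fin mulr_ge0 ?ltW.
  have -> := esym (ge0_integralZl mu mDW (mphi _ _) (fun t _ => p0 N t) c1).
  rewrite -J.
  apply: (@le_trans _ _ (\int[mu]_(t in D `\` gamma_window N) (q t)%:E)%E).
    apply: (ge0_le_integral mu mDW (fun t _ => mule_ge0 c1 (p0 N t)) _ (mq _)).
    - by apply: measurable_funeM; exact: mphi.
    - move=> t [/= Dt nW]; rewrite -EFinM lee_fin /q ler_wpM2r ?gamma_kernel_ge0//.
      have tp : 0 < t by move: Dt; rewrite /D/= in_itv/= andbT.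
      have : 2 * Num.sqrt t0 < `|t - t0|.
        by rewrite ltNge; apply/negP => h; apply: nW; split.
      move=> /ltW h.
      rewrite -real_normK ?num_real// (_ : 4 * t0 = (2 * Num.sqrt t0) ^+ 2).
        by rewrite ler_pXn2r ?nnegrE// mulr_ge0 ?sqrtr_ge0.
      by rewrite exprMn sqr_sqrtr ?ltW//; ring.
  apply: ge0_subset_integral => //; exact: mq.
have tail2 : (\int[mu]_(t in D `\` gamma_window N) (phi N t)%:E <= (4^-1 * G)%:E)%E.
  have -> : (4^-1 * G)%:E = (((4 * t0)^-1)%:E * (t0 * G)%:E)%E.
    by rewrite -EFinM; congr EFin; field; rewrite gt_eqF.
  rewrite -[leLHS]mul1e -(_ : ((4 * t0)^-1)%:E * (4 * t0)%:E = 1%:E)%E; last first.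
    by rewrite -EFinM mulVf// gt_eqF// mulr_gt0.
  by rewrite -muleA lee_wpmul2l// lee_fin invr_ge0 mulr_ge0 ?ltW.
rewrite -(@leeD2rE _ (4^-1 * G)%:E)//.
rewrite -EFinD -mulrDl (_ : 3 / 4 + 4^-1 = 1) ?mul1r; last by field.
by rewrite -G0 split_D leeD2l.
Qed.

End gamma.

(** * The Prekopa-Leindler inequality on the line *)

Section prekopa_leindler.
Context {R : realType}.
Local Notation mu := (@lebesgue_measure R).

(** If a is close to sup A and b to inf B, the translates (A + b)/2 and
    (a + B)/2 of the halved sets overlap in measure as little as one wants. *)
Lemma lebesgue_midpoints (A B C : set R) :
  measurable A -> measurable B -> measurable C ->
  A !=set0 -> B !=set0 -> has_ubound A -> has_lbound B ->
  (forall a b, A a -> B b -> C ((a + b) / 2)) ->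
  (mu A + mu B <= 2%:E * mu C)%E.
Proof.
move=> mA mB mC A0 B0 uA lB ABC.
apply/lee_addgt0Pr => e e0.
have e2 : 0 < e / 2 by rewrite divr_gt0.
have [a Aa ha] := sup_adherent e2 (conj A0 uA).
have [b Bb hb] := inf_adherent e2 (conj B0 lB).
pose A1 := A `&` `]-oo, a[%classic; pose B1 := B `&` `[b, +oo[%classic.
have mA1 : measurable A1 by exact: measurableI.
have mB1 : measurable B1 by exact: measurableI.
have hA : (mu A <= mu A1 + (e / 2)%:E)%E.
  apply: (@le_trans _ _ (mu A1 + mu `[a, sup A]%classic)%E); last first.
    rewrite leeD2l// lebesgue_measure_itv/= lte_fin; case: ifPn => _.
      by rewrite -EFinB lee_fin lerBlDr addrC -lerBlDr ltW.
    by rewrite lee_fin ltW// divr_gt0.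
  apply: le_trans (measureU2 _ _ _) => //.
  apply: le_measure; rewrite ?inE//; first exact: measurableU.
  move=> x Ax; have [xa|ax] := ltP x a; [left|right] => /=.
    by split=> //=; rewrite in_itv.
  by rewrite in_itv/= ax/= ub_le_sup.
have hB : (mu B <= mu B1 + (e / 2)%:E)%E.
  apply: (@le_trans _ _ (mu B1 + mu `[inf B, b]%classic)%E); last first.
    rewrite leeD2l// lebesgue_measure_itv/= lte_fin; case: ifPn => _.
      by rewrite -EFinB lee_fin lerBlDr addrC ltW.
    by rewrite lee_fin ltW// divr_gt0.
  apply: le_trans (measureU2 _ _ _) => //.
  apply: le_measure; rewrite ?inE//; first exact: measurableU.
  move=> x Bx; have [bx|xb] := leP b x; [left|right] => /=.
    by split=> //=; rewrite in_itv/= bx.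
  by rewrite in_itv/= (ltW xb) andbT ge_inf.
pose C1 := (fun c : R => 2 * c + - b) @^-1` A1.
pose C2 := (fun c : R => 2 * c + - a) @^-1` B1.
have m1 : mu C1 = (2^-1%:E * mu A1)%E by apply: lebesgue_measure_affine.
have m2 : mu C2 = (2^-1%:E * mu B1)%E by apply: lebesgue_measure_affine.
have mC1 : measurable C1.
  by rewrite -[X in measurable X]setTI; exact: measurable_affine.
have mC2 : measurable C2.
  by rewrite -[X in measurable X]setTI; exact: measurable_affine.
have C12 : [disjoint C1 & C2].
  apply/disj_setPS => c [[_ /=]]; rewrite !in_itv/= => h1 [_ /=].
  by rewrite in_itv/= andbT => h2; exfalso; lra.
have C12C : C1 `|` C2 `<=` C.
  move=> c [[+ _]|[+ _]] => h.
    by have := ABC _ _ h Bb; congr C; field.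
  by have := ABC _ _ Aa h; congr C; field.
have hC : (2^-1%:E * mu A1 + 2^-1%:E * mu B1 <= mu C)%E.
  rewrite -m1 -m2 -measureU//; last exact/disj_set2P.
  by apply: le_measure; rewrite ?inE//; exact: measurableU.
apply: (@le_trans _ _ ((mu A1 + (e / 2)%:E) + (mu B1 + (e / 2)%:E))%E).
  exact: leeD.
rewrite addeACA -EFinD -splitr leeD2r//.
have p2 : (0 <= 2%:E :> \bar R)%E by rewrite lee_fin.
by have := lee_wpmul2l p2 hC; rewrite ge0_muleDr ?mule_ge0// !muleA -EFinM divff// !mul1e.
Qed.

(** After division of f and g by their suprema, all superlevel sets of f and g at
    heights in [0, 1[ are nonempty, and the midpoints of these sets lie in the
    superlevel set of h at the same height. Integrating the inequality between
    their measures bounds the sum of the two integrals, and the inequality of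
    the arithmetic and geometric means turns the sum into the product. *)
Lemma prekopa_leindler (f g h : R -> R) (K L c : R) : 0 <= L ->
  measurable_fun setT f -> measurable_fun setT g -> measurable_fun setT h ->
  (forall x, 0 <= f x <= K) -> (forall x, 0 <= g x <= K) ->
  (forall x, 0 <= h x) ->
  (forall x, L < `|x| -> f x = 0) -> (forall x, L < `|x| -> g x = 0) ->
  (forall a b, f a * g b <= h ((a + b) / 2) ^+ 2) ->
  (\int[mu]_x (h x)%:E = c%:E)%E ->
  ((\int[mu]_x (f x)%:E) * (\int[mu]_x (g x)%:E) <= (c ^+ 2)%:E)%E.
Proof.
move=> L0 mf mg mh f0 g0 h0 fs gs fgh hc.
have int_fin (u : R -> R) : (forall x, 0 <= u x <= K) ->
    (forall x, L < `|x| -> u x = 0) -> measurable_fun setT u ->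
    (\int[mu]_x (u x)%:E)%E \is a fin_num.
  move=> u0 us mu0; rewrite ge0_fin_numE; last first.
    by apply: integral_ge0 => x _; rewrite lee_fin; have /andP[] := u0 x.
  have K0 : 0 <= K by have /andP[/le_trans] := u0 0; apply.
  rewrite (_ : \int[mu]_x (u x)%:E = \int[mu]_(x in `[(- L)%R, L]%classic) (u x)%:E)%E.
    apply: (@le_lt_trans _ _ (\int[mu]_(x in `[(- L)%R, L]%classic) cst K%:E x)%E).
      apply: ge0_le_integral => //.
      - by move=> x _; rewrite lee_fin; have /andP[] := u0 x.
      - by apply: measurable_funTS; apply/measurable_EFinP.
      - by move=> x _; rewrite lee_fin; have /andP[] := u0 x.
    rewrite integral_cst//= lebesgue_measure_itv/=.
    by case: ifP => _; rewrite -?EFinB -EFinM ltry.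
  rewrite [RHS]integral_mkcond; apply: eq_integral => x _.
  rewrite patchE mem_setE in_itv/=; case: ifPn => //.
  by rewrite -ler_norml -ltNge => /us ->.
have ff := int_fin _ f0 fs mf.
have fg := int_fin _ g0 gs mg.
have sup_pos (u : R -> R) : (forall x, 0 <= u x <= K) ->
    \int[mu]_x u x != 0 -> exists2 F, 0 < F &
      (forall x, u x <= F) /\ (forall s, s < 1 -> exists x, F * s < u x).
  move=> u0 un0.
  have hs : has_sup (range u).
    by split; [exists (u 0), 0|exists K => _ [x _ <-]; have /andP[] := u0 x].
  have ule x : u x <= sup (range u).
    by apply: ub_le_sup; [exact: hs.2|exists x].
  have F0 : 0 < sup (range u).
    rewrite lt_neqAle (le_trans _ (ule 0)) ?andbT; last by have /andP[] := u0 0.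
    apply: contra_neq un0 => F0; rewrite /Rintegral (eq_integral (fun=> 0%E)) ?integral0// => x _.
    by congr EFin; apply/eqP; rewrite eq_le {1}F0 ule; have /andP[] := u0 x.
  exists (sup (range u)) => //; split => // s s1.
  have [|_ [x _ <-] hx] := @sup_adherent _ (range u) (sup (range u) * (1 - s)) _ hs.
    by rewrite mulr_gt0// subr_gt0.
  by exists x; move: hx; rewrite mulrBr mulr1 opprB addrCA subrr addr0.
have [F0|F0] := eqVneq (\int[mu]_x f x) 0.
  by rewrite -(fineK ff) -/(Rintegral _ _ _) F0 mul0e lee_fin sqr_ge0.
have [G0|G0] := eqVneq (\int[mu]_x g x) 0.
  by rewrite -(fineK fg) -/(Rintegral _ _ _) G0 mule0 lee_fin sqr_ge0.
have [F Fp [fF Fs]] := sup_pos _ f0 F0.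
have [G Gp [gG Gs]] := sup_pos _ g0 G0.
have FG0 : 0 < F * G by rewrite mulr_gt0.
pose r := Num.sqrt (F * G).
have r0 : 0 < r by rewrite sqrtr_gt0.
have r2 : r ^+ 2 = F * G by rewrite sqr_sqrtr// ltW.
have msup (u : R -> R) (s : R) : measurable_fun setT u -> measurable [set x | s < u x].
  move=> mu0; rewrite -[X in measurable X]setTI.
  exact: (measurable_fun_ltr (measurable_cst s) mu0 measurableT (Y := [set true])).
have mdiv (u : R -> R) (k : R) : measurable_fun setT u ->
    measurable_fun setT (fun x => u x / k).
  by move=> mu0; apply: measurable_funM.
have key (s : R) : 0 <= s < 1 ->
    (mu [set x | (s < f x / F)%R] + mu [set x | (s < g x / G)%R] <=
     2%:E * mu [set x | (s < h x / r)%R])%E.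
  move=> /andP[s0 s1].
  have pos (u : R -> R) (k : R) x : 0 < k -> s < u x / k -> 0 < u x.
    by move=> k0 /(le_lt_trans s0); rewrite pmulr_lgt0 ?invr_gt0.
  have in1 (u : R -> R) x : (forall x, L < `|x| -> u x = 0) -> 0 < u x -> `|x| <= L.
    by move=> us ux; rewrite leNgt; apply/negP => /us u0; rewrite u0 ltxx in ux.
  apply: lebesgue_midpoints.
  - by apply: msup; exact: mdiv.
  - by apply: msup; exact: mdiv.
  - by apply: msup; exact: mdiv.
  - by have [x hx] := Fs _ s1; exists x => /=; rewrite ltr_pdivlMr// mulrC.
  - by have [x hx] := Gs _ s1; exists x => /=; rewrite ltr_pdivlMr// mulrC.
  - exists L => x /= /(pos _ _ _ Fp) /(in1 _ _ fs).
    by rewrite ler_norml => /andP[].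
  - exists (- L) => x /= /(pos _ _ _ Gp) /(in1 _ _ gs).
    by rewrite ler_norml => /andP[].
  - move=> a b /= sa sb.
    rewrite -(ltr_pXn2r (n := 2))// ?nnegrE ?divr_ge0 ?h0 ?(ltW r0)//.
    rewrite exprMn exprVn r2 (lt_le_trans (y := f a / F * (g b / G)))//.
      by rewrite expr2 ltr_pM.
    rewrite mulrACA -invfM ler_wpM2r//.
    by rewrite invr_ge0 ltW.
have layer (u : R -> R) (k : R) : 0 < k -> (forall x, 0 <= u x) ->
    measurable_fun setT u ->
    (\int[mu]_x (u x / k)%:E =
     \int[mu]_(s in `[0%R, +oo[) mu [set x | (s < u x / k)%R])%E.
  move=> k0 u0 mu0; apply: (@integral_superlevels _ _ _ mu); first exact: mdiv.
  by move=> x; rewrite divr_ge0// ltW.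
pose I01 := (`[0, 1[%classic : set R).
have layer1 (u : R -> R) (k : R) : 0 < k -> (forall x, 0 <= u x <= k) ->
    measurable_fun setT u ->
    (\int[mu]_x (u x / k)%:E =
     \int[mu]_(s in I01) mu [set x | (s < u x / k)%R])%E.
  move=> k0 u0 mu0; rewrite layer//; last by move=> x; have /andP[] := u0 x.
  rewrite [LHS]integral_mkcond [RHS]integral_mkcond; apply: eq_integral => s _.
  rewrite !patchE !mem_setE !in_itv/= andbT; have [s0|//] := boolP (0 <= s).
  have [//|s1] := ltP s 1.
  rewrite (_ : [set x | _] = set0) ?measure0//.
  apply/seteqP; split => x //=; rewrite ltr_pdivlMr// => h1.
  have /andP[_ h2] := u0 x.
  by have := lt_le_trans h1 h2; rewrite ltNge ler_peMl// ltW.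
have f01 x : 0 <= f x <= F by rewrite fF andbT; have /andP[] := f0 x.
have g01 x : 0 <= g x <= G by rewrite gG andbT; have /andP[] := g0 x.
have mlev : forall (v : R -> R) (E : set R), measurable_fun setT v ->
    measurable_fun E (fun s : R => mu [set x | (s < v x)%R]).
  by move=> v E mu0; apply: measurable_funTS; exact: (measurable_superlevels mu mu0).
have mI01 : measurable I01 by exact: measurable_itv.
have m0 (u : R -> R) s : I01 s -> (0 <= mu [set x | (s < u x)%R])%E by [].
have main : (\int[mu]_x (f x / F)%:E + \int[mu]_x (g x / G)%:E <=
    2%:E * \int[mu]_x (h x / r)%:E)%E.
  rewrite (layer1 f F)// (layer1 g G)// (layer h r)//.
  rewrite -(ge0_integralD mu mI01 (m0 _) (mlev _ _ (mdiv _ _ mf)) (m0 _) (mlev _ _ (mdiv _ _ mg))).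
  have p2 : (0 <= 2%:E :> \bar R)%E by rewrite lee_fin.
  apply: (@le_trans _ _ (\int[mu]_(s in I01) (2%:E * mu [set x | (s < h x / r)%R]))%E).
    have n1 s : I01 s -> (0 <= mu [set x | (s < f x / F)%R] +
        mu [set x | (s < g x / G)%R])%E by move=> _; rewrite adde_ge0.
    apply: (ge0_le_integral mu mI01 n1).
    - by apply: emeasurable_funD; apply: mlev; exact: mdiv.
    - by apply: measurable_funeM; apply: mlev; exact: mdiv.
    - by move=> s; rewrite /I01/= in_itv/= => /key.
  rewrite (ge0_integralZl mu mI01 (mlev _ _ (mdiv _ _ mh)) (m0 _) p2).
  rewrite lee_wpmul2l//; apply: ge0_subset_integral => //.
    by apply: mlev; exact: mdiv.
  by move=> s /=; rewrite !in_itv/= andbT => /andP[].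
have intdiv (u : R -> R) (k v : R) : 0 < k -> (forall x, 0 <= u x) ->
    measurable_fun setT u -> (\int[mu]_x (u x)%:E = v%:E)%E ->
    (\int[mu]_x (u x / k)%:E = (v / k)%:E)%E.
  move=> k0 u0 mu0 uv.
  have mu1 : measurable_fun setT (fun x => (u x)%:E) by exact/measurable_EFinP.
  have u1 x : setT x -> (0 <= (u x)%:E)%E by rewrite lee_fin.
  have k1 : (0 <= (k^-1)%:E)%E by rewrite lee_fin invr_ge0 ltW.
  rewrite mulrC EFinM -uv -(ge0_integralZl mu measurableT mu1 u1 k1).
  by apply: eq_integral => x _; rewrite mulrC EFinM.
have f0' x : 0 <= f x by have /andP[] := f0 x.
have g0' x : 0 <= g x by have /andP[] := g0 x.
move: main; rewrite -(fineK ff) -(fineK fg).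
rewrite (intdiv f F _ Fp f0' mf (esym (fineK ff))).
rewrite (intdiv g G _ Gp g0' mg (esym (fineK fg))).
rewrite (intdiv h r _ r0 h0 mh hc) -!EFinM -EFinD !lee_fin.
set a := fine _; set b := fine _ => main.
have a0 : 0 <= a.
  by apply: fine_ge0; apply: integral_ge0 => x _; rewrite lee_fin.
have b0 : 0 <= b.
  by apply: fine_ge0; apply: integral_ge0 => x _; rewrite lee_fin.
have aF : 0 <= a / F by rewrite divr_ge0// ltW.
have bG : 0 <= b / G by rewrite divr_ge0// ltW.
have h1 : (a / F + b / G) ^+ 2 <= (2 * (c / r)) ^+ 2.
  by rewrite ler_pXn2r// nnegrE ?addr_ge0//; apply: le_trans main; exact: addr_ge0.
have h2 : 4 * ((a / F) * (b / G)) <= (a / F + b / G) ^+ 2.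
  by rewrite -subr_ge0 (_ : _ - _ = (a / F - b / G) ^+ 2) ?sqr_ge0//; ring.
have := le_trans h2 h1.
rewrite exprMn exprMn exprVn r2.
rewrite (_ : 2 ^+ 2 = 4 :> R); last by ring.
rewrite ler_pM2l// mulrACA -invfM ler_pM2r// invr_gt0.
by [].
Qed.

End prekopa_leindler.

(** * The volume of the balls *)

Section lp_volumes.
Context {R : realType} (p : R) (hp : 1 <= p <= 2).
Local Notation mu := (@lebesgue_measure R).
Local Notation lam n := (@lebesgue_tuple R n).

Lemma p_gt0 : 0 < p. Proof. by have /andP[/(lt_le_trans ltr01)] := hp. Qed.
Hint Resolve p_gt0 : core.
Lemma p_neq0 : p != 0. Proof. by rewrite gt_eqF. Qed.
Lemma pV_gt0 : 0 < p^-1. Proof. by rewrite invr_gt0. Qed.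
Hint Resolve pV_gt0 : core.

Definition rho (x : R) : R := expR (- `|x| `^ p).
Definition rho_mass : R := 2 * Gamma (1 + p^-1).
Local Notation Z := rho_mass.

Lemma rho_mass_gt0 : 0 < Z. Proof. by rewrite mulr_gt0// Gamma_gt0. Qed.

Lemma rho_continuous : continuous rho.
Proof.
move=> x; apply: (@continuous_comp R R R (fun x : R => - `|x| `^ p) expR).
  by apply: cvgN; exact: powR_norm_continuous.
exact: continuous_expR.
Qed.

Lemma measurable_rho : measurable_fun setT rho.
Proof. by apply: continuous_measurable_fun; exact: rho_continuous. Qed.

Lemma rho_gt0 x : 0 < rho x. Proof. exact: expR_gt0. Qed.

Lemma rho_le1 x : rho x <= 1.
Proof. by rewrite -expR0 ler_expR oppr_le0 powR_ge0. Qed.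

Lemma rhoN x : rho (- x) = rho x. Proof. by rewrite /rho normrN. Qed.

Lemma measurable_powR_norm : measurable_fun setT (fun x : R => `|x| `^ p).
Proof. by apply: continuous_measurable_fun; exact: powR_norm_continuous. Qed.

Lemma powRK x : 0 <= x -> (x `^ p) `^ p^-1 = x.
Proof. by move=> x0; rewrite -powRrM divff ?p_neq0// powRr1. Qed.

Lemma powRVK x : 0 <= x -> (x `^ p^-1) `^ p = x.
Proof. by move=> x0; rewrite -powRrM mulVf ?p_neq0// powRr1. Qed.

Lemma powR_le_powRV x t : 0 <= x -> 0 <= t -> (x `^ p <= t) = (x <= t `^ p^-1).
Proof.
move=> x0 t0; apply/idP/idP => h.
  by rewrite -(powRK x0) ge0_ler_powR ?nnegrE ?powR_ge0// ltW.
by rewrite -(powRVK t0) ge0_ler_powR ?nnegrE ?powR_ge0// ltW.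
Qed.

Lemma integral_rho : (\int[mu]_x (rho x)%:E = Z%:E)%E.
Proof.
rewrite (ge0_integral_expRN_layers mu measurableT measurable_powR_norm
  (fun x => powR_ge0 _ p)).
rewrite /Z EFinM -gamma_integralE// /gamma_integral.
have mg : measurable_fun (`]0%R, +oo[%classic : set R)
    (fun t : R => (gamma_kernel p^-1 t)%:E).
  apply: measurable_funTS; apply/measurable_EFinP; exact: measurable_gamma_kernel.
have g0 t : `]0%R, +oo[%classic t -> (0 <= (gamma_kernel p^-1 t)%:E)%E.
  by rewrite lee_fin gamma_kernel_ge0.
have c0 : (0 <= 2%:E :> \bar R)%E by rewrite lee_fin.
have -> := esym (ge0_integralZl mu (measurable_itv _) mg g0 c0).
apply: eq_integral => t; rewrite inE/= in_itv/= andbT => t0.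
have q0 : 0 <= t `^ p^-1 by exact: powR_ge0.
rewrite setTI (_ : [set x | _] = `[- t `^ p^-1, t `^ p^-1]%classic); last first.
  by apply/seteqP; split => x /=; rewrite in_itv/= powR_le_powRV ?(ltW t0)//
    ler_norml.
have q1 : 0 < t `^ p^-1 by exact: powR_gt0.
rewrite lebesgue_measure_itv/= lte_fin ifT; last by lra.
by rewrite -EFinB -!EFinM /gamma_kernel; congr EFin; ring.
Qed.

Definition lnorm n (x : n.-tuple R) : R := \sum_(i < n) `|tnth x i| `^ p.

Lemma lnorm_ge0 n (x : n.-tuple R) : 0 <= lnorm x.
Proof. by apply: sumr_ge0 => i _; exact: powR_ge0. Qed.

Lemma measurable_lnorm n : measurable_fun setT (@lnorm n).
Proof.
apply: measurable_sum => i.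
exact: (measurableT_comp measurable_powR_norm (measurable_tnth i)).
Qed.

Lemma lnorm_cons n t (x : n.-tuple R) :
  lnorm (tcons t x) = `|t| `^ p + lnorm x.
Proof.
rewrite /lnorm big_ord_recl tnth_tcons0; congr (_ + _).
by apply: eq_bigr => i _; rewrite tnth_tconsS.
Qed.

Lemma lnorm_tscale n a (x : n.-tuple R) : 0 <= a ->
  lnorm (tscale a x) = a `^ p * lnorm x.
Proof.
move=> a0; rewrite /lnorm mulr_sumr; apply: eq_bigr => i _.
by rewrite tnth_tscale normrM ger0_norm// powRM.
Qed.

Lemma integral_expR_lnorm n :
  (\int[lam n]_x (expR (- lnorm x))%:E = (Z ^+ n)%:E)%E.
Proof.
have me m : measurable_fun setT (fun x : m.-tuple R => (expR (- lnorm x))%:E).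
  apply/measurable_EFinP; apply: (measurableT_comp measurable_expRN).
  exact: measurable_lnorm.
have e0 m (x : m.-tuple R) : (0 <= (expR (- lnorm x))%:E)%E.
  by rewrite lee_fin expR_ge0.
elim: n => [|n IH].
  by rewrite /= (integral_dirac _ measurableT (me 0%N)) diracE in_setT mul1e expr0 /lnorm big_ord0 oppr0 expR0.
rewrite integral_lebesgue_tupleS//.
transitivity (\int[mu]_t ((Z ^+ n)%:E * (rho t)%:E))%E.
  apply: eq_integral => t _; rewrite muleC -IH.
  rewrite -(ge0_integralZl (lam n) measurableT (me n) (fun x _ => e0 n x)).
    by apply: eq_integral => x _; rewrite lnorm_cons opprD expRD EFinM.
  by rewrite lee_fin ltW// rho_gt0.
have mr : measurable_fun setT (fun t : R => (rho t)%:E).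
  by apply/measurable_EFinP; exact: measurable_rho.
have r0 t : setT t -> (0 <= (rho t)%:E)%E by rewrite lee_fin ltW// rho_gt0.
have z0 : (0 <= (Z ^+ n)%:E)%E by rewrite lee_fin exprn_ge0// ltW// rho_mass_gt0.
by rewrite (ge0_integralZl mu measurableT mr r0 z0) integral_rho -EFinM exprSr.
Qed.

Definition lball n (t : R) : set (n.-tuple R) := [set x | lnorm x <= t].
Arguments lball : clear implicits.

Lemma measurable_lball n t : measurable (lball n t).
Proof.
rewrite -[X in measurable X]setTI.
exact: (measurable_fun_ler (@measurable_lnorm n) (measurable_cst t) measurableT
  (Y := [set true])).
Qed.

Lemma tscale_lball n a t : 0 < a -> tscale a @^-1` lball n (a `^ p * t) = lball n t.
Proof.
move=> a0; apply/seteqP; split => x; rewrite /lball /= lnorm_tscale ?(ltW a0)//;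
by rewrite ler_pM2l// powR_gt0.
Qed.

Lemma lebesgue_lball n t : 0 < t ->
  (lam n (lball n t) = (t `^ (n%:R / p))%:E * lam n (lball n 1))%E.
Proof.
move=> t0; have a0 : 0 < t `^ p^-1 by exact: powR_gt0.
have := @lebesgue_tscale R n _ (lball n t) a0 (@measurable_lball n t).
have := @tscale_lball n _ 1 a0; rewrite (powRVK (ltW t0)) mulr1 => -> ->.
rewrite muleA -EFinM (_ : _ * _ = 1) ?mul1e//.
rewrite -powR_mulrn ?powR_ge0// -powRrM (mulrC p^-1) divff// gt_eqF//.
by rewrite powR_gt0.
Qed.

(** Both sides are the integral of e^(- lnorm x): the left one by its level sets,
    which are homothetic balls, the right one as a product of one-dimensional
    integrals. *)
Lemma lebesgue_lball_Gamma n : (0 < n)%N ->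
  (lam n (lball n 1) * (Gamma (1 + n%:R / p))%:E = (Z ^+ n)%:E)%E.
Proof.
move=> n0; rewrite -integral_expR_lnorm.
rewrite (ge0_integral_expRN_layers (lam n) measurableT (@measurable_lnorm n)
  (@lnorm_ge0 n)).
have N0 : 0 < n%:R / p by rewrite divr_gt0// ltr0n.
rewrite -gamma_integralE// /gamma_integral.
have mg : measurable_fun (`]0%R, +oo[%classic : set R)
    (fun t : R => (gamma_kernel (n%:R / p) t)%:E).
  apply: measurable_funTS; apply/measurable_EFinP; exact: measurable_gamma_kernel.
have g0 t : `]0%R, +oo[%classic t -> (0 <= (gamma_kernel (n%:R / p) t)%:E)%E.
  by rewrite lee_fin gamma_kernel_ge0.
have -> := esym (ge0_integralZl mu (measurable_itv _) mg g0
  (measure_ge0 (lam n) (lball n 1))).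
apply: eq_integral => t; rewrite inE/= in_itv/= andbT => t0.
rewrite setTI -/(lball n t) (lebesgue_lball n t0) /gamma_kernel.
by rewrite [LHS]muleC EFinM [RHS]muleCA muleA.
Qed.

Lemma omegaE n : omega p n = Gamma (1 + n%:R / p) `^ n%:R^-1 / Z.
Proof. by []. Qed.

Lemma ratio_gt0 n : (0 < n)%N -> 0 < n%:R / p.
Proof. by move=> n0; rewrite divr_gt0// ltr0n. Qed.

Lemma omega_gt0 n : (0 < n)%N -> 0 < omega p n.
Proof.
by move=> n0; rewrite divr_gt0 ?rho_mass_gt0// powR_gt0// Gamma_gt0// ratio_gt0.
Qed.

Lemma omega_expn n : (0 < n)%N ->
  omega p n ^+ n = Gamma (1 + n%:R / p) / Z ^+ n.
Proof.
move=> n0; rewrite omegaE exprMn exprVn; congr (_ / _).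
rewrite -powR_mulrn ?powR_ge0// -powRrM mulVf ?pnatr_eq0 -?lt0n//.
by rewrite powRr1// ltW// Gamma_gt0// ratio_gt0.
Qed.

Lemma unit_lp_ballE n : (0 < n)%N ->
  unit_lp_ball p n = lball n (omega p n `^ p).
Proof.
move=> n0; have w0 := omega_gt0 n0.
apply/seteqP; split => x.
  move=> [y hy <-].
  have : lnorm (tscale (omega p n) y) <= omega p n `^ p.
    by rewrite lnorm_tscale ?(ltW w0)// ler_piMr// powR_ge0.
  by [].
move=> hx; exists (tscale (omega p n)^-1 x).
  have : lnorm (tscale (omega p n)^-1 x) <= 1.
    have e : (omega p n)^-1 `^ p * omega p n `^ p = 1.
      by rewrite -powRM ?invr_ge0 ?(ltW w0)// mulVf ?gt_eqF// powR1.
    by rewrite lnorm_tscale ?invr_ge0 ?(ltW w0)// -e ler_wpM2l// powR_ge0.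
  by [].
apply: eq_from_tnth => i; rewrite tnth_mktuple tnth_tscale mulrA divff ?mul1r//.
by rewrite gt_eqF.
Qed.

Lemma powR_norm_pn n a : (0 < n)%N -> 0 <= a ->
  (a `^ p) `^ (n%:R / p) = a ^+ n.
Proof.
move=> n0 a0; rewrite -powRrM mulrCA divff ?p_neq0// mulr1 powR_mulrn//.
Qed.

Lemma lebesgue_unit_lp_ball n : (0 < n)%N -> (lam n (unit_lp_ball p n) = 1)%E.
Proof.
move=> n0; have w0 := omega_gt0 n0; have N0 := ratio_gt0 n0.
rewrite unit_lp_ballE// lebesgue_lball ?powR_gt0// powR_norm_pn ?(ltW w0)//.
rewrite omega_expn// mulrC EFinM -muleA (muleC _ (lam n _)) lebesgue_lball_Gamma//.
by rewrite -EFinM mulVf// gt_eqF// exprn_gt0// rho_mass_gt0.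
Qed.

End lp_volumes.
Arguments lball {R} p n.

(** * Measures with a density on the line *)

Section density.
Context {R : realType} (f : R -> R).
Hypotheses (f0 : forall x, 0 <= f x) (mf : measurable_fun setT f).
Local Notation mu := (@lebesgue_measure R).

(** The proofs are parameters so that the measure structure can be found by
    unification. *)
Definition dens of (forall x, 0 <= f x) & measurable_fun setT f :=
  fun A : set (measurableTypeR R) => (\int[mu]_(x in A) (f x)%:E)%E.
Local Notation nu := (dens f0 mf).

Let nu_set0 : nu set0 = 0%E. Proof. exact: integral_set0. Qed.

Let nu_ge0 A : (0 <= nu A)%E.
Proof. by apply: integral_ge0 => x _; rewrite lee_fin. Qed.

Let nu_sigma_additive : semi_sigma_additive nu.
Proof.
move=> /= F mF tF mUF; rewrite /dens; apply: cvg_toP.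
  apply: ereal_nondecreasing_is_cvgn => m n mn.
  by apply: lee_sum_nneg_natr => // k _ _; exact: nu_ge0.
rewrite ge0_integral_bigcup//=.
- by apply: measurable_funTS; exact/measurable_EFinP.
- by move=> x _; rewrite lee_fin.
Qed.

HB.instance Definition _ := isMeasure.Build _ _ _
  nu nu_set0 nu_ge0 nu_sigma_additive.

Lemma integral_mul_superlevels (u : R -> R) :
  measurable_fun setT u -> (forall x, 0 <= u x) ->
  (\int[mu]_x (u x * f x)%:E =
   \int[mu]_(s in `[0%R, +oo[) nu [set x | (s < u x)%R])%E.
Proof.
move=> mu0 u0.
pose S : set (measurableTypeR R * measurableTypeR R) := [set z | 0 <= z.2 < u z.1].
have mS : measurable S.
  rewrite (_ : S = (fun z => 0 <= z.2) @^-1` [set true] `&`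
      (fun z => z.2 < u z.1) @^-1` [set true]).
    apply: measurableI; rewrite -[X in measurable X]setTI.
      exact: (@measurable_fun_ler _ _ _ setT (fun=> 0) snd).
    apply: (@measurable_fun_ltr _ _ _ setT snd (fun z => u z.1)) => //.
    exact: (measurableT_comp mu0).
  by apply/seteqP; split => z /= => [/andP[-> ->]|[? ?]]; [|apply/andP].
have SE (x s : R) : ((x, s) \in S) = (0 <= s < u x).
  by apply/idP/idP; rewrite inE.
pose F (z : measurableTypeR R * measurableTypeR R) : \bar R :=
  ((\1_S z : R) * f z.1)%:E.
have mF : measurable_fun setT F.
  apply/measurable_EFinP; apply: measurable_funM; first exact: measurable_indic.
  exact: (measurableT_comp mf).
have F0 z : (0 <= F z)%E by rewrite lee_fin mulr_ge0.
have := fubini_tonelli (m1 := mu) (m2 := mu) _ mF F0.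
have -> : (\int[mu]_x \int[mu]_y F (x, y) = \int[mu]_x (u x * f x)%:E)%E.
  apply: eq_integral => x _.
  have i0 t : setT t -> (0 <= (\1_(`[0%R, u x[%classic : set R) t : R)%:E)%E.
    by rewrite lee_fin.
  have mi : measurable_fun setT (fun t => (\1_(`[0%R, u x[%classic : set R) t : R)%:E).
    by apply/measurable_EFinP; apply: measurable_indic; exact: measurable_itv.
  have fx0 : (0 <= (f x)%:E)%E by rewrite lee_fin.
  transitivity (\int[mu]_t ((f x)%:E * (\1_(`[0%R, u x[%classic : set R) t)%:E))%E.
    apply: eq_integral => t _.
    by rewrite /F !indicE SE mem_setE in_itv/= -EFinM mulrC.
  rewrite (ge0_integralZl mu measurableT mi i0 fx0) integral_setT_indic//=.
  rewrite lebesgue_measure_itv/= lte_fin; case: ltP => [_|g1].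
    by rewrite -EFinB subr0 -EFinM mulrC.
  by rewrite (_ : u x = 0) ?mul0r ?mule0//; apply/eqP; rewrite eq_le u0 g1.
move=> ->; rewrite [RHS]integral_mkcond; apply: eq_integral => s _.
rewrite patchE mem_setE in_itv/= andbT; case: ifPn => s0; last first.
  rewrite (eq_integral (fun=> 0%E)) ?integral0// => x _.
  by rewrite /F indicE SE (negbTE s0) mul0r.
rewrite /dens [RHS]integral_mkcond; apply: eq_integral => x _.
rewrite /F indicE SE s0 patchE/=.
have -> : (x \in [set x0 | s < u x0]) = (s < u x) by apply/idP/idP; rewrite inE.
by case: ifPn => _; rewrite ?mul1r ?mul0r.
Qed.

End density.

Section change_of_density.
Context {R : realType} (f D : R -> R) (T : R -> R).
Hypotheses (f0 : forall x, 0 <= f x) (mf : measurable_fun setT f).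
Hypotheses (D0 : forall x, 0 <= D x) (mD : measurable_fun setT D).
Hypothesis mT : measurable_fun setT T.
Local Notation mu := (@lebesgue_measure R).

(** Half-open intervals generate the Borel sets, and the measures are finite on
    an increasing sequence of them that covers the line. *)
Lemma eq_dens_pushforward :
  (forall a b, a < b ->
     dens D0 mD (T @^-1` `]a, b]%classic) = dens f0 mf `]a, b]%classic) ->
  (forall a b, (dens f0 mf `]a, b]%classic < +oo)%E) ->
  forall A, measurable A -> dens D0 mD (T @^-1` A) = dens f0 mf A.
Proof.
move=> h hoo A mA.
have mT' : measurable_fun setT (T : measurableTypeR R -> measurableTypeR R) by [].
pose n1 : {measure set (measurableTypeR R) -> \bar R} := dens D0 mD.
pose n2 : {measure set (measurableTypeR R) -> \bar R} := dens f0 mf.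
pose m1 := measure_function_pushforward__canonical__measure_function_Measure n1 mT'.
have m1E B : m1 B = dens D0 mD (T @^-1` B) by [].
have oc X : ocitv X -> m1 X = n2 X.
  move=> /ocitvP[->|[[a b] /= ab ->]]; first by rewrite !measure0.
  by rewrite m1E h.
pose g (k : nat) : set (measurableTypeR R) := `](- k%:R)%R, k%:R]%classic.
have cover : \bigcup_k g k = setT.
  apply/seteqP; split => // x _.
  exists (Num.truncn `|x|).+1 => //=.
  have := truncnS_gt `|x|; rewrite /g/= in_itv/= => hx.
  have /andP[-> h2] : - (Num.truncn `|x|).+1%:R < x < (Num.truncn `|x|).+1%:R.
    by rewrite -ltr_norml.
  by rewrite ltW.
have fin k : (m1 (g k) < +oo)%E.
  by rewrite oc; [exact: hoo|exact: is_ocitv].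
have Gg i : ocitv (g i) by exact: is_ocitv.
exact: (@measure_unique _ R (measurableTypeR R) (@ocitv R) g erefl (@ocitvI R)
  Gg cover m1 n2 oc fin A mA).
Qed.

Lemma integral_change_density :
  (forall A, measurable A -> dens D0 mD (T @^-1` A) = dens f0 mf A) ->
  forall u : R -> R, measurable_fun setT u -> (forall x, 0 <= u x) ->
  (\int[mu]_a (u (T a) * D a)%:E = \int[mu]_x (u x * f x)%:E)%E.
Proof.
move=> h u mu0 u0.
rewrite (integral_mul_superlevels f0 mf mu0 u0).
rewrite (integral_mul_superlevels D0 mD (measurableT_comp mu0 mT)
  (fun a => u0 (T a))).
apply: eq_integral => s _; rewrite -h//.
rewrite -[X in measurable X]setTI.
exact: (measurable_fun_ltr (measurable_cst s) mu0 measurableT (Y := [set true])).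
Qed.

End change_of_density.

(** * The law of density proportional to exp(-|x|^p) *)

Section lp_law.
Context {R : realType} (p : R) (hp : 1 <= p <= 2).
Local Notation mu := (@lebesgue_measure R).
Local Notation Z := (rho_mass p).
Let pp : 0 < p := p_gt0 hp.
#[local] Hint Resolve pp : core.
Local Notation rho := (@rho R p).

Definition prho (x : R) : R := rho x / Z.

Lemma prho_gt0 x : 0 < prho x.
Proof. by rewrite divr_gt0 ?rho_gt0// rho_mass_gt0. Qed.

Lemma le_prho x y : (prho x <= prho y) = (`|y| <= `|x|).
Proof.
rewrite /prho ler_pM2r; last by rewrite invr_gt0 rho_mass_gt0.
rewrite /rho ler_expR lerN2.
apply/idP/idP => h; last by rewrite ge0_ler_powR ?nnegrE ?(ltW pp).
rewrite leNgt; apply/negP => /(gt0_ltr_powR pp).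
by rewrite !nnegrE !normr_ge0 => /(_ isT isT); rewrite ltNge h.
Qed.

Lemma prho_ge0 x : 0 <= prho x. Proof. exact/ltW/prho_gt0. Qed.

Lemma measurable_prho : measurable_fun setT prho.
Proof. by apply: measurable_funM => //; exact: measurable_rho. Qed.

Lemma prhoN x : prho (- x) = prho x. Proof. by rewrite /prho rhoN. Qed.

Definition lp_law := dens prho_ge0 measurable_prho.
Local Notation nu := lp_law.
HB.instance Definition _ := Measure.on nu.

Lemma lp_law_setT : nu setT = 1%E.
Proof.
rewrite /nu /dens.
have mr : measurable_fun setT (fun t : R => (rho t)%:E).
  by apply/measurable_EFinP; exact: measurable_rho.
have r0 t : setT t -> (0 <= (rho t)%:E)%E by rewrite lee_fin ltW// rho_gt0.
have z0 : (0 <= (Z^-1)%:E)%E by rewrite lee_fin invr_ge0 ltW// rho_mass_gt0.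
transitivity (\int[mu]_x ((Z^-1)%:E * (rho x)%:E))%E.
  by apply: eq_integral => x _; rewrite -EFinM mulrC.
rewrite (ge0_integralZl mu measurableT mr r0 z0) (integral_rho hp) -EFinM.
by rewrite mulVf// gt_eqF// rho_mass_gt0.
Qed.

Lemma lp_law_le1 A : measurable A -> (nu A <= 1)%E.
Proof. by move=> mA; rewrite -lp_law_setT; apply: le_measure; rewrite ?inE. Qed.

Lemma lp_law_fin A : measurable A -> nu A \is a fin_num.
Proof.
move=> mA; rewrite ge0_fin_numE ?measure_ge0//.
by rewrite (le_lt_trans (lp_law_le1 mA))// ltry.
Qed.

Lemma prho_itv_ge (x y c : R) : x <= y -> 0 <= c ->
  (forall t, x < t <= y -> c <= prho t) ->
  ((c * (y - x))%:E <= nu `]x, y]%classic)%E.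
Proof.
move=> xy c0 h.
have -> : (c * (y - x))%:E = (\int[mu]_(t in `]x, y]%classic) (cst c%:E t))%E.
  rewrite integral_cst//= lebesgue_measure_itv/= lte_fin; case: ltP => h1.
    by rewrite -EFinB -EFinM.
  by rewrite (_ : y = x) ?subrr ?mulr0 ?mule0//; apply/eqP; rewrite eq_le xy h1.
apply: (ge0_le_integral mu (measurable_itv _)).
- by move=> t _; rewrite lee_fin.
- exact: measurable_cst.
- by apply: measurable_funTS; apply/measurable_EFinP; exact: measurable_prho.
- by move=> t /=; rewrite in_itv/= => /h; rewrite lee_fin.
Qed.

Lemma prho_itv_le (x y : R) : x <= y ->
  (nu `]x, y]%classic <= ((y - x) / Z)%:E)%E.
Proof.
move=> xy.
have -> : ((y - x) / Z)%:E = (\int[mu]_(t in `]x, y]%classic) (cst (Z^-1)%:E t))%E.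
  rewrite integral_cst//= lebesgue_measure_itv/= lte_fin; case: ltP => h1.
    by rewrite -EFinB -EFinM mulrC.
  by rewrite (_ : y = x) ?subrr ?mul0r ?mule0//; apply/eqP; rewrite eq_le xy h1.
apply: (ge0_le_integral mu (measurable_itv _)).
- by move=> t _; rewrite lee_fin prho_ge0.
- by apply: measurable_funTS; apply/measurable_EFinP; exact: measurable_prho.
- exact: measurable_cst.
- move=> t _; rewrite lee_fin /prho ler_piMl ?rho_le1//.
  by rewrite invr_ge0 ltW// rho_mass_gt0.
Qed.

Definition lp_cdf (x : R) : R := fine (nu `]-oo, x]%classic).
Local Notation F := lp_cdf.

Lemma lp_cdfE x : (F x)%:E = nu `]-oo, x]%classic.
Proof. by rewrite fineK// lp_law_fin. Qed.

Lemma lp_cdf_itv x y : x <= y -> ((F y - F x)%:E = nu `]x, y]%classic)%E.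
Proof.
move=> xy; rewrite EFinB !lp_cdfE.
rewrite (_ : `]-oo, y]%classic = `]-oo, x]%classic `|` `]x, y]%classic).
  rewrite measureU//.
    by rewrite addeAC subee ?add0e// lp_law_fin.
  by apply/seteqP; split => t //= []; rewrite !in_itv/= => + /andP[];
    case: ltP.
by rewrite -itv_bndbnd_setU ?bnd_simp.
Qed.

Lemma lp_cdf_tail x : ((1 - F x)%:E = nu `]x, +oo[%classic)%E.
Proof.
have -> : (1 - F x)%:E = (nu setT - nu `]-oo, x]%classic)%E.
  by rewrite lp_law_setT -lp_cdfE EFinB.
rewrite -(setUv `]-oo, x]%classic) setCitvl measureU//.
  by rewrite addeAC subee ?add0e// lp_law_fin.
by rewrite -setCitvl setICr.
Qed.

Lemma lp_cdf_lt x y : x < y -> F x < F y.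
Proof.
move=> xy; rewrite -subr_gt0 -lte_fin lp_cdf_itv ?(ltW xy)//.
pose m := Num.max `|x| `|y|.
apply: (@lt_le_trans _ _ (prho m * (y - x))%:E).
  by rewrite lte_fin mulr_gt0 ?prho_gt0// subr_gt0.
apply: prho_itv_ge; [exact: ltW|exact: prho_ge0|move=> t /andP[xt ty]].
rewrite le_prho.
have m0 : 0 <= m by rewrite le_max normr_ge0.
rewrite (ger0_norm m0) /m le_max.
have [t0|t0] := leP 0 t.
  by apply/orP; right; rewrite (ger0_norm t0) (le_trans ty)// ler_norm.
rewrite (ltr0_norm t0); apply/orP; left.
by rewrite ltr0_norm ?(lt_trans xt)// lerN2 ltW.
Qed.

Lemma lp_cdf_ltE x y : (F x < F y) = (x < y).
Proof.
apply/idP/idP; last exact: lp_cdf_lt.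
by apply: contraLR; rewrite -!leNgt le_eqVlt => /predU1P[->//|/lp_cdf_lt/ltW].
Qed.

Lemma lp_cdf_leE x y : (F x <= F y) = (x <= y).
Proof. by rewrite !leNgt lp_cdf_ltE. Qed.

Lemma lp_cdf_lipschitz x y : x <= y -> F y - F x <= (y - x) / Z.
Proof. by move=> xy; rewrite -lee_fin lp_cdf_itv// prho_itv_le. Qed.

Lemma lp_cdf_continuous : continuous F.
Proof.
move=> x; apply/cvgrPdist_le => /= e e0.
have eZ : 0 < e * Z by rewrite mulr_gt0// rho_mass_gt0.
have : \forall y \near x, `|x - y| < e * Z.
  by exists (e * Z).
apply: filterS => y /ltW; rewrite -ler_pdivrMr ?rho_mass_gt0//.
apply: le_trans.
wlog xy : x y / x <= y => [wl|].
  have [|/ltW] := leP x y; first exact: wl.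
  by rewrite distrC (distrC x); exact: wl.
rewrite distrC (distrC x) !ger0_norm ?subr_ge0 ?lp_cdf_leE//.
exact: lp_cdf_lipschitz.
Qed.

Lemma dens_reflect (A : set R) : measurable A ->
  nu ((fun x => - x) @^-1` A) = nu A.
Proof.
move=> mA.
have mf : measurable_fun setT ((fun x : R => (prho x)%:E) \_ A).
  apply/(measurable_restrictT _ _).1 => //; apply: measurable_funTS.
  by apply/measurable_EFinP; exact: measurable_prho.
have f0 x : (0 <= ((fun x : R => (prho x)%:E) \_ A) x)%E.
  by apply: erestrict_ge0 => t _; rewrite lee_fin prho_ge0.
rewrite /nu /dens [RHS]integral_mkcond -(ge0_integral_oppr mf f0).
rewrite [LHS]integral_mkcond; apply: eq_integral => x _.
rewrite !patchE prhoN.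
by have -> : (x \in (fun x => - x) @^-1` A) = (- x \in A) by
  apply/idP/idP; rewrite !inE.
Qed.

Lemma lp_cdfN x : F (- x) = 1 - F x.
Proof.
apply: EFin_inj; rewrite lp_cdf_tail lp_cdfE -(dens_reflect (A := `]x, +oo[)) //.
rewrite (_ : _ @^-1` _ = `]-oo, (- x)%R[%classic); last first.
  by apply/seteqP; split => t /=; rewrite !in_itv/= andbT ltrNr.
rewrite /nu /dens integral_itv_bndo_bndc//.
by apply: measurable_funTS; apply/measurable_EFinP; exact: measurable_prho.
Qed.

Lemma lp_cdf0 : F 0 = 2^-1.
Proof. by have := lp_cdfN 0; rewrite oppr0 => h; lra. Qed.

Lemma lp_cdf_tail_ge0 x : 0 <= 1 - F x.
Proof. by rewrite -lee_fin lp_cdf_tail measure_ge0. Qed.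

Lemma lp_cdf_lt1 x : F x < 1.
Proof.
have x1 : x < x + 1 by rewrite ltrDl.
have := lp_cdf_lt x1.
by have := lp_cdf_tail_ge0 (x + 1); rewrite subr_ge0 => h /lt_le_trans; exact.
Qed.

Lemma lp_cdf_gt0 x : 0 < F x.
Proof. by have := lp_cdf_lt1 (- x); rewrite lp_cdfN gtrBl. Qed.

Lemma powR_superadditive a b : 0 <= a -> 0 <= b -> a `^ p + b `^ p <= (a + b) `^ p.
Proof.
move=> a0 b0; have := addr_ge0 a0 b0; rewrite le_eqVlt => /predU1P[ab0|ab0].
  have : a = 0 /\ b = 0 by lra.
  by move=> [-> ->]; rewrite addr0 !powR0 ?gt_eqF ?pp// addr0.
have h c : 0 <= c <= a + b -> c `^ p <= c / (a + b) * (a + b) `^ p.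
  move=> /andP[c0 cab].
  have -> : c `^ p = (c / (a + b)) `^ p * (a + b) `^ p.
    by rewrite -powRM ?divr_ge0 ?(ltW ab0)// mulfVK ?gt_eqF.
  rewrite ler_wpM2r ?powR_ge0//.
  have := c0; rewrite le_eqVlt => /predU1P[<-|cp].
    by rewrite mul0r powR0// gt_eqF.
  apply: ge1r_powR; last by have /andP[] := hp.
  by rewrite divr_gt0//= ler_pdivrMr// mul1r.
apply: le_trans (lerD (h a _) (h b _)) _; rewrite ?a0 ?b0 ?lerDl ?lerDr//.
by rewrite -mulrDl -mulrDl divff ?mul1r// gt_eqF.
Qed.

(** On the half-line, (x + d)^p >= x^p + d^p as p >= 1; this is a bound between
    densities, integrated over the tail. *)
Lemma lp_cdf_shift y d : 0 <= y -> 0 <= d ->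
  1 - F (y + d) <= expR (- d `^ p) * (1 - F y).
Proof.
move=> y0 d0.
have key (x : R) : y < x -> prho (x + d) <= expR (- d `^ p) * prho x.
  move=> yx; have x0 : 0 <= x by rewrite ltW// (le_lt_trans y0).
  rewrite /prho mulrA ler_pM2r; last by rewrite invr_gt0 rho_mass_gt0.
  rewrite /rho -expRD ler_expR.
  rewrite (ger0_norm x0) (ger0_norm (addr_ge0 x0 d0)) -opprD lerN2 addrC.
  exact: powR_superadditive.
rewrite -lee_fin EFinM !lp_cdf_tail /nu /dens.
have me A : measurable_fun A (fun x : R => (prho x)%:E).
  by apply: measurable_funTS; apply/measurable_EFinP; exact: measurable_prho.
have p0 x : (0 <= (prho x)%:E)%E by rewrite lee_fin prho_ge0.
have c0 : (0 <= (expR (- d `^ p))%:E)%E by rewrite lee_fin expR_ge0.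
have <- := ge0_integralZl mu (measurable_itv `]y, +oo[) (me _) (fun x _ => p0 x) c0.
pose f (x : R) : \bar R := ((fun x : R => (prho x)%:E) \_ `]y + d, +oo[) x.
have mf : measurable_fun setT f.
  by apply/(measurable_restrictT _ _).1 => //; exact: me.
have f0 x : (0 <= f x)%E by apply: erestrict_ge0 => t _; exact: p0.
have fd : (\int[mu]_x f x = \int[mu]_x f (1 * x + d)%R)%E.
  by rewrite ge0_integral_affine// invr1 mul1e.
rewrite [leLHS]integral_mkcond -/f [leLHS]fd.
rewrite [leRHS]integral_mkcond.
apply: (ge0_le_integral mu measurableT (fun x _ => f0 (1 * x + d))).
- by apply: (measurableT_comp mf); exact: measurable_affine.
- have mE : measurable_fun `]y, +oo[%classic
      (fun x => (expR (- d `^ p))%:E * (prho x)%:E)%E.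
    by apply: measurable_funeM; exact: me.
  exact: (measurable_restrictT _ (measurable_itv _)).1 mE.
move=> x _; rewrite /f !patchE !mem_setE !in_itv/= !andbT mul1r ltrD2r.
case: ifPn => yx; last exact: lexx.
rewrite -EFinM lee_fin; exact: key.
Qed.

Lemma lp_cdf_tail_le x : 0 <= x -> 1 - F x <= expR (- x `^ p) / 2.
Proof.
move=> x0; have := lp_cdf_shift (lexx 0) x0.
by rewrite add0r lp_cdf0 (_ : 1 - 2^-1 = 2^-1) //; lra.
Qed.

(** The hazard rate of the law is at least 2/Z: the density at y + d dominates
    the tail beyond y + d. *)
Lemma lp_cdf_hazard y d : 0 <= y -> 0 <= d ->
  (1 + 2 / Z * d) * (1 - F (y + d)) <= 1 - F y.
Proof.
move=> y0 d0.
have yd : y <= y + d by rewrite lerDl.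
have yd0 : 0 <= y + d by exact: addr_ge0.
have h : prho (y + d) * d <= F (y + d) - F y.
  rewrite -lee_fin lp_cdf_itv//.
  rewrite [X in (X%:E <= _)%E](_ : _ = prho (y + d) * (y + d - y)); last by ring.
  apply: prho_itv_ge; [exact: yd|exact: prho_ge0|].
  move=> t /andP[yt td]; have t0 : 0 <= t by rewrite (le_trans y0)// ltW.
  by rewrite le_prho (ger0_norm t0) ger0_norm.
have h2 : 2 / Z * (1 - F (y + d)) <= prho (y + d).
  rewrite /prho mulrAC ler_pM2r; last by rewrite invr_gt0 rho_mass_gt0.
  have := lp_cdf_tail_le yd0; rewrite ler_pdivlMr; last by rewrite ltr0n.
  by rewrite mulrC /rho (ger0_norm yd0).
have h3 : 2 / Z * (1 - F (y + d)) * d <= F (y + d) - F y.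
  by apply: le_trans h; rewrite ler_wpM2r.
by rewrite mulrDl mul1r mulrAC; lra.
Qed.

(** The tail beyond x contains an interval of length 1. *)
Lemma lp_cdf_tail_ge x : 0 <= x -> expR (- (x + 1) `^ p) / Z <= 1 - F x.
Proof.
move=> x0; have x1 : x <= x + 1 by rewrite lerDl.
apply: (@le_trans _ _ (F (x + 1) - F x)); last first.
  by rewrite lerD2r ltW// lp_cdf_lt1.
rewrite -lee_fin lp_cdf_itv//.
have -> : expR (- (x + 1) `^ p) / Z = prho (x + 1) * (x + 1 - x).
  by rewrite /prho /rho ger0_norm ?addr_ge0// addrAC subrr add0r mulr1.
apply: prho_itv_ge; [exact: x1|exact: prho_ge0|].
move=> t /andP[yt td]; have t0 : 0 <= t by rewrite (le_trans x0)// ltW.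
by rewrite le_prho (ger0_norm t0) ger0_norm// addr_ge0.
Qed.

Lemma lp_cdf_surj q : 0 < q < 1 -> exists x, F x = q.
Proof.
move=> /andP[q0 q1].
have big s : 0 < s -> exists2 b, 0 <= b & 1 - F b <= s.
  move=> s0; pose b := Num.max 1 (- ln s).
  have b1 : 1 <= b by rewrite le_max lexx.
  have b0 : 0 <= b by rewrite (le_trans ler01).
  exists b => //; apply: le_trans (lp_cdf_tail_le b0) _.
  apply: (@le_trans _ _ (expR (- b))).
    rewrite ler_pdivrMr//; apply: (@le_trans _ _ (expR (- b))).
      by rewrite ler_expR lerN2 le1r_powR//; have /andP[] := hp.
    by rewrite ler_peMr ?expR_ge0// ler1n.
  rewrite -[leRHS]lnK ?posrE// ler_expR lerNl le_max lexx orbT//.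
have q1' : 0 < 1 - q by rewrite subr_gt0.
have [b b0 hb] := big (1 - q) q1'.
have [a a0 ha] := big q q0.
have ab : - a <= b by rewrite (le_trans _ b0)// oppr_le0.
have cF : {within `[- a, b], continuous F}.
  by apply: continuous_subspaceT; exact: lp_cdf_continuous.
have hq : Num.min (F (- a)) (F b) <= q <= Num.max (F (- a)) (F b).
  rewrite lp_cdfN ge_min ha/= le_max; apply/orP; right.
  by lra.
by have [x _ hx] := IVT ab cF hq; exists x.
Qed.

End lp_law.

(** * Odds ratios of two points *)

Section gain.
Context {R : realType} (p : R) (hp : 1 <= p <= 2).
Local Notation mu := (@lebesgue_measure R).
Local Notation Z := (rho_mass p).
Local Notation F := (lp_cdf hp).
Let pp : 0 < p := p_gt0 hp.
#[local] Hint Resolve pp : core.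

(** A multiplicative tail bound on the right half-line controls the odds ratio
    of any two points: if they lie on both sides of the origin, one of them is at
    distance at least half their gap from it. *)
Lemma odds_ratio (r : R -> R) (x y : R) :
  (forall s, 0 <= s -> 1 <= r s) ->
  (forall s t, 0 <= s -> s <= t -> r s <= r t) ->
  (forall y s, 0 <= y -> 0 <= s -> r s * (1 - F (y + s)) <= 1 - F y) ->
  y <= x ->
  r ((x - y) / 2) * (F y * (1 - F x)) <= F x * (1 - F y).
Proof.
move=> r1 rmono rtail yx.
pose d := (x - y) / 2.
have d0 : 0 <= d by rewrite divr_ge0// subr_ge0.
have dd : d <= x - y by rewrite /d; lra.
have t0 z : 0 <= 1 - F z by exact: lp_cdf_tail_ge0.
have F0 z : 0 <= F z by rewrite ltW// lp_cdf_gt0.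
have xy0 : 0 <= x - y by rewrite subr_ge0.
have Fyx : F y <= F x by rewrite lp_cdf_leE.
rewrite -/d.
have rd0 : 0 <= r d by rewrite (le_trans ler01)// r1.
have [y0|y0] := leP 0 y.
  rewrite mulrCA; apply: ler_pM => //; first by rewrite mulr_ge0.
  apply: le_trans (rtail y (x - y) y0 xy0).
  by rewrite (addrC y) subrK ler_wpM2r// rmono.
have [x0|x0] := leP x 0.
  rewrite mulrA mulrC [leRHS]mulrC; apply: ler_pM => //.
  - by rewrite mulr_ge0.
  - by rewrite lerD2l lerN2.
  have Nx0 : 0 <= - x by rewrite oppr_ge0.
  have := rtail (- x) (x - y) Nx0 xy0.
  rewrite (_ : - x + (x - y) = - y); last by ring.
  rewrite !lp_cdfN !opprB !(addrC 1) !subrK => h.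
  by apply: le_trans h; rewrite ler_wpM2r// rmono.
have h1 : r x * (1 - F x) <= 2^-1.
  have := rtail 0 x (lexx _) (ltW x0); rewrite add0r lp_cdf0.
  by move=> h; apply: (le_trans h); lra.
have h2 : r (- y) * F y <= 2^-1.
  have Ny0 : 0 <= - y by rewrite oppr_ge0 ltW.
  have := rtail 0 (- y) (lexx _) Ny0; rewrite add0r lp_cdf0 lp_cdfN.
  by rewrite opprB addrC subrK => h; apply: (le_trans h); lra.
have h3 : 2^-1 <= F x by rewrite -(lp_cdf0 hp) lp_cdf_leE ltW.
have h4 : 2^-1 <= 1 - F y.
  have : F y <= 2^-1 by rewrite -(lp_cdf0 hp) lp_cdf_leE ltW.
  by move=> h; lra.
have [dx|xd] := leP d x.
  have e1 : r d * (1 - F x) <= 1 - F y.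
    apply: le_trans h4; apply: le_trans h1.
    by rewrite ler_wpM2r// rmono.
  by rewrite mulrCA; apply: ler_pM => //; rewrite mulr_ge0.
have dy : d <= - y by move: xd; rewrite /d; lra.
have e2 : r d * F y <= F x.
  apply: le_trans h3; apply: le_trans h2.
  by rewrite ler_wpM2r// rmono.
rewrite mulrA; apply: ler_pM => //; first by rewrite mulr_ge0.
by rewrite lerD2l lerN2.
Qed.

Lemma bernoulli_ge (y : R) m : 1 <= y -> 1 + m%:R * (y - 1) <= y ^+ m.
Proof.
move=> y1; elim: m => [|m IH]; first by rewrite mul0r addr0 expr0.
rewrite exprS; apply: le_trans (ler_wpM2l _ IH); last by rewrite (le_trans ler01).
have : 0 <= m%:R * ((y - 1) * (y - 1)) by rewrite mulr_ge0// mulr_ge0 ?subr_ge0.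
by rewrite -natr1; nra.
Qed.

(** The cost of a displacement: quadratic for small ones, the p-th power for large
    ones. *)
Definition gain_cost (d : R) : R := Num.min (d ^+ 2) (`|d| `^ p).

Lemma gain_cost_ge0 d : 0 <= gain_cost d.
Proof. by rewrite le_min sqr_ge0 powR_ge0. Qed.

Lemma gain_costN d : gain_cost (- d) = gain_cost d.
Proof. by rewrite /gain_cost sqrrN normrN. Qed.

(** Small enough for both regimes in [gain_ratio]: the first term serves d <= 1, the
    second one d > 1. *)
Definition gain_rate : R := Num.min ((Num.min 1 (Z^-1 / 3)) ^+ 2 / 16) (288^-1).

Lemma gain_rate_gt0 : 0 < gain_rate.
Proof.
have Z0 := rho_mass_gt0 hp.
by rewrite lt_min divr_gt0 ?exprn_gt0 ?lt_min ?ltr01 ?divr_gt0 ?invr_gt0 ?ltr0n.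
Qed.

(** The two regimes: near the diagonal the hazard rate gives a quadratic gain,
    far from it the stretched exponential tail gives the p-th power. *)
Lemma gain_ratio (A B d : R) : 0 < A -> 0 < B -> 0 <= d ->
  (1 + 2 / Z * (d / 2)) * B <= A -> expR ((d / 2) `^ p) * B <= A ->
  4 * Num.sqrt (A * B) * expR (gain_rate * gain_cost d) <=
  A + B + 2 * Num.sqrt (A * B).
Proof.
move=> A0 B0 d0 h1 h2.
have Z0 := rho_mass_gt0 hp.
(* z is a lower bound of sqrt (A / B), and (A + B + 2 sqrt(A B)) / sqrt(A B)
   increases with that ratio *)
suff [z z1 [zA zw]] : exists2 z, 1 <= z & z ^+ 2 * B <= A /\
    expR (gain_rate * gain_cost d) * (4 * z) <= 4 * z + (z - 1) ^+ 2.
  pose a := Num.sqrt A; pose b := Num.sqrt B.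
  have a0 : 0 < a by rewrite sqrtr_gt0.
  have b0 : 0 < b by rewrite sqrtr_gt0.
  have aE : A = a ^+ 2 by rewrite sqr_sqrtr// ltW.
  have bE : B = b ^+ 2 by rewrite sqr_sqrtr// ltW.
  have -> : Num.sqrt (A * B) = a * b by rewrite sqrtrM// ltW.
  have z0 : 0 < z by rewrite (lt_le_trans ltr01).
  have zba : z * b <= a.
    have zb0 : 0 <= z * b by rewrite mulr_ge0 ?(ltW z0) ?(ltW b0).
    by rewrite -(ler_pXn2r (ltn0Sn 1)) ?nnegrE ?(ltW a0)// exprMn -aE -bE.
  have e1 : 0 <= (a - z * b) * (z * a - b).
    rewrite mulr_ge0 ?subr_ge0//; apply: (@le_trans _ _ a).
      by apply: le_trans zba; rewrite ler_peMl// ltW.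
    by rewrite ler_peMl// ltW.
  rewrite -(ler_pM2l z0) aE bE.
  have := ler_wpM2l (ltW (mulr_gt0 a0 b0)) zw.
  set E := expR _; nra.
have [d1|d1] := leP d 1.
  pose k := Num.min 1 (Z^-1 / 3).
  have k0 : 0 < k by rewrite lt_min ltr01 divr_gt0 ?invr_gt0.
  have k1 : k <= 1 by rewrite ge_min lexx.
  have kZ : 3 * k <= Z^-1.
    have : k <= Z^-1 / 3 by rewrite ge_min lexx orbT.
    by rewrite ler_pdivlMr ?ltr0n// mulrC.
  exists (1 + k * d); first by rewrite lerDl mulr_ge0// ltW.
  split.
    apply: le_trans h1; rewrite ler_pM2r//.
    have -> : 2 / Z * (d / 2) = Z^-1 * d by field; rewrite gt_eqF.
    have e1 : 3 * k * d <= Z^-1 * d by rewrite ler_wpM2r.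
    have e2 : k * k * (d * d) <= k * d.
      rewrite (_ : k * k * (d * d) = (k * d) * (k * d)); last by ring.
      have kd : k * d <= 1 by rewrite mulr_ile1// ltW.
      by rewrite ler_piMr// mulr_ge0// ltW.
    by rewrite expr2; nra.
  pose t := k ^+ 2 / 16 * d ^+ 2.
  have t0 : 0 <= t by rewrite mulr_ge0 ?sqr_ge0// divr_ge0 ?sqr_ge0.
  have t1 : t <= 2^-1.
    have e1 : k ^+ 2 <= 1 by rewrite exprn_ile1// ltW.
    have e2 : d ^+ 2 <= 1 by rewrite exprn_ile1.
    have e3 : 0 <= k ^+ 2 by exact: sqr_ge0.
    have e4 : 0 <= d ^+ 2 by exact: sqr_ge0.
    by rewrite /t; nra.
  have e1 : expR (gain_rate * gain_cost d) <= 1 + 2 * t.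
    apply: (@le_trans _ _ (expR t)).
      rewrite ler_expR; apply: ler_pM; rewrite ?gain_cost_ge0 ?(ltW gain_rate_gt0)//.
        by rewrite ge_min lexx.
      by rewrite ge_min lexx.
    have := expR_ge1Dx (- t) => e3.
    have e4 : expR t * expR (- t) = 1 by rewrite expRN divff// gt_eqF// expR_gt0.
    have e5 : 0 < expR t by exact: expR_gt0.
    have e6 : expR t * (1 - t) <= expR t * expR (- t) by rewrite ler_pM2l.
    rewrite e4 in e6.
    have e7 : 1 <= (1 + 2 * t) * (1 - t) by nra.
    have e8 : 0 < 1 - t by lra.
    by rewrite -(ler_pM2r e8) (le_trans e6).
  have z0 : 0 <= 4 * (1 + k * d).
    have : 0 <= k * d by rewrite mulr_ge0// ltW.
    by move=> kd; lra.
  apply: (le_trans (ler_wpM2r z0 e1)).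
  have kd1 : k * d <= 1 by rewrite mulr_ile1// ltW.
  have kd0 : 0 <= k * d by rewrite mulr_ge0// ltW.
  have -> : t = (k * d) ^+ 2 / 16 by rewrite /t exprMn; field.
  by nra.
(* Here d^p <= 8 s as 2^p <= 4, and 288 = 8 * 36. *)
pose s := (d / 2) `^ p / 2.
exists (expR s).
  by rewrite -expR0 ler_expR divr_ge0// powR_ge0.
split.
  apply: le_trans h2; rewrite ler_pM2r// expr2 -expRD ler_expR /s.
  by rewrite -splitr.
have dp : d `^ p <= 8 * s.
  have -> : d `^ p = (d / 2) `^ p * 2 `^ p.
    by rewrite -powRM ?divr_ge0// divfK.
  rewrite (_ : 8 * s = (d / 2) `^ p * 4); last by rewrite /s; field.
  rewrite ler_wpM2l ?powR_ge0//.
  apply: (@le_trans _ _ (2 `^ 2)); last by rewrite powR_mulrn// -natrX ler_nat.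
  by rewrite ler_powR ?ler1n//; have /andP[] := hp.
have s0 : 8^-1 <= s.
  suff : 1 <= d `^ p by move=> h; lra.
  by rewrite -(powRr0 d) ler_powR// ltW.
have e1 : expR (gain_rate * gain_cost d) <= expR (s / 36).
  rewrite ler_expR; apply: (@le_trans _ _ (288^-1 * (8 * s))); last first.
    by rewrite (_ : 288^-1 * (8 * s) = s / 36)//; field.
  apply: ler_pM; rewrite ?gain_cost_ge0 ?(ltW gain_rate_gt0)//.
    by rewrite ge_min lexx orbT.
  by rewrite (le_trans _ dp)// /gain_cost ge_min (ger0_norm d0) lexx orbT.
have e2 : expR (s / 36) <= 1 + (expR s - 1) / 36.
  have y1 : 1 <= expR (s / 36) by rewrite -expR0 ler_expR divr_ge0//; lra.
  have := bernoulli_ge 36 y1.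
  rewrite -expRM_natl (_ : 36%:R * (s / 36) = s); last by field.
  by move=> h; lra.
have e3 : 9 / 8 <= expR s.
  by apply: le_trans (expR_ge1Dx s); lra.
have e4 := le_trans e1 e2.
have z0 : 0 <= 4 * expR s by rewrite mulr_ge0// expR_ge0.
apply: (le_trans (ler_wpM2r z0 e4)).
by nra.
Qed.

End gain.

(** * Transport from the cosine law *)

Section transport.
Context {R : realType} (p : R) (hp : 1 <= p <= 2).
Local Notation mu := (@lebesgue_measure R).
Local Notation Z := (rho_mass p).
Local Notation F := (lp_cdf hp).
Local Notation prho := (@prho R p).
Let pp : 0 < p := p_gt0 hp.
#[local] Hint Resolve pp : core.

Definition open_arc : set R := `](- (pi / 2)), (pi / 2)[%classic.

Lemma open_arcE (a : R) : open_arc a = (- (pi / 2) < a < pi / 2) :> Prop.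
Proof. by rewrite /open_arc /= in_itv. Qed.

Lemma measurable_arc : measurable open_arc. Proof. exact: measurable_itv. Qed.

Lemma sin_arc (a : R) : open_arc a -> -1 < sin a < 1.
Proof.
rewrite open_arcE => /andP[a1 a2].
have c0 : 0 < cos a by apply: cos_gt0_pihalf; rewrite a1 a2.
have := cos2Dsin2 a => h.
have h1 : 0 < cos a ^+ 2 by rewrite exprn_gt0.
have h2 : sin a ^+ 2 < 1 by lra.
by rewrite -ltr_norml -(ltr_pXn2r (ltn0Sn 1)) ?nnegrE// expr1n real_normK// num_real.
Qed.

Definition quantile0 (a : R) : R := xget 0 [set x | F x = (1 + sin a) / 2].

Lemma quantile0P a : open_arc a -> F (quantile0 a) = (1 + sin a) / 2.
Proof.
move=> /sin_arc /andP[s1 s2].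
have q01 : 0 < (1 + sin a) / 2 < 1 by apply/andP; split; lra.
have [x hx] := lp_cdf_surj hp q01.
by rewrite /quantile0; case: xgetP => // /(_ x).
Qed.

(** The monotone map carrying the cosine law on [open_arc] to the law of density
    proportional to e^(-|x|^p), extended by a constant. *)
Definition quantile : R -> R := quantile0 \_ open_arc.
Definition cosine : R -> R := (fun a => cos a / 2) \_ open_arc.

Lemma quantileP a : open_arc a -> F (quantile a) = (1 + sin a) / 2.
Proof.
by move=> aa; rewrite /quantile patchE mem_set// quantile0P.
Qed.

Lemma measurable_quantile : measurable_fun setT quantile.
Proof.
apply: (measurable_restrictT _ measurable_arc).1.
apply: (measurability (@RGenCInfty.G R)) => [|/= _ [_] [r] -> <-].
  exact: RGenCInfty.measurableE.
rewrite (_ : open_arc `&` _ = open_arc `&` [set a | F r <= (1 + sin a) / 2]).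
  apply: measurableI; first exact: measurable_arc.
  have ms : measurable_fun setT (fun a : R => (1 + sin a) / 2).
    apply: measurable_funM => //; apply: measurable_funD => //.
    apply: continuous_measurable_fun; exact: continuous_sin.
  rewrite -[X in measurable X]setTI.
  exact: (measurable_fun_ler (measurable_cst (F r)) ms measurableT (Y := [set true])).
by apply/seteqP; split => a /= [aa] h; split => //; move: h;
  rewrite /= in_itv/= andbT -(lp_cdf_leE hp r (quantile0 a)) quantile0P.
Qed.

Lemma cosine_ge0 a : 0 <= cosine a.
Proof.
rewrite /cosine patchE; case: ifPn => // /set_mem; rewrite open_arcE => h.
by rewrite divr_ge0// ltW// cos_gt0_pihalf.
Qed.

Lemma measurable_cosine : measurable_fun setT cosine.
Proof.
apply: (measurable_restrictT _ measurable_arc).1; apply: measurable_funTS.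
apply: measurable_funM => //; apply: continuous_measurable_fun.
exact: continuous_cos.
Qed.

Lemma cosineE a : open_arc a -> cosine a = cos a / 2.
Proof. by move=> aa; rewrite /cosine patchE mem_set. Qed.

Lemma cosine_out a : ~ open_arc a -> cosine a = 0.
Proof. by move=> aa; rewrite /cosine patchE memNset. Qed.

Lemma two_cdf x : -1 < 2 * F x - 1 < 1.
Proof.
have := lp_cdf_gt0 hp x; have := lp_cdf_lt1 hp x => h1 h0.
by apply/andP; split; lra.
Qed.

Lemma asin_cdf_arc x : open_arc (asin (2 * F x - 1)).
Proof.
have /andP[h1 h2] := two_cdf x.
by rewrite open_arcE asin_gtNpi2 ?asin_ltpi2// ?h1 ?h2 ltW.
Qed.

Lemma sin_asin_cdf x : sin (asin (2 * F x - 1)) = 2 * F x - 1.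
Proof.
by rewrite asinK// in_itv/=; have /andP[/ltW-> /ltW->] := two_cdf x.
Qed.

Lemma arcW a : open_arc a -> a \in `[- (pi / 2), pi / 2].
Proof. by rewrite open_arcE in_itv/= => /andP[/ltW-> /ltW->]. Qed.

Lemma quantile_itv x y a : open_arc a ->
  (x < quantile a <= y) =
  (asin (2 * F x - 1) < a <= asin (2 * F y - 1)).
Proof.
move=> aa; rewrite -(lp_cdf_ltE hp) -(lp_cdf_leE hp _ y) quantileP//.
rewrite (leNgt a) -!(fun z => ltr_sin (arcW (asin_cdf_arc z)) (arcW aa)).
rewrite !sin_asin_cdf -leNgt.
by congr andb; apply/idP/idP => h; lra.
Qed.

Lemma dens_cosine_itv x y : x < y ->
  dens cosine_ge0 measurable_cosine (quantile @^-1` `]x, y]%classic) =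
  dens (prho_ge0 hp) (measurable_prho hp) `]x, y]%classic.
Proof.
move=> xy.
pose al := asin (2 * F x - 1); pose be := asin (2 * F y - 1).
have albe : al < be.
  rewrite -(ltr_sin (arcW (asin_cdf_arc x)) (arcW (asin_cdf_arc y))).
  by rewrite !sin_asin_cdf ltrD2r ltr_pM2l// lp_cdf_ltE.
have -> : dens (prho_ge0 hp) (measurable_prho hp) `]x, y]%classic =
    (F y - F x)%:E by rewrite (lp_cdf_itv hp (ltW xy)).
rewrite /dens.
transitivity (\int[mu]_(a in `]al, be]%classic) (cos a / 2)%:E)%E.
  rewrite [LHS]integral_mkcond [RHS]integral_mkcond; apply: eq_integral => a _.
  rewrite !patchE (_ : (a \in _ @^-1` _) = (x < quantile a <= y)); last first.
    by apply/idP/idP; rewrite inE/= in_itv.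
  rewrite mem_setE.
  have [aa|na] := pselect (open_arc a).
    by rewrite quantile_itv// in_itv/= cosineE.
  rewrite cosine_out// if_same in_itv/=; case: ifPn => // /andP[h1 h2].
  exfalso; apply: na; rewrite open_arcE.
  have := asin_cdf_arc x; have := asin_cdf_arc y; rewrite !open_arcE.
  rewrite -/al -/be => /andP[_ h3] /andP[h4 _].
  by rewrite (lt_trans h4)//= (le_lt_trans h2).
rewrite integral_itv_obnd_cbnd; last first.
  apply: measurable_funTS; apply/measurable_EFinP; apply: measurable_funM => //.
  by apply: continuous_measurable_fun; exact: continuous_cos.
have ds (z : R) : is_derive z (1 : R) (fun a : R => sin a / 2) (cos z / 2).
  by apply: is_derive_eq; rewrite !scaler0 add0r [LHS]mulrC.
have cs : continuous (fun a : R => sin a / 2).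
  by move=> z; apply: cvgM; [exact: continuous_sin|exact: cvg_cst].
rewrite (continuous_FTC2 (F := fun a : R => sin a / 2) albe).
- by rewrite !sin_asin_cdf -EFinB; congr EFin; field.
- by apply: continuous_subspaceT => z; apply: cvgM; [exact: continuous_cos|exact: cvg_cst].
- split.
  + by move=> z _; exact: ex_derive.
  + by apply: cvg_at_right_filter; exact: cs.
  + by apply: cvg_at_left_filter; exact: cs.
- by move=> z _; rewrite derive1E derive_val.
Qed.

Lemma integral_quantile (u : R -> R) : measurable_fun setT u ->
  (forall x, 0 <= u x) ->
  (\int[mu]_a (u (quantile a) * cosine a)%:E = \int[mu]_x (u x * prho x)%:E)%E.
Proof.
have fin a b : (dens (prho_ge0 hp) (measurable_prho hp) `]a, b]%classic < +oo)%E.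
  apply: (@le_lt_trans _ _ 1%E); last exact: ltry.
  exact: (lp_law_le1 hp (measurable_itv _)).
have push := eq_dens_pushforward measurable_quantile dens_cosine_itv fin.
exact: (integral_change_density measurable_quantile push).
Qed.

Lemma integral_cosine : (\int[mu]_a (cosine a)%:E = 1)%E.
Proof.
rewrite -(lp_law_setT hp).
transitivity (\int[mu]_a (1 * cosine a)%:E)%E.
  by apply: eq_integral => a _; rewrite mul1r.
rewrite (integral_quantile (u := fun=> 1))//.
by apply: eq_integral => a _; rewrite mul1r.
Qed.

(** Let x and y be the quantiles, A = F x (1 - F y) and B = F y (1 - F x). Since
    cos a = 2 sqrt(F x (1 - F x)), the left product of cosines is 4 sqrt(A B) and
    the square of the cosine at the midpoint is A + B + 2 sqrt(A B): the gain is a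
    function of the odds ratio A / B, which [odds_ratio] bounds below. *)
Lemma cosine_gain a b : open_arc a -> open_arc b ->
  cos a * cos b * expR (gain_rate p * gain_cost p (quantile a - quantile b)) <=
  cos ((a + b) / 2) ^+ 2.
Proof.
wlog ba : a b / quantile b <= quantile a.
  move=> wl aa bb; have [/wl|/ltW /wl] := leP (quantile b) (quantile a); first exact.
  by move=> /(_ bb aa); rewrite -opprB gain_costN (mulrC (cos b)) (addrC b).
move=> aa bb.
have Fa := quantileP aa; have Fb := quantileP bb.
set x := quantile a in ba Fa *; set y := quantile b in ba Fb *.
have xa : 0 < F x by exact: lp_cdf_gt0.
have xb : F x < 1 by exact: lp_cdf_lt1.
have ya : 0 < F y by exact: lp_cdf_gt0.
have yb : F y < 1 by exact: lp_cdf_lt1.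
pose A := F x * (1 - F y); pose B := F y * (1 - F x).
have A0 : 0 < A by rewrite mulr_gt0// subr_gt0.
have B0 : 0 < B by rewrite mulr_gt0// subr_gt0.
have d0 : 0 <= x - y by rewrite subr_ge0.
have Z0 := rho_mass_gt0 hp.
have c0 : 0 <= 2 / Z by rewrite divr_ge0// ltW.
have h1 : (1 + 2 / Z * ((x - y) / 2)) * B <= A.
  apply: (@odds_ratio R p hp (fun s => 1 + 2 / Z * s)); last exact: ba.
  - by move=> s s0; rewrite lerDl mulr_ge0.
  - by move=> s t s0 st; rewrite lerD2l ler_wpM2l.
  - by move=> z s z0 s0; exact: lp_cdf_hazard.
have h2 : expR (((x - y) / 2) `^ p) * B <= A.
  apply: (@odds_ratio R p hp (fun s => expR (s `^ p))); last exact: ba.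
  - by move=> s s0; rewrite -expR0 ler_expR powR_ge0.
  - move=> s t s0 st; rewrite ler_expR ge0_ler_powR ?nnegrE ?(ltW pp)//.
    exact: le_trans st.
  - move=> z s z0 s0; rewrite -(ler_pM2l (expR_gt0 (- s `^ p))) mulrA -expRD addNr.
    by rewrite expR0 mul1r; exact: lp_cdf_shift.
have := gain_ratio hp A0 B0 d0 h1 h2.
have ca : 0 < cos a by apply: cos_gt0_pihalf; move: aa; rewrite open_arcE.
have cb : 0 < cos b by apply: cos_gt0_pihalf; move: bb; rewrite open_arcE.
have sa : sin a = 2 * F x - 1 by rewrite Fa; field.
have sb : sin b = 2 * F y - 1 by rewrite Fb; field.
have ca2 : cos a ^+ 2 = 4 * (F x * (1 - F x)).
  by rewrite cos2sin2 sa; ring.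
have cb2 : cos b ^+ 2 = 4 * (F y * (1 - F y)).
  by rewrite cos2sin2 sb; ring.
have X : cos a * cos b = 4 * Num.sqrt (A * B).
  have c1 : 0 <= cos a * cos b by rewrite mulr_ge0 ?(ltW ca) ?(ltW cb).
  have c2 : 0 <= 4 * Num.sqrt (A * B) by rewrite mulr_ge0 ?sqrtr_ge0.
  apply/eqP; rewrite -(eqrXn2 (ltn0Sn 1) c1 c2) [X in X == _]exprMn ca2 cb2.
  rewrite exprMn sqr_sqrtr; last by rewrite mulr_ge0 ?(ltW A0) ?(ltW B0).
  by apply/eqP; rewrite /A /B; ring.
have m2 : cos ((a + b) / 2) ^+ 2 = A + B + 2 * Num.sqrt (A * B).
  have e : (a + b) / 2 *+ 2 = a + b by rewrite mulr2n; field.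
  have := cos_mulr2n ((a + b) / 2); rewrite e cosD X sa sb mulr2n => h.
  by move: h; rewrite /A /B => h; lra.
by rewrite X m2.
Qed.

End transport.

(** * Concentration for the product law *)

Section property_tau.
Context {R : realType} (p : R) (hp : 1 <= p <= 2).
Local Notation mu := (@lebesgue_measure R).
Local Notation lam n := (@lebesgue_tuple R n).
Local Notation prho := (@prho R p).
Local Notation T := (quantile hp).
Local Notation cost d := (gain_rate p * gain_cost p d).

Lemma arc_midpoint (a b : R) : open_arc a -> open_arc b -> open_arc ((a + b) / 2).
Proof.
rewrite !open_arcE => /andP[a1 a2] /andP[b1 b2].
by apply/andP; split; lra.
Qed.

(** In the variable of the cosine law this is the Prekopa-Leindler inequality with
    the density of that law at the midpoint, whose gain over the product of the
    densities at the end points absorbs the cost. *)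
Lemma property_tau1 (u v : R -> R) (C : R) : 0 <= C ->
  measurable_fun setT u -> measurable_fun setT v ->
  (forall x, 0 <= u x <= 1) -> (forall x, 0 <= v x <= 1) ->
  (forall x y, u x * v y <= C * expR (cost (x - y))) ->
  ((\int[mu]_x (u x * prho x)%:E) * (\int[mu]_x (v x * prho x)%:E) <= C%:E)%E.
Proof.
move=> C0 mu0 mv u01 v01 uv.
have u0 x : 0 <= u x by have /andP[] := u01 x.
have v0 x : 0 <= v x by have /andP[] := v01 x.
rewrite -(integral_quantile hp mu0 u0) -(integral_quantile hp mv v0).
pose h a := Num.sqrt C * @cosine R a.
have h0 a : 0 <= h a by rewrite mulr_ge0 ?sqrtr_ge0 ?cosine_ge0.
have mh : measurable_fun setT h.
  by apply: measurable_funM => //; exact: measurable_cosine.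
have mf (w : R -> R) : measurable_fun setT w ->
    measurable_fun setT (fun a => w (T a) * @cosine R a).
  move=> mw; apply: measurable_funM; last exact: measurable_cosine.
  exact: (measurableT_comp mw (measurable_quantile hp)).
have cos1 a : @cosine R a <= 1.
  have [aa|na] := pselect (open_arc a); last by rewrite cosine_out.
  by rewrite cosineE// ler_pdivrMr// mul1r (le_trans (cos_le1 a))// ler1n.
have w01 (w : R -> R) : (forall x, 0 <= w x <= 1) ->
    forall a, 0 <= w (T a) * @cosine R a <= 1.
  move=> hw a; have /andP[w0 w1] := hw (T a).
  by rewrite mulr_ge0 ?cosine_ge0//= mulr_ile1// cosine_ge0.
have out (w : R -> R) a : pi / 2 < `|a| -> w (T a) * @cosine R a = 0.
  move=> ha; rewrite cosine_out ?mulr0// open_arcE -ltr_norml => /lt_trans.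
  by move=> /(_ _ ha); rewrite ltxx.
have hint : (\int[mu]_x (h x)%:E = (Num.sqrt C)%:E)%E.
  have mc : measurable_fun setT (fun a : R => (cosine a)%:E).
    by apply/measurable_EFinP; exact: measurable_cosine.
  have c0 (a : R) : setT a -> (0 <= (cosine a)%:E)%E by rewrite lee_fin cosine_ge0.
  have s0 : (0 <= (Num.sqrt C)%:E)%E by rewrite lee_fin sqrtr_ge0.
  have := ge0_integralZl mu measurableT mc c0 s0.
  by rewrite (integral_cosine hp) mule1.
have pi0 : 0 <= pi / 2 :> R by rewrite divr_ge0// pi_ge0.
have := prekopa_leindler pi0 (mf u mu0) (mf v mv) mh (w01 u u01) (w01 v v01) h0
  (out u) (out v) _ hint.
rewrite sqr_sqrtr//; apply => a b.
have [aa|na] := pselect (open_arc a); last first.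
  by rewrite (cosine_out na) mulr0 mul0r sqr_ge0.
have [bb|nb] := pselect (open_arc b); last first.
  by rewrite (cosine_out nb) !mulr0 sqr_ge0.
have mm := arc_midpoint aa bb.
rewrite /h exprMn sqr_sqrtr// !cosineE//.
have ca : 0 < cos a by apply: cos_gt0_pihalf; move: aa; rewrite open_arcE.
have cb : 0 < cos b by apply: cos_gt0_pihalf; move: bb; rewrite open_arcE.
have g := cosine_gain hp aa bb.
have w := uv (T a) (T b).
have cab : 0 <= cos a * cos b by rewrite mulr_ge0// ltW.
have := ler_wpM2r cab w; have := ler_wpM2l C0 g.
set E := expR _; set m := cos ((a + b) / 2).
move=> h1 h2.
have h3 : u (T a) * v (T b) * (cos a * cos b) <= C * m ^+ 2.
  by apply: (le_trans h2); apply: le_trans h1; rewrite [leLHS]mulrAC [leRHS]mulrA.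
rewrite (_ : u (T a) * (cos a / 2) * (v (T b) * (cos b / 2)) =
  u (T a) * v (T b) * (cos a * cos b) / 4); last by field.
rewrite (_ : C * (m / 2) ^+ 2 = C * m ^+ 2 / 4); last by field.
by rewrite ler_pM2r.
Qed.

Definition lp_density n (x : n.-tuple R) : R := \prod_(i < n) prho (tnth x i).

Lemma lp_density_ge0 n (x : n.-tuple R) : 0 <= lp_density x.
Proof. by apply: prodr_ge0 => i _; exact: prho_ge0. Qed.

Lemma lp_density_cons n t (x : n.-tuple R) :
  lp_density (tcons t x) = prho t * lp_density x.
Proof.
rewrite {1}/lp_density big_ord_recl tnth_tcons0; congr (_ * _).
by apply: eq_bigr => i _; rewrite tnth_tconsS.
Qed.

Lemma measurable_lp_density n : measurable_fun setT (@lp_density n).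
Proof.
apply: measurable_prod => i _.
exact: (measurableT_comp (measurable_prho hp) (measurable_tnth i)).
Qed.

(** Cost functions add up over the coordinates, so that constants do not depend on
    the dimension. *)
Definition total_cost n (x y : n.-tuple R) : R :=
  \sum_(i < n) gain_cost p (tnth x i - tnth y i).

Lemma total_cost_cons n s t (x y : n.-tuple R) :
  total_cost (tcons s x) (tcons t y) =
  gain_cost p (s - t) + total_cost x y.
Proof.
rewrite /total_cost big_ord_recl !tnth_tcons0; congr (_ + _).
by apply: eq_bigr => i _; rewrite !tnth_tconsS.
Qed.

Lemma integral_density_cons n (U : n.+1.-tuple R -> R) :
  measurable_fun setT U -> (forall x, 0 <= U x) ->
  (\int[lam n.+1]_x (U x * lp_density x)%:E =
   \int[mu]_t ((prho t)%:E *
     \int[lam n]_x (U (tcons t x) * lp_density x)%:E))%E.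
Proof.
move=> mU U0.
rewrite integral_lebesgue_tupleS; last 2 first.
- apply/measurable_EFinP; apply: measurable_funM => //.
  exact: measurable_lp_density.
- by move=> x; rewrite lee_fin mulr_ge0// lp_density_ge0.
apply: eq_integral => t _.
have mt : measurable_fun setT
    (fun x : n.-tuple R => (U (tcons t x) * lp_density x)%:E).
  apply/measurable_EFinP; apply: measurable_funM; last exact: measurable_lp_density.
  exact: measurable_cons_fix.
have t0 x : setT x -> (0 <= (U (tcons t x) * lp_density x)%:E)%E.
  by rewrite lee_fin mulr_ge0// lp_density_ge0.
have p0 : (0 <= (prho t)%:E)%E by rewrite lee_fin prho_ge0.
rewrite -(ge0_integralZl (lam n) measurableT mt t0 p0).
by apply: eq_integral => x _; rewrite lp_density_cons mulrCA EFinM.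
Qed.

Lemma integral_lp_density n : (\int[lam n]_x (lp_density x)%:E = 1)%E.
Proof.
elim: n => [|n IH].
  rewrite /= integral_dirac//; last first.
    by apply/measurable_EFinP; exact: measurable_lp_density.
  by rewrite diracE in_setT mul1e /lp_density big_ord0.
transitivity (\int[lam n.+1]_x (1 * lp_density x)%:E)%E.
  by apply: eq_integral => x _; rewrite mul1r.
rewrite (integral_density_cons (U := fun=> 1))//.
rewrite -(lp_law_setT hp) /lp_law /dens; apply: eq_integral => t _.
rewrite (_ : \int[lam n]_x (1 * lp_density x)%:E = 1)%E ?mule1//.
by rewrite -IH; apply: eq_integral => x _; rewrite mul1r.
Qed.

Lemma fiber_density_bounds n (U : n.-tuple R -> R) : measurable_fun setT U ->
  (forall x, 0 <= U x <= 1) ->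
  (0 <= \int[lam n]_x (U x * lp_density x)%:E <= 1)%E.
Proof.
move=> mU U01.
have U0 x : 0 <= U x by have /andP[] := U01 x.
have n0 x : setT x -> (0 <= (U x * lp_density x)%:E)%E.
  by rewrite lee_fin mulr_ge0// lp_density_ge0.
apply/andP; split; first by apply: integral_ge0 => x _; exact: n0.
rewrite -(integral_lp_density n); apply: (ge0_le_integral (lam n) measurableT n0).
- apply/measurable_EFinP; apply: measurable_funM => //.
  exact: measurable_lp_density.
- by apply/measurable_EFinP; exact: measurable_lp_density.
- move=> x _; rewrite lee_fin ler_piMl ?lp_density_ge0//.
  by have /andP[] := U01 x.
Qed.

(** Induction on the dimension: the integrals over the last n coordinates of the
    two functions satisfy the one-dimensional hypothesis, with the cost of the
    first coordinate, because of the n-dimensional inequality on the fibers. *)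
Lemma property_tau n (U V : n.-tuple R -> R) (C : R) : 0 <= C ->
  measurable_fun setT U -> measurable_fun setT V ->
  (forall x, 0 <= U x <= 1) -> (forall x, 0 <= V x <= 1) ->
  (forall x y, U x * V y <= C * expR (gain_rate p * total_cost x y)) ->
  ((\int[lam n]_x (U x * lp_density x)%:E) *
   (\int[lam n]_x (V x * lp_density x)%:E) <= C%:E)%E.
Proof.
elim: n U V C => [|n IH] U V C C0 mU mV U01 V01 UV.
  have md (W : 0.-tuple R -> R) : measurable_fun setT W ->
      measurable_fun setT (fun x : 0.-tuple R => (W x * lp_density x)%:E).
    move=> mW; apply/measurable_EFinP; apply: measurable_funM => //.
    exact: measurable_lp_density.
  rewrite /= (integral_dirac _ _ (md U mU))// (integral_dirac _ _ (md V mV))//.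
  rewrite diracE in_setT !mul1e /lp_density !big_ord0 !mulr1 -EFinM lee_fin.
  by have := UV [tuple] [tuple]; rewrite /total_cost big_ord0 mulr0 expR0 mulr1.
have U0 x : 0 <= U x by have /andP[] := U01 x.
have V0 x : 0 <= V x by have /andP[] := V01 x.
pose I (W : n.+1.-tuple R -> R) (t : R) :=
  (\int[lam n]_x (W (tcons t x) * lp_density x)%:E)%E.
have Ib (W : n.+1.-tuple R -> R) t : measurable_fun setT W ->
    (forall x, 0 <= W x <= 1) -> (0 <= I W t <= 1)%E.
  move=> mW W01; apply: fiber_density_bounds; last by move=> x; exact: W01.
  exact: measurable_cons_fix.
have If (W : n.+1.-tuple R -> R) t : measurable_fun setT W ->
    (forall x, 0 <= W x <= 1) -> I W t \is a fin_num.
  move=> mW W01; have /andP[h0 h1] := Ib W t mW W01.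
  by rewrite ge0_fin_numE// (le_lt_trans h1)// ltry.
have mI (W : n.+1.-tuple R -> R) : measurable_fun setT W ->
    (forall x, 0 <= W x) -> measurable_fun setT (fun t => fine (I W t)).
  move=> mW W0; apply: (measurableT_comp (fine_measurable measurableT)).
  pose f (y : n.+1.-tuple R) := (W y * lp_density [tuple of behead y])%:E.
  have mf : measurable_fun setT f.
    apply/measurable_EFinP; apply: measurable_funM => //.
    exact: (measurableT_comp (@measurable_lp_density n) (@measurable_behead _ _ n)).
  have f0 y : (0 <= f y)%E by rewrite lee_fin mulr_ge0// lp_density_ge0.
  have e : I W = (fun t : R => \int[lam n]_x f (tcons t x))%E.
    apply/funext => t; apply: eq_integral => x _; rewrite /f.
    by have -> : [tuple of behead (tcons t x)] = x by exact: val_inj.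
  rewrite e; exact: measurable_fun_fiber.
have Iu01 (W : n.+1.-tuple R -> R) t : measurable_fun setT W ->
    (forall x, 0 <= W x <= 1) -> 0 <= fine (I W t) <= 1.
  move=> mW W01; have := Ib W t mW W01.
  by rewrite -{1 2}(fineK (If W t mW W01)) !lee_fin.
have Ieq (W : n.+1.-tuple R -> R) : measurable_fun setT W ->
    (forall x, 0 <= W x <= 1) ->
    (\int[lam n.+1]_x (W x * lp_density x)%:E =
     \int[mu]_t (fine (I W t) * prho t)%:E)%E.
  move=> mW W01; rewrite integral_density_cons//; last first.
    by move=> x; have /andP[] := W01 x.
  apply: eq_integral => t _.
  by rewrite [RHS]EFinM (fineK (If W t mW W01)) muleC.
rewrite (Ieq U mU U01) (Ieq V mV V01).
apply: property_tau1 => //.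
- exact: mI.
- exact: mI.
- by move=> t; exact: Iu01.
- by move=> t; exact: Iu01.
move=> s t; rewrite -lee_fin EFinM (fineK (If U s mU U01)) (fineK (If V t mV V01)).
apply: IH.
- by rewrite mulr_ge0// expR_ge0.
- exact: measurable_cons_fix.
- exact: measurable_cons_fix.
- by move=> x; exact: U01.
- by move=> x; exact: V01.
move=> x y; have := UV (tcons s x) (tcons t y).
by rewrite total_cost_cons mulrDr expRD mulrA.
Qed.

Definition lp_prob n (A : set (n.-tuple R)) : \bar R :=
  (\int[lam n]_(x in A) (lp_density x)%:E)%E.

Lemma lp_probE n (A : set (n.-tuple R)) : measurable A ->
  lp_prob A = (\int[lam n]_x (\1_A x * lp_density x)%:E)%E.
Proof.
move=> mA; rewrite /lp_prob integral_mkcond; apply: eq_integral => x _.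
by rewrite patchE indicE; case: ifPn => _; rewrite ?mul1r ?mul0r.
Qed.

(** If no term of the cost exceeds the total S >= 1, the p-th powers in it
    bound the squares up to the factor S^(2/p - 1). *)
Lemma total_cost_ge n (x y : n.-tuple R) (d : R) : 1 <= d ->
  d <= eucl_dist x y -> d `^ p <= total_cost x y.
Proof.
move=> d1 dxy.
have d0 : 0 <= d by rewrite (le_trans ler01).
pose S := total_cost x y.
have S0 : 0 <= S by apply: sumr_ge0 => i _; exact: gain_cost_ge0.
have pp := p_gt0 hp.
have dS : d ^+ 2 <= \sum_(i < n) (tnth x i - tnth y i) ^+ 2.
  have s0 : 0 <= \sum_(i < n) (tnth x i - tnth y i) ^+ 2.
    by apply: sumr_ge0 => i _; exact: sqr_ge0.
  by rewrite -(sqr_sqrtr s0) ler_pXn2r ?nnegrE ?sqrtr_ge0.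
have term i : gain_cost p (tnth x i - tnth y i) <= S.
  rewrite /S /total_cost (bigD1 i)//= lerDl.
  by apply: sumr_ge0 => j _; exact: gain_cost_ge0.
pose q := 2 / p - 1.
have q0 : 0 <= q.
  by rewrite subr_ge0 ler_pdivlMr// mul1r; have /andP[] := hp.
pose M := Num.max 1 (S `^ q).
have bound (z : R) : gain_cost p z <= S -> z ^+ 2 <= gain_cost p z * M.
  rewrite /gain_cost; have M1 : 1 <= M by rewrite le_max lexx.
  have [h|h] := leP (z ^+ 2) (`|z| `^ p) => hz.
    by rewrite ler_peMr// sqr_ge0.
  have zz : z ^+ 2 = `|z| `^ p * (`|z| `^ p) `^ q.
    rewrite -[LHS]real_normK ?num_real// -powR_mulrn// -[in RHS]powRrM.
    have [->|z0] := eqVneq `|z| 0.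
      by rewrite [LHS]powR0 ?pnatr_eq0// [0 `^ p]powR0 ?mul0r// gt_eqF.
    rewrite -powRD; last by rewrite z0 implybT.
    by congr (_ `^ _); rewrite /q; field; rewrite gt_eqF.
  rewrite zz ler_wpM2l ?powR_ge0// (le_trans _ (_ : S `^ q <= _))//.
    by rewrite ge0_ler_powR// nnegrE ?powR_ge0.
  by rewrite le_max lexx orbT.
have dSM : d ^+ 2 <= S * M.
  apply: (le_trans dS); rewrite /S /total_cost mulr_suml.
  by apply: ler_sum => i _; exact: bound.
have S1 : 1 <= S.
  rewrite leNgt; apply/negP => S1.
  have M1 : M = 1.
    apply/eqP; rewrite eq_le le_max lexx andbT ge_max lexx/=.
    have : S `^ q <= 1 `^ q by rewrite ge0_ler_powR ?nnegrE ?ler01 ?(ltW S1).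
    by rewrite powR1.
  have : 1 <= d ^+ 2 by rewrite exprn_ege1.
  by move: dSM; rewrite M1 mulr1 => h1 h2; move: S1; rewrite ltNge (le_trans h2 h1).
have ME : M = S `^ q.
  by apply/max_idPr; rewrite -(powRr0 S) ler_powR.
have SS : S * M = S `^ (2 / p).
  have Sn0 : S != 0 by rewrite gt_eqF// (lt_le_trans ltr01).
  rewrite ME -{1}(powRr1 S0) -powRD; last by rewrite Sn0 implybT.
  by congr (_ `^ _); rewrite /q; ring.
have pd : d `^ p = (d ^+ 2) `^ (p / 2).
  by rewrite -powR_mulrn// -powRrM; congr (_ `^ _); field.
rewrite pd (le_trans (_ : _ <= (S `^ (2 / p)) `^ (p / 2)))//.
  rewrite ge0_ler_powR ?nnegrE ?powR_ge0 ?sqr_ge0 ?divr_ge0 ?(ltW pp)//.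
  by rewrite -SS.
by rewrite -powRrM (_ : 2 / p * (p / 2) = 1) ?powRr1//; field; rewrite gt_eqF.
Qed.

(** Apply [property_tau] to the indicator functions of A and B. *)
Lemma concentration n (A B : set (n.-tuple R)) (d : R) :
  measurable A -> measurable B -> 1 <= d ->
  (forall a b, A a -> B b -> d <= eucl_dist a b) ->
  (lp_prob A * lp_prob B <= (expR (- (gain_rate p * d `^ p)))%:E)%E.
Proof.
move=> mA mB d1 AB; rewrite !lp_probE//.
have i01 (E : set (n.-tuple R)) x : 0 <= (\1_E x : R) <= 1.
  by rewrite indicE; case: (_ \in _); rewrite /= ?lexx ?ler01.
apply: property_tau.
- exact: expR_ge0.
- exact: measurable_indic.
- exact: measurable_indic.
- exact: i01.
- exact: i01.
move=> x y; rewrite -expRD.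
rewrite !indicE; have [xA|_] := boolP (x \in A); last first.
  by rewrite mul0r expR_ge0.
have [yB|_] := boolP (y \in B); last by rewrite mulr0 expR_ge0.
rewrite mulr1 -[leLHS]expR0 ler_expR addrC subr_ge0.
rewrite ler_pM2l ?(gain_rate_gt0 hp)//; apply: total_cost_ge => //.
by apply: AB; exact: set_mem.
Qed.

End property_tau.

(** * Euclidean distance and neighbourhoods *)

Section euclid.
Context {R : realType}.
Implicit Types n : nat.

Definition norm2 n (x : n.-tuple R) : R := Num.sqrt (\sum_(i < n) tnth x i ^+ 2).

Lemma norm2_ge0 n (x : n.-tuple R) : 0 <= norm2 x.
Proof. exact: sqrtr_ge0. Qed.

Lemma norm2_sqr n (x : n.-tuple R) : norm2 x ^+ 2 = \sum_(i < n) tnth x i ^+ 2.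
Proof. by rewrite sqr_sqrtr// sumr_ge0// => i _; exact: sqr_ge0. Qed.

Lemma cauchy_schwarz n (x y : 'I_n -> R) (a b : R) : 0 <= a -> 0 <= b ->
  \sum_(i < n) x i ^+ 2 <= a ^+ 2 -> \sum_(i < n) y i ^+ 2 <= b ^+ 2 ->
  \sum_(i < n) x i * y i <= a * b.
Proof.
have zero (z : 'I_n -> R) : \sum_(i < n) z i ^+ 2 <= 0 -> forall i, z i = 0.
  move=> h i; apply/eqP; rewrite -sqrf_eq0 eq_le sqr_ge0 andbT.
  apply: le_trans h; rewrite (bigD1 i)//= lerDl.
  by apply: sumr_ge0 => j _; exact: sqr_ge0.
move=> a0 b0 xa yb.
move: a0; rewrite le_eqVlt => /predU1P[a0|a0].
  rewrite -a0 mul0r big1// => i _; rewrite (zero x) ?mul0r//.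
  by move: xa; rewrite -a0 expr0n.
move: b0; rewrite le_eqVlt => /predU1P[b0|b0].
  rewrite -b0 mulr0 big1// => i _; rewrite (zero y) ?mulr0//.
  by move: yb; rewrite -b0 expr0n.
have ab0 : 0 < a * b by rewrite mulr_gt0.
apply: (@le_trans _ _ (\sum_(i < n) (b / (2 * a) * x i ^+ 2 + a / (2 * b) * y i ^+ 2))).
  apply: ler_sum => i _.
  rewrite -subr_ge0 (_ : _ - _ = (b * x i - a * y i) ^+ 2 / (2 * (a * b))).
    by rewrite divr_ge0 ?sqr_ge0// mulr_ge0// ltW.
  by field; rewrite !gt_eqF.
rewrite big_split/= -!mulr_sumr.
apply: (@le_trans _ _ (b / (2 * a) * a ^+ 2 + a / (2 * b) * b ^+ 2)).
  by apply: lerD; rewrite ler_wpM2l// divr_ge0// ?mulr_ge0// ltW.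
by rewrite le_eqVlt; apply/orP; left; apply/eqP; field; rewrite !gt_eqF.
Qed.

Lemma minkowski n (x y : 'I_n -> R) (a b : R) : 0 <= a -> 0 <= b ->
  \sum_(i < n) x i ^+ 2 <= a ^+ 2 -> \sum_(i < n) y i ^+ 2 <= b ^+ 2 ->
  \sum_(i < n) (x i + y i) ^+ 2 <= (a + b) ^+ 2.
Proof.
move=> a0 b0 xa yb; have xy := cauchy_schwarz a0 b0 xa yb.
have -> : \sum_(i < n) (x i + y i) ^+ 2 = \sum_(i < n) x i ^+ 2 +
    2 * (\sum_(i < n) x i * y i) + \sum_(i < n) y i ^+ 2.
  rewrite mulr_sumr -!big_split/=; apply: eq_bigr => i _; ring.
rewrite (_ : (a + b) ^+ 2 = a ^+ 2 + 2 * (a * b) + b ^+ 2); last by ring.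
by apply: lerD => //; apply: lerD => //; rewrite ler_pM2l.
Qed.

Lemma eucl_dist_ge0 n (x y : n.-tuple R) : 0 <= eucl_dist x y.
Proof. exact: sqrtr_ge0. Qed.

Lemma eucl_dist_sqr n (x y : n.-tuple R) :
  eucl_dist x y ^+ 2 = \sum_(i < n) (tnth x i - tnth y i) ^+ 2.
Proof. by rewrite sqr_sqrtr// sumr_ge0// => i _; exact: sqr_ge0. Qed.

Lemma eucl_distC n (x y : n.-tuple R) : eucl_dist x y = eucl_dist y x.
Proof.
by rewrite /eucl_dist; congr Num.sqrt; apply: eq_bigr => i _; rewrite -sqrrN opprB.
Qed.

Lemma eucl_dist_triangle n (x y z : n.-tuple R) :
  eucl_dist x z <= eucl_dist x y + eucl_dist y z.
Proof.
rewrite -(ler_pXn2r (ltn0Sn 1)) ?nnegrE ?addr_ge0 ?eucl_dist_ge0//.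
rewrite eucl_dist_sqr.
have := @minkowski n (fun i => tnth x i - tnth y i) (fun i => tnth y i - tnth z i)
  _ _ (eucl_dist_ge0 x y) (eucl_dist_ge0 y z).
rewrite !eucl_dist_sqr !lexx => /(_ isT isT); apply: le_trans.
by apply: ler_sum => i _; rewrite addrA subrK.
Qed.

Lemma norm2_dist n (x y : n.-tuple R) : norm2 y <= norm2 x + eucl_dist x y.
Proof.
rewrite -(ler_pXn2r (ltn0Sn 1)) ?nnegrE ?addr_ge0 ?norm2_ge0 ?eucl_dist_ge0//.
rewrite norm2_sqr.
have := @minkowski n (fun i => tnth x i) (fun i => tnth y i - tnth x i)
  _ _ (norm2_ge0 x) (eucl_dist_ge0 y x).
rewrite norm2_sqr eucl_dist_sqr !lexx => /(_ isT isT).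
rewrite (eucl_distC x); apply: le_trans.
by apply: ler_sum => i _; rewrite addrC subrK.
Qed.

Lemma norm2_tscale n (a : R) (x : n.-tuple R) : norm2 (tscale a x) = `|a| * norm2 x.
Proof.
rewrite /norm2 -sqrtr_sqr -sqrtrM ?sqr_ge0// mulr_sumr; congr Num.sqrt.
by apply: eq_bigr => i _; rewrite tnth_tscale exprMn.
Qed.

Lemma eucl_dist_tscale n (a b : R) (x : n.-tuple R) :
  eucl_dist (tscale a x) (tscale b x) = `|a - b| * norm2 x.
Proof.
rewrite /norm2 -sqrtr_sqr -sqrtrM ?sqr_ge0// mulr_sumr; congr Num.sqrt.
by apply: eq_bigr => i _; rewrite !tnth_tscale -mulrBl exprMn.
Qed.

Lemma eucl_dist_tscale2 n (a : R) (x y : n.-tuple R) : 0 <= a ->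
  eucl_dist (tscale a x) (tscale a y) = a * eucl_dist x y.
Proof.
move=> a0; rewrite /eucl_dist -[a in RHS]ger0_norm// -sqrtr_sqr -sqrtrM ?sqr_ge0//.
rewrite mulr_sumr; congr Num.sqrt.
by apply: eq_bigr => i _; rewrite !tnth_tscale -mulrBr exprMn.
Qed.

Lemma measurable_norm2 n : measurable_fun setT (@norm2 n).
Proof.
apply: (measurableT_comp (@continuous_measurable_fun R Num.sqrt (@sqrt_continuous R))).
apply: measurable_sum => i; apply: measurable_funX; exact: measurable_tnth.
Qed.

Lemma measurable_eucl_dist n (y : n.-tuple R) :
  measurable_fun setT (fun x => eucl_dist x y).
Proof.
apply: (measurableT_comp (@continuous_measurable_fun R Num.sqrt (@sqrt_continuous R))).
apply: measurable_sum => i; apply: measurable_funX; apply: measurable_funB => //.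
exact: measurable_tnth.
Qed.

Lemma rational_approx n (y : n.-tuple R) (e : R) : 0 < e ->
  exists q : n.-tuple rat, eucl_dist y [tuple ratr (tnth q i) | i < n] <= e.
Proof.
move=> e0; pose h := e / (n%:R + 1).
have n1 : 0 < n%:R + 1 :> R by rewrite ltr_wpDl.
have h0 : 0 < h by rewrite divr_gt0.
have ex (i : 'I_n) : exists q : rat, `|tnth y i - ratr q| <= h.
  have : tnth y i - h < tnth y i + h by rewrite ltrBlDr -addrA ltrDl addr_gt0.
  move=> /rat_in_itvoo[q]; rewrite in_itv/= => hq; exists q.
  by rewrite distrC ler_distl; have /andP[/ltW-> /ltW->] := hq.
have [q hq] := choice ex.
exists [tuple q i | i < n].
rewrite -(ler_pXn2r (ltn0Sn 1)) ?nnegrE ?eucl_dist_ge0 ?(ltW e0)//.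
rewrite eucl_dist_sqr; apply: (@le_trans _ _ (\sum_(i < n) h ^+ 2)).
  apply: ler_sum => i _; rewrite !tnth_mktuple -real_normK ?num_real//.
  by rewrite ler_pXn2r ?nnegrE ?(ltW h0).
rewrite sumr_const card_ord -mulr_natl /h expr_div_n mulrCA ler_piMr ?sqr_ge0//.
rewrite ler_pdivrMr ?exprn_gt0// mul1r expr2.
have : 0 <= n%:R :> R by [].
by move=> hn; nra.
Qed.

(** A Borel set between the closed r-neighbourhood of S and the closed
    (r + 1)-neighbourhood: a countable union of balls with rational centers. *)
Definition envelope n (S : set (n.-tuple R)) (r : R) : set (n.-tuple R) :=
  \bigcup_(q in [set q : n.-tuple rat | exists2 x, S x &
      eucl_dist [tuple ratr (tnth q i) | i < n] x <= r + 2^-1])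
    [set y | eucl_dist y [tuple ratr (tnth q i) | i < n] <= 2^-1].

Lemma measurable_envelope n (S : set (n.-tuple R)) r : measurable (envelope S r).
Proof.
rewrite /envelope bigcup_mkcond; apply: countable_bigcupT_measurable => [|q].
  exact: countableP.
case: ifPn => // _; rewrite -[X in measurable X]setTI.
exact: (measurable_fun_ler (measurable_eucl_dist _) (measurable_cst (2^-1 : R))
  measurableT (Y := [set true])).
Qed.

Lemma sub_envelope n (S : set (n.-tuple R)) r x y : S x -> eucl_dist y x <= r ->
  envelope S r y.
Proof.
move=> Sx yx; have h0 : 0 < 2^-1 :> R by rewrite invr_gt0.
have [q hq] := rational_approx y h0.
exists q => //=; exists x => //.
by rewrite (le_trans (eucl_dist_triangle _ y _))// addrC lerD// eucl_distC.
Qed.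

Lemma envelope_sub n (S : set (n.-tuple R)) r y : envelope S r y ->
  exists2 x, S x & eucl_dist y x <= r + 1.
Proof.
move=> [q [x Sx qx] yq]; exists x => //.
apply: (le_trans (eucl_dist_triangle _ _ _)); apply: (le_trans (lerD yq qx)); lra.
Qed.

End euclid.

(** * The product law as a mixture of uniform laws on balls *)

Section inflation.
Context {R : realType} (p : R) (hp : 1 <= p <= 2).
Local Notation mu := (@lebesgue_measure R).
Local Notation lam n := (@lebesgue_tuple R n).
Local Notation Z := (@rho_mass R p).

Lemma lp_densityE n (x : n.-tuple R) :
  lp_density p x = (Z ^+ n)^-1 * expR (- lnorm p x).
Proof.
rewrite /lp_density /prho /rho big_split/= prodr_const card_ord exprVn mulrC.
by rewrite /lnorm -sumrN expR_sum.
Qed.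

Lemma lp_prob_layers n (E : set (n.-tuple R)) : measurable E ->
  ((Z ^+ n)%:E * lp_prob p E =
   \int[mu]_(t in `]0%R, +oo[) ((expR (- t))%:E * lam n (E `&` lball p n t)))%E.
Proof.
move=> mE.
rewrite -(ge0_integral_expRN_layers (lam n) mE (@measurable_lnorm R p hp n)
  (@lnorm_ge0 R p n)).
have Zn : 0 < Z ^+ n by rewrite exprn_gt0// rho_mass_gt0.
have md : measurable_fun E (fun x : n.-tuple R => (lp_density p x)%:E).
  apply/measurable_EFinP; apply: measurable_funTS; exact: measurable_lp_density.
have d0 (x : n.-tuple R) : E x -> (0 <= (lp_density p x)%:E)%E.
  by rewrite lee_fin lp_density_ge0.
have z0 : (0 <= (Z ^+ n)%:E)%E by rewrite lee_fin ltW.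
rewrite /lp_prob -(ge0_integralZl (lam n) mE md d0 z0).
by apply: eq_integral => x _; rewrite -EFinM lp_densityE mulrA divff ?mul1r// gt_eqF.
Qed.

Lemma measurable_lp_prob_layers n (E : set (n.-tuple R)) : measurable E ->
  measurable_fun setT (fun t : R => (expR (- t))%:E * lam n (E `&` lball p n t))%E.
Proof.
move=> mE; apply: emeasurable_funM.
  by apply/measurable_EFinP; exact: measurable_expRN.
exact: (measurable_sublevels (lam n) mE (@measurable_lnorm R p hp n)).
Qed.

(** The ratio of the ball [lball p n t] to the ball of unit volume. *)
Definition inflation n (t : R) : R := t `^ p^-1 / omega p n.

Lemma inflation_gt0 n t : (0 < n)%N -> 0 < t -> 0 < inflation n t.
Proof. by move=> n0 t0; rewrite divr_gt0 ?powR_gt0 ?omega_gt0. Qed.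

Lemma inflation_expn n t : (0 < n)%N -> 0 < t ->
  inflation n t ^+ n = t `^ (n%:R / p) / omega p n ^+ n.
Proof.
move=> n0 t0; rewrite /inflation exprMn exprVn; congr (_ / _).
by rewrite -powR_mulrn ?powR_ge0// -powRrM mulrC.
Qed.

Lemma inflation_lball n t (x : n.-tuple R) : (0 < n)%N -> 0 < t ->
  unit_lp_ball p n x -> lball p n t (tscale (inflation n t) x).
Proof.
move=> n0 t0; rewrite unit_lp_ballE// /lball/= => hx.
have w0 := omega_gt0 hp n0.
rewrite lnorm_tscale ?(ltW (inflation_gt0 n0 t0))//.
have i0 := ltW (inflation_gt0 n0 t0).
have e : t = inflation n t `^ p * omega p n `^ p.
  by rewrite -powRM// ?(ltW w0)// /inflation divfK ?gt_eqF// (powRVK hp (ltW t0)).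
by rewrite [leRHS]e ler_wpM2l ?powR_ge0.
Qed.

(** The law of density [lp_density] is the mixture of the uniform laws on the
    balls [lball p n t], with t of Gamma law; it gives mass at least 3/4 to
    the t in [gamma_window]. *)
Lemma lp_prob_inflation_ge n (S E : set (n.-tuple R)) : (0 < n)%N ->
  measurable S -> measurable E -> S `<=` unit_lp_ball p n ->
  (forall t x, gamma_window (n%:R / p) t -> S x -> E (tscale (inflation n t) x)) ->
  ((3 / 4)%:E * lam n S <= lp_prob p E)%E.
Proof.
move=> n0 mS mE SK SE; set N := n%:R / p.
have N0 : 0 < N by exact: ratio_gt0.
have w0 := omega_gt0 hp n0.
have Z0 : 0 < Z ^+ n by rewrite exprn_gt0// rho_mass_gt0.
have wn0 : 0 < omega p n ^+ n by rewrite exprn_gt0.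
have mW := measurable_gamma_window N.
have layer (t : R) : gamma_window N t ->
    ((t `^ N / omega p n ^+ n)%:E * lam n S <= lam n (E `&` lball p n t))%E.
  move=> Wt; have t0 : 0 < t by case: Wt.
  have s0 := inflation_gt0 n0 t0.
  have mB : measurable (E `&` lball p n t) by apply: measurableI => //; exact: measurable_lball.
  rewrite -inflation_expn//.
  have -> : lam n (E `&` lball p n t) = ((inflation n t ^+ n)%:E *
      lam n (tscale (inflation n t) @^-1` (E `&` lball p n t)))%E.
    by rewrite lebesgue_tscale// muleA -EFinM divff ?mul1e// gt_eqF// exprn_gt0.
  rewrite lee_wpmul2l ?lee_fin ?(ltW (exprn_gt0 _ s0))//.
  apply: le_measure; rewrite ?inE//.
    rewrite -[X in measurable X]setTI; exact: measurable_tscale.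
  by move=> x Sx; split; [exact: SE|apply: inflation_lball => //; exact: SK].
have S1 : (lam n S <= 1)%E.
  rewrite -(lebesgue_unit_lp_ball hp n0); apply: le_measure; rewrite ?inE//.
  by rewrite unit_lp_ballE//; exact: measurable_lball.
have Sf : lam n S \is a fin_num.
  by rewrite ge0_fin_numE ?measure_ge0// (le_lt_trans S1)// ltry.
have s0 : 0 <= fine (lam n S) by rewrite fine_ge0.
rewrite -(@lee_pmul2l _ (Z ^+ n)%:E)// lp_prob_layers//.
have mI : measurable (`]0%R, +oo[%classic : set R) by [].
have WI : gamma_window N `<=` `]0%R, +oo[%classic.
  by move=> t [t0 _]; rewrite /= in_itv/= t0.
have mf := measurable_lp_prob_layers mE.
have f0 (t : R) : (0 <= (expR (- t))%:E * lam n (E `&` lball p n t))%E.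
  by rewrite mule_ge0// lee_fin expR_ge0.
apply: (@le_trans _ _ (\int[mu]_(t in gamma_window N)
    ((expR (- t))%:E * lam n (E `&` lball p n t)))%E); last first.
  apply: ge0_subset_integral => //; exact: measurable_funTS.
pose c := fine (lam n S) / omega p n ^+ n.
have c0 : (0 <= c%:E)%E by rewrite lee_fin divr_ge0// ltW.
have mk : measurable_fun (gamma_window N) (fun t : R => (gamma_kernel N t)%:E).
  by apply/measurable_EFinP; apply: measurable_funTS; exact: measurable_gamma_kernel.
have k0 (t : R) : gamma_window N t -> (0 <= (gamma_kernel N t)%:E)%E.
  by rewrite lee_fin gamma_kernel_ge0.
apply: (@le_trans _ _ (\int[mu]_(t in gamma_window N) (c%:E * (gamma_kernel N t)%:E))%E).
  rewrite (ge0_integralZl mu mW mk k0 c0).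
  have := lee_wpmul2l c0 (gamma_window_ge N0); apply: le_trans.
  rewrite -(fineK Sf) -!EFinM lee_fin /c le_eqVlt; apply/orP; left; apply/eqP.
  rewrite omega_expn// -/N.
  have G0 : 0 < Gamma (1 + N) by exact: Gamma_gt0.
  by field; rewrite !gt_eqF// rho_mass_gt0.
apply: (ge0_le_integral mu mW) => //.
- by move=> t Wt; rewrite mule_ge0//; exact: k0.
- by apply: measurable_funeM.
- exact: measurable_funTS mf.
move=> t Wt; have := layer t Wt.
rewrite -(fineK Sf) -!EFinM => h.
have e0 : (0 <= (expR (- t))%:E)%E by rewrite lee_fin expR_ge0.
have := lee_wpmul2l e0 h; apply: le_trans.
rewrite -EFinM lee_fin /c /gamma_kernel le_eqVlt; apply/orP; left; apply/eqP.
by field; rewrite gt_eqF.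
Qed.

End inflation.

(** * Deviations of the Euclidean norm *)

Section deviation.
Context {R : realType} (p : R) (hp : 1 <= p <= 2).
Local Notation mu := (@lebesgue_measure R).
Local Notation lam n := (@lebesgue_tuple R n).
Local Notation Z := (@rho_mass R p).
Local Notation prho := (@prho R p).

(** As |x| <= 1 or |x| <= |x|^p, it suffices to bound the square of |x|^p / 4 by
    the exponential of |x|^p / 2. *)
Lemma sqr_le_expR (x : R) : x ^+ 2 <= 16 * expR (2^-1 * `|x| `^ p).
Proof.
have p1 : 1 <= p by have /andP[] := hp.
rewrite -real_normK ?num_real//; set y := `|x|.
have y0 : 0 <= y by exact: normr_ge0.
have e1 : 1 <= expR (2^-1 * y `^ p).
  by rewrite -expR0 ler_expR mulr_ge0 ?powR_ge0.
have [y1|y1] := leP y 1.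
  by have := exprn_ile1 2 y0 y1; lra.
have yp : y <= y `^ p by rewrite -{1}(powRr1 y0) ler_powR// ltW.
set u := y `^ p / 4.
have u0 : 0 <= u by rewrite divr_ge0 ?powR_ge0.
have ue : u <= expR u by have := expR_ge1Dx u; lra.
have -> : 2^-1 * y `^ p = u + u by rewrite /u; field.
rewrite expRD; have y4 : y <= 4 * u by rewrite /u mulrCA divff ?mulr1.
by have eu := expR_ge0 u; nra.
Qed.

Lemma second_moment : (\int[mu]_x (x ^+ 2 * prho x)%:E <= 32%:E)%E.
Proof.
have pp := p_gt0 hp; have Z0 := rho_mass_gt0 hp.
pose a : R := (2 `^ p^-1)^-1.
have c0 : 0 < 2 `^ p^-1 :> R by rewrite powR_gt0.
have a0 : 0 < a by rewrite invr_gt0.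
have ap (x : R) : `|a * x + 0| `^ p = 2^-1 * `|x| `^ p.
  rewrite addr0 normrM (gtr0_norm a0) powRM// ?(ltW a0)//; congr (_ * _).
  have -> : a = 2^-1 `^ p^-1 by rewrite /a -powR_inv1 ?powR_ge0// powRAC powR_inv1.
  by rewrite powRVK.
have mr : measurable_fun setT (fun x : R => (rho p x)%:E).
  by apply/measurable_EFinP; exact: measurable_rho.
have r0 (x : R) : (0 <= (rho p x)%:E)%E by rewrite lee_fin ltW// rho_gt0.
have mra : measurable_fun setT (fun x : R => (rho p (a * x + 0))%:E).
  apply/measurable_EFinP; apply: (measurableT_comp (measurable_rho hp)).
  exact: measurable_affine.
have ra0 (x : R) : setT x -> (0 <= (rho p (a * x + 0))%:E)%E by move=> _; exact: r0.
have k0 : (0 <= (16 / Z)%:E)%E by rewrite lee_fin divr_ge0// ltW.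
apply: (@le_trans _ _ (\int[mu]_x ((16 / Z)%:E * (rho p (a * x + 0))%:E))%E).
  apply: (ge0_le_integral mu measurableT) => //.
  - by move=> x _; rewrite lee_fin mulr_ge0 ?sqr_ge0// prho_ge0.
  - apply/measurable_EFinP; apply: measurable_funM; first exact: measurable_funX.
    exact: measurable_prho.
  - exact: measurable_funeM.
  move=> x _; rewrite -EFinM lee_fin.
  apply: (@le_trans _ _ (16 * expR (2^-1 * `|x| `^ p) * prho x)).
    by apply: ler_wpM2r; [exact: prho_ge0|exact: sqr_le_expR].
  rewrite /prho /rho ap le_eqVlt; apply/orP; left; apply/eqP.
  set u := `|x| `^ p.
  have -> : expR (- (2^-1 * u)) = expR (2^-1 * u) * expR (- u).
    by rewrite -expRD; congr expR; field.
  by field; rewrite gt_eqF.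
rewrite (ge0_integralZl mu measurableT mra ra0 k0).
rewrite (@ge0_integral_affine R a 0 (fun x => (rho p x)%:E) a0 mr r0) (integral_rho hp).
rewrite -!EFinM lee_fin /a invrK.
have : 2 `^ p^-1 <= 2 :> R.
  rewrite -[leRHS]powRr1// ler_powR ?ler1n// invf_le1//.
  by have /andP[] := hp.
rewrite (_ : 16 / Z * (2 `^ p^-1 * Z) = 16 * 2 `^ p^-1); first lra.
by field; rewrite gt_eqF.
Qed.

Lemma measurable_sum_sqr n :
  measurable_fun setT (fun x : n.-tuple R => \sum_(i < n) tnth x i ^+ 2).
Proof.
by apply: measurable_sum => i; apply: measurable_funX; exact: measurable_tnth.
Qed.

Lemma integral_sum_sqr n :
  (\int[lam n]_x ((\sum_(i < n) tnth x i ^+ 2) * lp_density p x)%:E <= (32 * n%:R)%:E)%E.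
Proof.
pose S m (x : m.-tuple R) := \sum_(i < m) tnth x i ^+ 2.
rewrite -/(S n).
have S0 m (x : m.-tuple R) : 0 <= S m x by apply: sumr_ge0 => i _; exact: sqr_ge0.
elim: n => [|n IH].
  rewrite /= integral0_eq ?mulr0// => x _.
  by rewrite /S big_ord0 mul0r.
have md : measurable_fun setT (fun x : n.-tuple R => (lp_density p x)%:E).
  by apply/measurable_EFinP; exact: measurable_lp_density.
have d0 (x : n.-tuple R) : setT x -> (0 <= (lp_density p x)%:E)%E.
  by rewrite lee_fin lp_density_ge0.
have mSd : measurable_fun setT (fun x : n.-tuple R => (S n x * lp_density p x)%:E).
  apply/measurable_EFinP; apply: measurable_funM; first exact: measurable_sum_sqr.
  exact: measurable_lp_density.
have Sd0 (x : n.-tuple R) : setT x -> (0 <= (S n x * lp_density p x)%:E)%E.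
  by rewrite lee_fin mulr_ge0// lp_density_ge0.
rewrite (integral_density_cons hp); last 2 first.
- exact: measurable_sum_sqr.
- exact: S0.
pose I := (\int[lam n]_x (S n x * lp_density p x)%:E)%E.
have I0 : (0 <= I)%E by apply: integral_ge0 => x _; exact: Sd0.
have inner (t : R) : (\int[lam n]_x (S n.+1 (tcons t x) * lp_density p x)%:E =
    (t ^+ 2)%:E + I)%E.
  have t0 : (0 <= (t ^+ 2)%:E)%E by rewrite lee_fin sqr_ge0.
  have mtd : measurable_fun setT (fun x : n.-tuple R => (t ^+ 2)%:E * (lp_density p x)%:E)%E.
    exact: measurable_funeM.
  have td0 (x : n.-tuple R) : setT x -> (0 <= (t ^+ 2)%:E * (lp_density p x)%:E)%E.
    by move=> _; rewrite mule_ge0//; exact: d0.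
  rewrite -[X in (X + I)%E]mule1 -(integral_lp_density hp n).
  rewrite -(ge0_integralZl (lam n) measurableT md d0 t0).
  rewrite -(ge0_integralD (lam n) measurableT td0 mtd Sd0 mSd).
  apply: eq_integral => x _; rewrite -EFinM -EFinD -mulrDl; congr (_ * _)%:E.
  rewrite {1}/S big_ord_recl tnth_tcons0; congr (_ + _).
  by apply: eq_bigr => i _; rewrite tnth_tconsS.
under eq_integral do rewrite inner.
have mp : measurable_fun setT (fun t : R => (prho t)%:E).
  by apply/measurable_EFinP; exact: measurable_prho.
have p0 (t : R) : setT t -> (0 <= (prho t)%:E)%E by rewrite lee_fin prho_ge0.
have mI : measurable_fun setT (fun t : R => I * (prho t)%:E)%E by exact: measurable_funeM.
have pI0 (t : R) : setT t -> (0 <= I * (prho t)%:E)%E.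
  by move=> _; rewrite mule_ge0//; exact: p0.
have m2 : measurable_fun setT (fun t : R => (t ^+ 2 * prho t)%:E).
  apply/measurable_EFinP; apply: measurable_funM; last exact: measurable_prho.
  exact: measurable_funX.
have p2 (t : R) : setT t -> (0 <= (t ^+ 2 * prho t)%:E)%E.
  by rewrite lee_fin mulr_ge0 ?sqr_ge0// prho_ge0.
have -> : (\int[mu]_t ((prho t)%:E * ((t ^+ 2)%:E + I)) =
    \int[mu]_t ((t ^+ 2 * prho t)%:E + I * (prho t)%:E))%E.
  apply: eq_integral => t _; rewrite ge0_muleDr ?lee_fin ?sqr_ge0//.
  by rewrite -EFinM [prho t * _]mulrC (muleC _ I).
rewrite (ge0_integralD mu measurableT p2 m2 pI0 mI).
rewrite (ge0_integralZl mu measurableT mp p0 I0).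
have -> : (\int[mu]_x (prho x)%:E = 1)%E by exact: lp_law_setT.
rewrite mule1 (le_trans (leeD second_moment IH))// -EFinD lee_fin -natr1.
lra.
Qed.

Lemma measurable_norm2_gt n (r : R) : measurable [set x : n.-tuple R | r < norm2 x].
Proof.
rewrite -[X in measurable X]setTI.
exact: (measurable_fun_ltr (measurable_cst r) (@measurable_norm2 R n) measurableT
  (Y := [set true])).
Qed.

Lemma lp_prob_setT n : lp_prob p [set: n.-tuple R] = 1%E.
Proof. exact: integral_lp_density. Qed.

Lemma lp_prob_setC n (A : set (n.-tuple R)) : measurable A ->
  (lp_prob p A + lp_prob p (~` A) = 1)%E.
Proof.
move=> mA; rewrite -(lp_prob_setT n) -(setUv A) /lp_prob ge0_integral_setU//.
- exact: measurableC.
- apply/measurable_EFinP; apply: measurable_funTS; exact: measurable_lp_density.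
- by move=> x _; rewrite lee_fin lp_density_ge0.
- by apply/disj_setPCl.
Qed.

Lemma lp_prob_ge0 n (A : set (n.-tuple R)) : (0 <= lp_prob p A)%E.
Proof. by apply: integral_ge0 => x _; rewrite lee_fin lp_density_ge0. Qed.

Lemma lp_prob_fin n (A : set (n.-tuple R)) : measurable A -> lp_prob p A \is a fin_num.
Proof.
move=> mA; rewrite ge0_fin_numE ?lp_prob_ge0// (le_lt_trans _ (ltry 1))//.
by rewrite -(lp_prob_setC mA) leeDl// lp_prob_ge0.
Qed.

(** Markov's inequality for the squared norm, whose mean is at most 32 n. *)
Lemma lp_prob_norm2_markov n : (0 < n)%N ->
  (lp_prob p [set x : n.-tuple R | (12 * Num.sqrt n%:R < norm2 x)%R] <= (4^-1)%:E)%E.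
Proof.
move=> n0; set E := [set x | _].
have mE : measurable E by exact: measurable_norm2_gt.
have n0R : 0 < n%:R :> R by rewrite ltr0n.
have md : measurable_fun E (fun x : n.-tuple R => (lp_density p x)%:E).
  apply/measurable_EFinP; apply: measurable_funTS; exact: measurable_lp_density.
have d0 (x : n.-tuple R) : E x -> (0 <= (lp_density p x)%:E)%E.
  by rewrite lee_fin lp_density_ge0.
have mS : measurable_fun setT (fun x : n.-tuple R =>
    ((\sum_(i < n) tnth x i ^+ 2) * lp_density p x)%:E).
  apply/measurable_EFinP; apply: measurable_funM; first exact: measurable_sum_sqr.
  exact: measurable_lp_density.
have S0 (x : n.-tuple R) : (0 <= ((\sum_(i < n) tnth x i ^+ 2) * lp_density p x)%:E)%E.
  by rewrite lee_fin mulr_ge0 ?lp_density_ge0// sumr_ge0// => i _; exact: sqr_ge0.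
have c0 : (0 <= (144 * n%:R : R)%:E)%E by rewrite lee_fin mulr_ge0.
have : ((144 * n%:R)%:E * lp_prob p E <= (32 * n%:R)%:E)%E.
  rewrite /lp_prob -(ge0_integralZl (lam n) mE md d0 c0).
  apply: le_trans (integral_sum_sqr n).
  apply: (@le_trans _ _ (\int[lam n]_(x in E)
      ((\sum_(i < n) tnth x i ^+ 2) * lp_density p x)%:E)%E).
    apply: (ge0_le_integral (lam n) mE) => //.
    - by move=> x Ex; rewrite mule_ge0//; exact: d0.
    - exact: measurable_funeM.
    - exact: measurable_funTS.
    move=> x Ex; rewrite -EFinM lee_fin ler_wpM2r ?lp_density_ge0//.
    rewrite -norm2_sqr (_ : 144 * _ = (12 * Num.sqrt n%:R) ^+ 2); last first.
      by rewrite exprMn sqr_sqrtr//; congr (_ * _); lra.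
    by rewrite ler_pXn2r ?nnegrE ?mulr_ge0 ?sqrtr_ge0// ltW.
  by apply: ge0_subset_integral => //.
rewrite -(fineK (lp_prob_fin mE)) -EFinM !lee_fin => h.
nra.
Qed.

(** The ball of radius 12 sqrt(n) has probability at least 3/4, and it is at
    distance at least 12 sqrt(n) from the set of larger norms: concentration
    upgrades the constant in Markov's inequality to an exponentially small one. *)
Lemma lp_prob_norm2_deviation n : (0 < n)%N ->
  (lp_prob p [set x : n.-tuple R | (24 * Num.sqrt n%:R < norm2 x)%R] <=
   (4 / 3 * expR (- (gain_rate p * Num.sqrt n%:R)))%:E)%E.
Proof.
move=> n0; set B := [set x | _].
have s1 : 1 <= Num.sqrt n%:R :> R by rewrite -{1}sqrtr1 ler_sqrt ?ler1n.
pose A := [set x : n.-tuple R | 12 * Num.sqrt n%:R < norm2 x].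
have mA : measurable (~` A) by apply: measurableC; exact: measurable_norm2_gt.
have mB : measurable B by exact: measurable_norm2_gt.
have d1 : 1 <= 12 * Num.sqrt n%:R :> R by lra.
have := concentration hp mA mB d1.
have sep (a b : n.-tuple R) : (~` A) a -> B b -> 12 * Num.sqrt n%:R <= eucl_dist a b.
  rewrite /A/B/= => /negP; rewrite -leNgt => ha hb.
  by have := norm2_dist a b; lra.
move=> /(_ sep).
have := lp_prob_setC (@measurable_norm2_gt n (12 * Num.sqrt n%:R)).
have := lp_prob_norm2_markov n0.
rewrite -/A -(fineK (lp_prob_fin mA)) -(fineK (lp_prob_fin mB)).
rewrite -(fineK (lp_prob_fin (@measurable_norm2_gt n _))).
rewrite -EFinD -EFinM !lee_fin => hA hC h; have {}hC := EFin_inj hC.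
have e : expR (- (gain_rate p * (12 * Num.sqrt n%:R) `^ p)) <=
    expR (- (gain_rate p * Num.sqrt n%:R)).
  rewrite ler_expR lerN2 ler_pM2l ?(gain_rate_gt0 hp)//.
  apply: (@le_trans _ _ (12 * Num.sqrt n%:R)); first lra.
  rewrite -{1}(powRr1 (le_trans ler01 d1)) ler_powR//.
  by have /andP[] := hp.
have b0 : 0 <= fine (lp_prob p B) by rewrite fine_ge0// lp_prob_ge0.
rewrite /A in hA hC *; nra.
Qed.

End deviation.

(** * The upper bound for Borel sets *)

Section upper_borel.
Context {R : realType} (p : R) (hp : 1 <= p <= 2).
Local Notation mu := (@lebesgue_measure R).
Local Notation lam n := (@lebesgue_tuple R n).
Local Notation Z := (@rho_mass R p).
Local Notation center n := (n%:R / p + 1).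
Local Notation sigma n := (inflation p n (center n)).

(** As 1/p <= 1, the power lies between u and 1. *)
Lemma powRV_dist1 (u : R) : 0 <= u -> `|u `^ p^-1 - 1| <= `|u - 1|.
Proof.
move=> u0; have pp := p_gt0 hp.
have p1 : p^-1 <= 1 by rewrite invf_le1//; have /andP[] := hp.
have one : 1 `^ p^-1 = 1 :> R by rewrite powR1.
have [u1|u1] := leP u 1.
  have a : u `^ p^-1 <= 1.
    by rewrite -[leRHS]one ge0_ler_powR ?nnegrE// invr_ge0 ltW.
  have b : u <= u `^ p^-1.
    have [->|un0] := eqVneq u 0; first by rewrite powR_ge0.
    by rewrite -{1}(powRr1 u0) ger_powR// u1 andbT lt0r un0.
  by rewrite ler0_norm ?subr_le0// ler0_norm ?subr_le0//; lra.
have a : 1 <= u `^ p^-1.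
  by rewrite -[leLHS]one ge0_ler_powR ?nnegrE ?invr_ge0 ?(ltW u1) ?(ltW pp).
have b : u `^ p^-1 <= u.
  by rewrite -{2}(powRr1 u0) ler_powR// ltW.
by rewrite ger0_norm ?subr_ge0// ger0_norm ?subr_ge0 ?(ltW u1)//; lra.
Qed.

Lemma inflation_window n t : (0 < n)%N -> gamma_window (n%:R / p) t ->
  `|inflation p n t - sigma n| <= sigma n * (2 / Num.sqrt (center n)).
Proof.
move=> n0 [t0 ht]; set c := center n.
have N0 := ratio_gt0 hp n0.
have c0 : 0 < c by rewrite addr_gt0.
have s0 : 0 < sigma n by exact: inflation_gt0.
have sc0 : 0 < Num.sqrt c by rewrite sqrtr_gt0.
have w0 := omega_gt0 hp n0.
have e : inflation p n t = (t / c) `^ p^-1 * sigma n.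
  rewrite /inflation mulrA -powRM ?(ltW c0)// ?divfK ?gt_eqF//.
  by rewrite divr_ge0// ltW.
have -> : inflation p n t - sigma n = sigma n * ((t / c) `^ p^-1 - 1).
  by rewrite e; ring.
rewrite normrM gtr0_norm// ler_pM2l//.
have tc0 : 0 <= t / c by rewrite divr_ge0 ?ltW.
apply: (le_trans (powRV_dist1 tc0)).
have -> : t / c - 1 = (t - c) / c by field; rewrite gt_eqF.
rewrite normrM (@ger0_norm _ c^-1) ?invr_ge0 ?(ltW c0)//.
have -> : 2 / Num.sqrt c = (2 * Num.sqrt c) / c.
  have cs : c = Num.sqrt c ^+ 2 by rewrite sqr_sqrtr// ltW.
  by move: cs sc0; set s := Num.sqrt c => -> sc0; field; rewrite gt_eqF.
by rewrite ler_pM2r ?invr_gt0.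
Qed.

Lemma center_ge n : n%:R / 2 <= center n.
Proof.
have pp := p_gt0 hp; rewrite (@le_trans _ _ (n%:R / p)) ?lerDl//.
rewrite ler_wpM2l ?lef_pV2 ?posrE//.
by have /andP[] := hp.
Qed.

(** By the upper bound on the Gamma function, [omega p n] is of order at most
    n^(1/p); so the inflation of the unit ball at the center of the window does
    not shrink distances by more than a constant factor. *)
Lemma inflation_ge n : (2 <= n)%N -> Z / 4 <= sigma n.
Proof.
move=> n2; have n0 : (0 < n)%N by exact: leq_trans n2.
have pp := p_gt0 hp; have N0 := ratio_gt0 hp n0; set N := n%:R / p in N0 *.
have nR : 0 < n%:R :> R by rewrite ltr0n.
have N1 : 1 <= N.
  rewrite ler_pdivlMr// mul1r (@le_trans _ _ 2)//; last by rewrite ler_nat.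
  by have /andP[] := hp.
have c0 : 0 < N + 1 by rewrite addr_gt0.
have Z0 := rho_mass_gt0 hp.
have G0 : 0 < Gamma (1 + N) by exact: Gamma_gt0.
have Gle : Gamma (1 + N) <= (4 * (N + 1)) `^ N.
  have h2 : 0 < (2^-1 : R) < 1 by apply/andP; split; lra.
  have Nn : 0 <= N by exact: ltW.
  apply: (le_trans (Gamma_le N0 h2)).
  have -> : (1 - 2^-1 : R) = 2^-1 by lra.
  rewrite invrK.
  have two : 2 <= 2 `^ N :> R by rewrite -[leLHS]powRr1// ler_powR// ler1n.
  have e2 : 2 <= expR 1 :> R by have := expR_ge1Dx (1:R); lra.
  apply: (@le_trans _ _ ((2 * N) `^ N * 2 `^ N)).
    apply: ler_pM => //; rewrite ?powR_ge0//.
    have b0 : 0 <= N / (2^-1 * expR 1) by rewrite divr_ge0// mulr_ge0 ?invr_ge0 ?expR_ge0.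
    have tN : 0 <= 2 * N by lra.
    rewrite ge0_ler_powR ?nnegrE//.
    rewrite ler_pdivrMr; last by rewrite mulr_gt0 ?expR_gt0.
    rewrite (_ : 2 * N * (2^-1 * expR 1) = N * expR 1); last by field.
    by rewrite ler_peMr//; lra.
  have tN : 0 <= 2 * N by lra.
  by rewrite -powRM// ge0_ler_powR ?nnegrE//; lra.
rewrite /inflation -/N omegaE -/N invf_div mulrCA ler_pM2l//.
rewrite -[4^-1]div1r ler_pdivrMr// mulrAC ler_pdivlMr ?powR_gt0// mul1r.
have : Gamma (1 + N) `^ n%:R^-1 <= (4 * (N + 1)) `^ p^-1.
  have -> : p^-1 = N * n%:R^-1 by rewrite /N; field; rewrite !gt_eqF.
  rewrite powRrM ge0_ler_powR ?nnegrE ?powR_ge0 ?invr_ge0 ?ler0n ?(ltW G0)//.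
move=> /le_trans; apply; rewrite powRM ?(ltW c0)// mulrC ler_wpM2l ?powR_ge0//.
rewrite -[leRHS]powRr1// ler_powR ?ler1n// invf_le1//.
by have /andP[] := hp.
Qed.

(** On the window the factor of inflation is at least half of its central value,
    so that these points are inflated to norms larger than 24 sqrt(n). *)
Lemma lebesgue_large_norm_le n : (32 <= n)%N ->
  (lam n (unit_lp_ball p n `&`
     [set x : n.-tuple R | (48 * Num.sqrt n%:R < norm2 (tscale (sigma n) x))%R]) <=
   (16 / 9 * expR (- (gain_rate p * Num.sqrt n%:R)))%:E)%E.
Proof.
move=> n32; have n0 : (0 < n)%N by exact: leq_trans n32.
set B := _ `&` _.
have mK : measurable (unit_lp_ball p n) by rewrite unit_lp_ballE//; exact: measurable_lball.
have mB : measurable B.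
  apply: measurableI => //.
  rewrite (_ : mkset _ = tscale (sigma n) @^-1`
    [set x | 48 * Num.sqrt n%:R < norm2 x])//.
  rewrite -[X in measurable X]setTI; apply: measurable_tscale => //.
  exact: measurable_norm2_gt.
have N0 := ratio_gt0 hp n0.
have c0 : 0 < center n by rewrite addr_gt0.
have s0 : 0 < sigma n by exact: inflation_gt0.
have BE t x : gamma_window (n%:R / p) t -> B x ->
    [set x : n.-tuple R | 24 * Num.sqrt n%:R < norm2 x] (tscale (inflation p n t) x).
  move=> Wt [_ /=]; rewrite !norm2_tscale gtr0_norm// => hx.
  have t0 : 0 < t by case: Wt.
  rewrite gtr0_norm ?inflation_gt0//.
  have := inflation_window n0 Wt; rewrite ler_distl => /andP[h _].
  have sc : 4 <= Num.sqrt (center n).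
    rewrite -[leLHS]ger0_norm// -sqrtr_sqr ler_sqrt; last exact: ltW.
    apply: le_trans (center_ge n).
    have : 32 <= n%:R :> R by rewrite ler_nat.
    by lra.
  have r : 2 / Num.sqrt (center n) <= 2^-1.
    by rewrite ler_pdivrMr; lra.
  have : sigma n / 2 <= inflation p n t.
    by apply: le_trans h; have := ler_wpM2l (ltW s0) r; lra.
  move=> /(ler_wpM2r (norm2_ge0 x)); lra.
have := lp_prob_inflation_ge hp n0 mB (@measurable_norm2_gt R n _) (@subIsetl _ _ _) BE.
move=> /le_trans /(_ (lp_prob_norm2_deviation hp n0)).
have Bf : lam n B \is a fin_num.
  rewrite ge0_fin_numE ?measure_ge0// (le_lt_trans _ (ltry 1))//.
  rewrite -(lebesgue_unit_lp_ball hp n0); apply: le_measure; rewrite ?inE//.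
  exact: subIsetl.
by rewrite -(fineK Bf) -EFinM !lee_fin; lra.
Qed.

Lemma measurable_large_norm n : (0 < n)%N ->
  measurable [set x : n.-tuple R | 48 * Num.sqrt n%:R < norm2 (tscale (sigma n) x)].
Proof.
move=> n0.
rewrite (_ : mkset _ = tscale (sigma n) @^-1` [set x | 48 * Num.sqrt n%:R < norm2 x])//.
rewrite -[X in measurable X]setTI; apply: measurable_tscale => //.
exact: measurable_norm2_gt.
Qed.

(** The points of A of norm at most 48 sqrt(n) move by at most 192 when the factor
    of inflation runs over the window, whose relative width is of order
    1 / sqrt(n); the volume of the other points of A is at most e / 4. *)
Lemma lp_prob_envelope n (A : set (n.-tuple R)) (e : R) : (32 <= n)%N ->
  measurable A -> A `<=` unit_lp_ball p n -> ((3 / 4 * e)%:E <= lam n A)%E ->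
  16 / 9 * expR (- (gain_rate p * Num.sqrt n%:R)) <= e / 4 ->
  ((3 / 8 * e)%:E <= lp_prob p (envelope (tscale (sigma n) @` A) 192))%E.
Proof.
move=> n32 mA AK Ae small; have n0 : (0 < n)%N by exact: leq_trans n32.
set B := [set x : n.-tuple R | 48 * Num.sqrt n%:R < norm2 (tscale (sigma n) x)].
have mB : measurable B by exact: measurable_large_norm.
have mAB : measurable (A `\` B) by exact: measurableD.
have N0 := ratio_gt0 hp n0.
have c0 : 0 < center n by rewrite addr_gt0.
have s0 : 0 < sigma n by exact: inflation_gt0.
have fin (S : set (n.-tuple R)) : measurable S -> S `<=` unit_lp_ball p n ->
    lam n S \is a fin_num.
  move=> mS SK; rewrite ge0_fin_numE ?measure_ge0// (le_lt_trans _ (ltry 1))//.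
  rewrite -(lebesgue_unit_lp_ball hp n0); apply: le_measure; rewrite ?inE//.
  by rewrite unit_lp_ballE//; exact: measurable_lball.
have ABK : A `\` B `<=` unit_lp_ball p n by move=> x [/AK].
have half : ((e / 2)%:E <= lam n (A `\` B))%E.
  have mAB' : measurable (A `&` B) by exact: measurableI.
  have bad : (lam n (A `&` B) <= (e / 4)%:E)%E.
    apply: (@le_trans _ _ (16 / 9 * expR (- (gain_rate p * Num.sqrt n%:R)))%:E).
      apply: le_trans (lebesgue_large_norm_le n32); apply: le_measure; rewrite ?inE//.
        apply: measurableI => //; rewrite unit_lp_ballE//; exact: measurable_lball.
      by move=> x [/AK].
    by rewrite lee_fin.
  have : lam n A = (lam n (A `\` B) + lam n (A `&` B))%E.
    rewrite -measureU//; first by rewrite setUC setUIDK.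
    by rewrite setIC; apply/seteqP; split => x // [[_ +] [_ ?]].
  move=> lamA; move: Ae bad; rewrite lamA -(fineK (fin _ mAB ABK)).
  have ABK' : A `&` B `<=` unit_lp_ball p n by move=> x [/AK].
  rewrite -(fineK (fin _ mAB' ABK')) -EFinD !lee_fin; lra.
have := lp_prob_inflation_ge hp n0 mAB (measurable_envelope (tscale (sigma n) @` A) 192) ABK.
have move_le t x : gamma_window (n%:R / p) t -> (A `\` B) x ->
    envelope (tscale (sigma n) @` A) 192 (tscale (inflation p n t) x).
  move=> Wt [Ax /= /negP]; rewrite -leNgt norm2_tscale gtr0_norm// => hx.
  apply: (@sub_envelope _ _ _ _ (tscale (sigma n) x)); first by exists x.
  rewrite eucl_dist_tscale.
  apply: (le_trans (ler_wpM2r (norm2_ge0 x) (inflation_window n0 Wt))).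
  have sc0 : 0 < Num.sqrt (center n) by rewrite sqrtr_gt0.
  have : Num.sqrt n%:R <= 2 * Num.sqrt (center n).
    have -> : 2 * Num.sqrt (center n) = Num.sqrt (4 * center n).
      rewrite sqrtrM//; congr (_ * _); rewrite (_ : 4 = 2 ^+ 2); last by ring.
      by rewrite sqrtr_sqr ger0_norm.
    rewrite ler_sqrt ?mulr_ge0 ?(ltW c0)//.
    by have := center_ge n; have : 0 <= n%:R :> R by []; lra.
  rewrite (_ : _ * _ * _ = 2 * (sigma n * norm2 x) / Num.sqrt (center n)); last by ring.
  move=> hs; rewrite ler_pdivrMr//.
  set s := Num.sqrt (center n) in hs sc0 *; set r := Num.sqrt n%:R in hs hx *.
  by lra.
move=> /(_ move_le); apply: le_trans.
move: half; rewrite -(fineK (fin _ mAB ABK)) -EFinM !lee_fin; lra.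
Qed.

(** If all points of A are at distance at least C L from those of B, where
    L = (- ln e)^(1/p), then the neighbourhoods of their inflations are far apart,
    and the product of their probabilities, at least (3 e / 8)^2, contradicts
    [concentration] when C is large. *)
Lemma upper_borel : exists2 C : R, 0 < C & forall e, 0 < e < 2^-1 ->
  exists n0 : nat, forall n, (n0 <= n)%N -> forall A B : set (n.-tuple R),
    measurable A -> A `<=` unit_lp_ball p n -> ((3 / 4 * e)%:E <= lam n A)%E ->
    measurable B -> B `<=` unit_lp_ball p n -> ((3 / 4 * e)%:E <= lam n B)%E ->
    exists a b, [/\ A a, B b & eucl_dist a b < C * (- ln e) `^ p^-1].
Proof.
have pp := p_gt0 hp; have k0 := gain_rate_gt0 hp; set k := gain_rate p in k0.
have Z0 := rho_mass_gt0 hp; have pV1 : p^-1 <= 1.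
  by rewrite invf_le1//; have /andP[] := hp.
have pV0 := pV_gt0 hp.
(* The distance between the neighbourhoods is at least Z / 4 * C L - 386, where
   386 = 2 * 193; since L >= 1/2, the summand 774 = 2 * 386 + 2 makes it at least
   C0 * L + 1. *)
pose C0 := (9 / k) `^ p^-1.
pose C := (C0 + 774) / (Z / 4).
have C00 : 0 <= C0 by exact: powR_ge0.
have Z4 : 0 < Z / 4 by rewrite divr_gt0.
have C_gt0 : 0 < C by apply: divr_gt0 Z4; lra.
exists C => // e /andP[e0 e2].
pose M := 64 / (9 * k * e).
have M0 : 0 < M by rewrite divr_gt0// mulr_gt0 ?mulr_gt0.
exists (maxn 32 (Num.bound (M ^+ 2))) => n; rewrite geq_max => /andP[n32 nM].
have n0 : (0 < n)%N by exact: leq_trans n32.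
have n2 : (2 <= n)%N by exact: leq_trans n32.
have small : 16 / 9 * expR (- (gain_rate p * Num.sqrt n%:R)) <= e / 4.
  have Mn : M <= Num.sqrt n%:R.
    rewrite -[leLHS](ger0_norm (ltW M0)) -sqrtr_sqr ler_sqrt ?ler0n//.
    by rewrite (le_trans (ltW (archi_boundP _)))// ?ler_nat// sqr_ge0.
  have kM : k * M = 64 / (9 * e) by rewrite /M; field; rewrite !gt_eqF.
  have h1 : 64 / (9 * e) <= k * Num.sqrt n%:R by rewrite -kM ler_pM2l.
  have h0 : 0 < 64 / (9 * e) by rewrite divr_gt0 ?mulr_gt0.
  rewrite expRN ler_pdivrMr ?expR_gt0//.
  have h2 := expR_ge1Dx (k * Num.sqrt n%:R).
  have h3 : 64 / (9 * e) <= expR (k * Num.sqrt n%:R) by lra.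
  rewrite (_ : 16 / 9 = e / 4 * (64 / (9 * e))); last by field; rewrite gt_eqF.
  by rewrite ler_wpM2l// divr_ge0 ?(ltW e0).
move=> A B mA AK Ae mB BK Be.
apply: contrapT => far.
set L := (- ln e) `^ p^-1 in far.
have sep a b : A a -> B b -> C * L <= eucl_dist a b.
  by move=> Aa Bb; rewrite leNgt; apply/negP => h; apply: far; exists a, b; split.
have Lam : 2^-1 <= - ln e.
  rewrite lerNr -[leRHS](expRK) ler_ln ?posrE ?expR_gt0//.
  have := expR_ge1Dx (- 2^-1 : R); lra.
have L2 : 2^-1 <= L.
  apply: (@le_trans _ _ ((2^-1 : R) `^ p^-1)).
    by rewrite -{1}[2^-1 in leLHS]powRr1// ger_powR//; lra.
  by rewrite ge0_ler_powR ?nnegrE ?(ltW pV0)//; lra.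
set s := sigma n.
have sZ : Z / 4 <= s by exact: inflation_ge.
have s0 : 0 < s by apply: lt_le_trans sZ; rewrite divr_gt0.
pose d := s * (C * L) - 386.
have dL : C0 * L + 1 <= d.
  have : (C0 + 774) * L <= s * (C * L).
    rewrite mulrA ler_wpM2r ?(le_trans _ L2)//.
    have : Z / 4 * C <= s * C by rewrite ler_wpM2r// ltW.
    by rewrite {1}/C mulrCA divff ?mulr1// gt_eqF// divr_gt0.
  by rewrite /d; nra.
have C0L : 0 <= C0 * L by rewrite mulr_ge0// (le_trans _ L2).
have d1 : 1 <= d by lra.
pose EA := envelope (tscale s @` A) 192; pose EB := envelope (tscale s @` B) 192.
have sepE y z : EA y -> EB z -> d <= eucl_dist y z.
  move=> /envelope_sub[_ [a Aa <-] ya] /envelope_sub[_ [b Bb <-] zb].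
  have := eucl_dist_triangle (tscale s a) y (tscale s b).
  have := eucl_dist_triangle y z (tscale s b).
  have := ler_wpM2l (ltW s0) (sep a b Aa Bb).
  rewrite -eucl_dist_tscale2 ?(ltW s0)// (eucl_distC (tscale s a) y) /d; lra.
have mEA := measurable_envelope (tscale s @` A) 192.
have mEB := measurable_envelope (tscale s @` B) 192.
have := concentration hp mEA mEB d1 sepE.
have := lp_prob_envelope n32 mA AK Ae small.
have := lp_prob_envelope n32 mB BK Be small.
rewrite -/s -/EA -/EB -(fineK (lp_prob_fin hp mEA)) -(fineK (lp_prob_fin hp mEB)).
rewrite -EFinM !lee_fin -/k => hB hA h.
have e38 : 0 <= 3 / 8 * e by lra.
have {h} : (3 / 8 * e) ^+ 2 <= expR (- (k * d `^ p)).
  by apply: le_trans h; rewrite expr2 ler_pM.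
rewrite leNgt => /negP; apply.
have e_eq : e = expR (ln e) by rewrite lnK.
have Lp : L `^ p = - ln e by rewrite /L (powRVK hp)//; lra.
have kd : 9 * (- ln e) < k * d `^ p.
  have : (C0 * L) `^ p < d `^ p.
    rewrite gt0_ltr_powR ?nnegrE//; first by lra.
    by lra.
  rewrite powRM ?(le_trans _ L2)// Lp /C0 (powRVK hp) ?divr_ge0 ?(ltW k0)//.
  rewrite -(ltr_pM2l k0); congr (_ < _).
  by field; rewrite gt_eqF.
have : expR (- (k * d `^ p)) < expR (9 * ln e) by rewrite ltr_expR; lra.
move=> /lt_le_trans; apply.
(* e^9 <= (1/2)^7 e^2, and (1/2)^7 <= (3/8)^2 *)
have -> : expR (9 * ln e) = e ^+ 9 by rewrite {2}e_eq -expRM_natl.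
rewrite exprMn (_ : 9 = 7 + 2)%N// exprD ler_wpM2r ?sqr_ge0//.
have : e ^+ 7 <= (2^-1) ^+ 7 by rewrite lerXn2r ?nnegrE ?(ltW e0) ?(ltW e2).
by move=> /le_trans; apply; lra.
Qed.

End upper_borel.

(** * Lebesgue measurable sets, upper and lower limits *)

Section volume.
Context {R : realType}.
Local Notation lam n := (@lebesgue_tuple R n).

Lemma volume_measurable n (A : set (n.-tuple R)) : measurable A -> volume A = lam n A.
Proof. by move=> mA; rewrite /volume /completed_measure_extension measurable_mu_extE. Qed.

Lemma measurable_lebesgue n (A : set (n.-tuple R)) : measurable A -> lebesgue_measurable A.
Proof. by move=> mA; apply: sub_caratheodory; exact: sub_sigma_algebra. Qed.

(** The complement in K of a countable Borel cover of K \ A whose total volume is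
    close to that of K \ A. *)
Lemma inner_borel n (K A : set (n.-tuple R)) (e r : R) : r < e ->
  measurable K -> lam n K = 1%E -> A `<=` K ->
  lebesgue_measurable A -> volume A = e%:E ->
  exists A', [/\ measurable A', A' `<=` A & (r%:E <= lam n A')%E].
Proof.
move=> re mK K1 AK cA vA.
pose m := ((lebesgue_tuple n)^*)%mu : set (n.-tuple R) -> \bar R.
have mKE : m K = 1%E by rewrite -K1; exact: measurable_mu_extE.
have eq1 : m K = (m (K `&` A) + m (K `&` ~` A))%E := cA K.
rewrite mKE setIidr// [m A]vA in eq1.
have fin : m (K `&` ~` A) \is a fin_num.
  move: eq1; case: (m _) => //.
have mE : m (K `&` ~` A) = (1 - e)%:E.
  move: eq1 fin; case: (m _) => // s; rewrite -EFinD => h _.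
  by have {}h := EFin_inj h; congr EFin; lra.
have er0 : 0 < e - r by rewrite subr_gt0.
have := lb_ereal_inf_adherent er0 fin.
rewrite (_ : ereal_inf _ = (1 - e)%:E); last exact: mE.
move=> [_ [F [mF cF] <-]]; rewrite -EFinD => hF.
have mU : measurable (\bigcup_i F i) by exact: bigcup_measurable.
exists (K `\` \bigcup_i F i); split.
- exact: measurableD.
- by move=> x [Kx nU]; apply: contrapT => nA; apply: nU; apply: cF.
have Ule : (lam n (\bigcup_i F i) <= (1 - e + (e - r))%:E)%E.
  apply: le_trans (ltW hF).
  exact: measure_sigma_subadditive.
have Ufin : lam n (\bigcup_i F i) \is a fin_num.
  by rewrite ge0_fin_numE ?measure_ge0// (le_lt_trans Ule)// ltry.
have : (1%E <= lam n (K `\` \bigcup_i F i) + lam n (\bigcup_i F i))%E.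
  rewrite -K1 -measureU//; last 2 first.
  - exact: measurableD.
  - by apply/seteqP; split => // x [[_ nx] Ux]; exact: (nx Ux).
  apply: le_measure; rewrite ?inE//.
    by apply: measurableU => //; exact: measurableD.
  by move=> x Kx; have [|] := pselect ((\bigcup_i F i) x); [right|left].
move: Ule; rewrite -(fineK Ufin) lee_fin => Ule.
case: (lam n (K `\` _)) => [s| |] //=.
- by rewrite -EFinD !lee_fin; lra.
- by move=> _; rewrite leey.
Qed.

Lemma limn_esup_le (u : (\bar R)^nat) (l : \bar R) n0 :
  (forall n, (n0 <= n)%N -> (u n <= l)%E) -> (limn_esup u <= l)%E.
Proof.
move=> h; apply: ge_ereal_inf => /=.
exists (ereal_sup (u @` [set n | (n0 <= n)%N])).
  by exists [set n | (n0 <= n)%N] => //; exists n0.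
by apply: ge_ereal_sup => _ [n /= n0n <-]; exact: h.
Qed.

Lemma limn_einf_ge (u : (\bar R)^nat) (l : \bar R) n0 :
  (forall n, (n0 <= n)%N -> (l <= u n)%E) -> (l <= limn_einf u)%E.
Proof.
move=> h; rewrite /limn_einf leeNr; apply: (@limn_esup_le _ _ n0) => n n0n.
by rewrite leeN2; exact: h.
Qed.

Lemma limn_esup_max_dist (p : R) (hp : 1 <= p <= 2) : exists C : R,
  forall e, 0 < e < 2^-1 ->
    (limn_esup (max_dist p e) <= (C * (- ln e) `^ p^-1)%:E)%E.
Proof.
have [C C0 hC] := upper_borel hp; exists C => e he; have /andP[e0 e2] := he.
have [n0 hn0] := hC e he; apply: (@limn_esup_le _ _ (maxn 1 n0)) => n.
rewrite geq_max => /andP[n1 nn0].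
apply: ge_ereal_sup => _ [A [B [[cA AK vA] [[cB BK vB] ->]]]].
have mK : measurable (unit_lp_ball p n).
  by rewrite unit_lp_ballE//; exact: measurable_lball.
have K1 := lebesgue_unit_lp_ball hp n1.
have re : 3 / 4 * e < e by lra.
have [A' [mA' A'A lA']] := inner_borel re mK K1 AK cA vA.
have [B' [mB' B'B lB']] := inner_borel re mK K1 BK cB vB.
have [a [b [A'a B'b dab]]] := hn0 n nn0 A' B' mA' (subset_trans A'A AK) lA'
  mB' (subset_trans B'B BK) lB'.
apply: (@le_trans _ _ (eucl_dist a b)%:E); last by rewrite lee_fin ltW.
apply: ereal_inf_lbound; exists a; first exact: A'A.
by exists b => //; exact: B'B.
Qed.

End volume.

(** * The function Psi and its inverse *)

Section Psi.
Context {R : realType} (p : R) (hp : 1 <= p <= 2).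
Local Notation mu := (@lebesgue_measure R).
Local Notation Z := (@rho_mass R p).
Local Notation F := (lp_cdf hp).

(** The density at 0 of [Psi p], relative to the density of [lp_law]. *)
Definition Psi_scale : R := Z * expR p^-1.

Lemma Psi_scale_gt0 : 0 < Psi_scale.
Proof. by rewrite mulr_gt0 ?rho_mass_gt0 ?expR_gt0. Qed.

Definition Psi_density (x : R) : R :=
  expR p^-1 * expR (- (2 * Gamma (1 + p^-1) * expR p^-1 * `|x|) `^ p).

Lemma Psi_densityE x : Psi_density x = Psi_scale * prho p (Psi_scale * x).
Proof.
have c0 := Psi_scale_gt0; have Z0 := rho_mass_gt0 hp.
rewrite /Psi_density /prho /rho normrM gtr0_norm//.
have -> : 2 * Gamma (1 + p^-1) * expR p^-1 * `|x| = Psi_scale * `|x| by [].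
by rewrite {2}/Psi_scale; field; rewrite gt_eqF.
Qed.

Lemma integral_Psi_density (A : set R) : measurable A ->
  (\int[mu]_(x in A) (Psi_density x)%:E =
   lp_law hp ((fun x : R => (Psi_scale^-1 * x)%R) @^-1` A))%E.
Proof.
move=> mA; have c0 := Psi_scale_gt0; have Z0 := rho_mass_gt0 hp.
pose B := (fun x : R => Psi_scale^-1 * x) @^-1` A.
have mB : measurable (B : set R).
  by rewrite /B -[X in measurable X]setTI; apply: measurable_funM.
pose f (y : R) : \bar R := ((prho p y)%:E * (\1_B y)%:E)%E.
have mf : measurable_fun setT f.
  apply: emeasurable_funM; apply/measurable_EFinP; first exact: measurable_prho.
  exact: measurable_indic.
have f0 (y : R) : (0 <= f y)%E.
  by rewrite /f -EFinM lee_fin mulr_ge0 ?prho_ge0// indicE.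
have -> : lp_law hp B = (\int[mu]_y f y)%E.
  rewrite /lp_law /dens integral_mkcond; apply: eq_integral => y _.
  by rewrite /f patchE indicE; case: ifPn => _; rewrite ?mule1 ?mule0.
rewrite integral_mkcond.
have := @ge0_integral_affine R Psi_scale 0 f c0 mf f0.
have mfc : measurable_fun setT (fun x : R => f (Psi_scale * x + 0)).
  exact: (measurableT_comp mf (measurable_affine _ _)).
have c0' : (0 <= Psi_scale%:E)%E by rewrite lee_fin ltW.
move=> /(congr1 (fun z => Psi_scale%:E * z)%E); rewrite muleA -EFinM divff ?gt_eqF// mul1e.
move=> <-; rewrite -(ge0_integralZl mu measurableT mfc (fun x _ => f0 _) c0').
apply: eq_integral => x _; rewrite patchE /f indicE addr0.
have -> : (Psi_scale * x \in B) = (x \in A).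
  by apply/idP/idP; rewrite !inE /B/= mulKf ?gt_eqF.
case: ifPn => _; last by rewrite !mule0.
by rewrite mule1 -EFinM Psi_densityE.
Qed.

Lemma integral_Psi_densityT : (\int[mu]_x (Psi_density x)%:E = 1)%E.
Proof. by rewrite integral_Psi_density// preimage_setT lp_law_setT. Qed.

Lemma PsiE (a : R) : Psi p a = F (Psi_scale * a).
Proof.
have c0 := Psi_scale_gt0.
rewrite /Psi /Rintegral (@integral_Psi_density `]-oo, a])//; congr (fine (lp_law hp _)).
apply/seteqP; split => x; rewrite /= !in_itv/=.
  by rewrite (mulrC _^-1) ler_pdivrMr// mulrC.
by rewrite (mulrC _^-1) ler_pdivrMr// mulrC.
Qed.

Lemma integral_Psi_density_le (a : R) :
  (\int[mu]_(x in `]-oo, a]) (Psi_density x)%:E = (Psi p a)%:E)%E.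
Proof.
have c0 := Psi_scale_gt0.
rewrite PsiE lp_cdfE (@integral_Psi_density `]-oo, a])//; congr (lp_law hp _).
apply/seteqP; split => x; rewrite /= !in_itv/=.
  by rewrite (mulrC _^-1) ler_pdivrMr// mulrC.
by rewrite (mulrC _^-1) ler_pdivrMr// mulrC.
Qed.

Lemma Psi_invE (e : R) : 0 < e < 1 -> F (Psi_scale * Psi_inv p e) = e.
Proof.
move=> he; rewrite -PsiE; have [x xe] := lp_cdf_surj hp he.
rewrite /Psi_inv pinvK// inE; exists (x / Psi_scale) => //.
by rewrite PsiE mulrCA divff ?mulr1// gt_eqF// Psi_scale_gt0.
Qed.

(** The tail of the law at y lies between e^(- (y + 1)^p) / Z and e^(- y^p). *)
Lemma lp_quantile_bounds (e y : R) : 0 < e < 2^-1 -> F (- y) = e ->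
  [/\ 0 < y, y `^ p <= - ln e & - ln e <= (y + 1) `^ p + ln Z].
Proof.
move=> /andP[e0 e2] Fe; have Z0 := rho_mass_gt0 hp.
have y0 : 0 < y by rewrite -oppr_lt0 -(lp_cdf_ltE hp) Fe lp_cdf0.
have FE : 1 - F y = e by rewrite -lp_cdfN.
split => //.
  have := lp_cdf_tail_le hp (ltW y0); rewrite FE => h.
  rewrite lerNr -ler_expR lnK ?posrE//; have := expR_gt0 (- y `^ p); lra.
have := lp_cdf_tail_ge hp (ltW y0); rewrite FE => h.
rewrite lerNl -(ler_expR _ (ln e)) lnK ?posrE//; apply: le_trans h.
by rewrite opprD expRD (expRN (ln _)) lnK ?posrE.
Qed.

Lemma Psi_inv_asymptotics :
  (fun e : R => - 2 * Psi_inv p e /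
      ((expR p^-1 * Gamma (1 + p^-1))^-1 * (- ln e) `^ p^-1))
    @ 0^'+ --> (1 : R).
Proof.
have c0 := Psi_scale_gt0; have Z0 := rho_mass_gt0 hp; have pp := p_gt0 hp.
have G0 : 0 < Gamma (1 + p^-1) by rewrite Gamma_gt0 // pV_gt0.
have pV0 := pV_gt0 hp; have pV1 : p^-1 <= 1 by rewrite invf_le1//; have /andP[] := hp.
apply/cvgrPdist_le => /= d d0.
pose M := Num.max 1 (Num.max (2 * `|ln Z| / d) (Num.max `|ln Z| ((2 / d) `^ p))).
have lnM : \forall e \near 0^'+, ln e <= - M.
  have /cvgrNyPle := @lnNy R; exact.
near=> e.
have e0 : 0 < e by near: e; exact: nbhs_right_gt.
have e2 : e < 2^-1 by near: e; apply: nbhs_right_lt; rewrite invr_gt0.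
have eM : ln e <= - M by near: e.
set y := - (Psi_scale * Psi_inv p e).
have he : 0 < e < 2^-1 by rewrite e0.
have Fe : F (- y) = e by rewrite opprK Psi_invE// e0 (lt_trans e2)// invf_lt1// ltr1n.
have [y0 y1 y2] := lp_quantile_bounds he Fe.
set L := - ln e in y1 y2 *.
have ML : M <= L by rewrite lerNr.
have [L1 L2 L3 L4] : [/\ 1 <= L, 2 * `|ln Z| / d <= L, `|ln Z| <= L & (2 / d) `^ p <= L].
  by move: ML; rewrite /M !ge_max => /and4P[].
set q := L `^ p^-1.
have L0 : 0 < L by exact: lt_le_trans L1.
have q0 : 0 < q by rewrite powR_gt0.
rewrite (_ : _ / _ = y / q); last first.
  by rewrite /y /Psi_scale /rho_mass; field; rewrite !gt_eqF// expR_gt0.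
have yq : y <= q by rewrite /q -powR_le_powRV// ltW.
have dq : 2 / d <= q by rewrite /q -powR_le_powRV// ?divr_ge0 ?(ltW d0) ?(ltW L0).
have lower : (1 - `|ln Z| / L) * q <= y + 1.
  have u0 : 0 <= 1 - `|ln Z| / L by rewrite subr_ge0 ler_pdivrMr// mul1r.
  have u1 : 1 - `|ln Z| / L <= 1 by rewrite gerBl divr_ge0// ltW.
  set u := 1 - _ in u0 u1 *.
  have uu : u <= u `^ p^-1.
    have [->|un0] := eqVneq u 0; first exact: powR_ge0.
    by rewrite -{1}(powRr1 u0) ger_powR// u1 andbT lt0r un0.
  apply: (@le_trans _ _ (u `^ p^-1 * q)); first by rewrite ler_wpM2r// ltW.
  have y10 : 0 <= y + 1 by rewrite addr_ge0// ltW.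
  rewrite -powRM ?(ltW L0)// -(powRK hp y10).
  rewrite ge0_ler_powR ?nnegrE ?powR_ge0 ?mulr_ge0 ?(ltW L0) ?(ltW pV0)//.
  rewrite /u mulrBl mul1r divfK ?gt_eqF//; have := ler_norm (ln Z); lra.
rewrite ger0_norm ?subr_ge0 ?ler_pdivrMr ?mul1r//.
rewrite lerBlDr addrC -lerBlDr ler_pdivlMr//.
have a1 : `|ln Z| / L <= d / 2.
  rewrite ler_pdivrMr//; move: L2; rewrite ler_pdivrMr//; lra.
have a2 : 1 <= d / 2 * q.
  by move: dq; rewrite ler_pdivrMr//; lra.
set z := `|ln Z| / L in a1 lower; nra.
Unshelve. all: by end_near. Qed.

End Psi.

(** * The profile of the slices of the ball *)

Section slices.
Context {R : realType} (p : R) (hp : 1 <= p <= 2).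
Local Notation mu := (@lebesgue_measure R).
Local Notation Z := (@rho_mass R p).

Lemma powR_expR_ge (u N : R) : 0 <= u < 1 -> 0 < N ->
  expR (- (N * u / (1 - u))) <= (1 - u) `^ N.
Proof.
move=> /andP[u0 u1] N0; have v0 : 0 < 1 - u by rewrite subr_gt0.
rewrite /powR gt_eqF// ler_expR -mulrA -mulrN ler_pM2l//.
rewrite -ler_expR lnK ?posrE// expRN invf_ple ?posrE ?expR_gt0//.
apply: le_trans (expR_ge1Dx _).
by rewrite le_eqVlt; apply/orP; left; apply/eqP; field; rewrite gt_eqF.
Qed.

Lemma powR_expR_le (u N : R) : 0 < N ->
  Num.max 0 (1 - u) `^ N <= expR (- (N * u)).
Proof.
move=> N0; have [h|h] := leP (1 - u) 0.
  by rewrite powR0 ?expR_ge0// gt_eqF.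
rewrite /powR gt_eqF// ler_expR -mulrN ler_pM2l//.
by rewrite -ler_expR lnK ?posrE//; have := expR_ge1Dx (- u); lra.
Qed.

Lemma powRV (x r : R) : 0 <= x -> x^-1 `^ r = (x `^ r)^-1.
Proof. by move=> x0; rewrite -(powR_inv1 x0) powRAC powR_inv1 ?powR_ge0. Qed.

Lemma omega_powp n : (0 < n)%N ->
  omega p n `^ p = Gamma (1 + n%:R / p) `^ (n%:R / p)^-1 / Z `^ p.
Proof.
move=> n0; have Z0 := rho_mass_gt0 hp.
rewrite omegaE powRM ?powR_ge0 ?invr_ge0 ?(ltW Z0)//.
rewrite powRV ?(ltW Z0)//; congr (_ / _).
by rewrite -powRrM; congr (_ `^ _); rewrite invf_div mulrC.
Qed.

(** Stirling's formula to first order. *)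
Lemma Gamma_root_ge (N : R) : 0 < N ->
  N * expR (- (1 + N^-1)) <= Gamma (1 + N) `^ N^-1.
Proof.
move=> N0; have Nn : 0 <= N := ltW N0.
have NV : 0 <= N^-1 by rewrite invr_ge0.
have -> : N * expR (- (1 + N^-1)) = (N `^ N * expR (- (N + 1))) `^ N^-1.
  rewrite powRM ?powR_ge0 ?expR_ge0// -powRrM divff ?gt_eqF// powRr1//.
  congr (_ * _); rewrite -expRM; congr expR; field; by rewrite gt_eqF.
rewrite ge0_ler_powR ?nnegrE ?mulr_ge0 ?powR_ge0 ?expR_ge0//.
  by rewrite ltW// Gamma_gt0.
exact: Gamma_ge.
Qed.

(** [Gamma_le] with l = 1 - 1/N, and N^(1/N) <= e^(2 / sqrt N). *)
Lemma Gamma_root_le (N : R) : 1 < N ->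
  Gamma (1 + N) `^ N^-1 <= N / ((1 - N^-1) * expR 1) * expR (2 * Num.sqrt N^-1).
Proof.
move=> N1; have N0 : 0 < N by exact: lt_trans N1.
have Nn : 0 <= N := ltW N0.
have NV : 0 <= N^-1 by rewrite invr_ge0.
have l01 : 0 < 1 - N^-1 < 1.
  by rewrite subr_gt0 invf_lt1// N1 /= gtrBl invr_gt0.
have l0 : 0 <= 1 - N^-1 by case/andP : l01 => /ltW.
have b0 : 0 <= N / ((1 - N^-1) * expR 1) by rewrite divr_ge0// mulr_ge0 ?expR_ge0.
apply: (@le_trans _ _ (((N / ((1 - N^-1) * expR 1)) `^ N * N) `^ N^-1)).
  rewrite ge0_ler_powR ?nnegrE ?(mulr_ge0 (powR_ge0 _ _) Nn)//.
    by rewrite ltW// Gamma_gt0.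
  by have := Gamma_le N0 l01; rewrite (_ : 1 - (1 - N^-1) = N^-1) ?invrK//; ring.
rewrite powRM ?powR_ge0// -powRrM divff ?gt_eqF// powRr1//.
rewrite ler_wpM2l// /powR gt_eqF// ler_expR.
have sN : 0 < Num.sqrt N by rewrite sqrtr_gt0.
have lnN : ln N <= 2 * Num.sqrt N.
  rewrite -{1}(sqr_sqrtr Nn) lnXn// mulr_natl lerMn2r/=.
  by have := ln_sublinear sN; exact: ltW.
rewrite sqrtrV//; have -> : 2 * (Num.sqrt N)^-1 = N^-1 * (2 * Num.sqrt N).
  by rewrite -{2}(sqr_sqrtr Nn); field; rewrite gt_eqF.
by rewrite ler_wpM2l.
Qed.

(** In dimension m + 2, the power (1 - |t|^p / omega^p)^((m + 1) / p), which is
    the volume of the slice at t up to a factor, is close to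
    exp(- slice_rate m |t|^p). *)
Definition slice_rate m : R := m.+1%:R / p / omega p m.+2 `^ p.

Definition slice m (t : R) : R :=
  Num.max 0 (1 - `|t| `^ p / omega p m.+2 `^ p) `^ (m.+1%:R / p).

Lemma slice_rate_ge m : (Z / 4) `^ p / 4 <= slice_rate m.
Proof.
have pp := p_gt0 hp; have Z0 := rho_mass_gt0 hp.
have w0 : 0 < omega p m.+2 by exact: omega_gt0.
have wp0 : 0 < omega p m.+2 `^ p by exact: powR_gt0.
pose c := m.+2%:R / p + 1.
have c0 : 0 < c by rewrite addr_gt0// divr_gt0.
have := @inflation_ge R p hp m.+2 isT; rewrite /inflation -/c => h.
have z0 : 0 <= Z / 4 by rewrite divr_ge0 ?ltW.
have {}h : (Z / 4) `^ p <= c / omega p m.+2 `^ p.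
  have -> : c / omega p m.+2 `^ p = (c `^ p^-1 / omega p m.+2) `^ p.
    rewrite powRM ?powR_ge0 ?invr_ge0 ?(ltW w0)// (powRVK hp) ?(ltW c0)//.
    by rewrite powRV ?(ltW w0).
  by rewrite ge0_ler_powR ?nnegrE ?(ltW pp)// divr_ge0 ?powR_ge0 ?(ltW w0).
rewrite /slice_rate ler_pdivrMr//; apply: (le_trans h).
rewrite mulrAC ler_pM2r ?invr_gt0//.
have q2 : 1 <= 2 * p^-1 by rewrite ler_pdivlMr// mul1r; have /andP[] := hp.
have mq : 0 <= m%:R * p^-1 by rewrite mulr_ge0// invr_ge0 ltW.
by rewrite /c -!natr1 !mulrDl; lra.
Qed.

(** Both bounds on the N-th root of Gamma (1 + N), for N = (m + 2) / p, are
    continuous functions of sqrt (1 / N) with the same value at 0. *)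
Lemma slice_rate_cvg : slice_rate @ \oo --> Psi_scale p `^ p.
Proof.
have pp := p_gt0 hp; have Z0 := rho_mass_gt0 hp.
have Zp0 : 0 < Z `^ p by exact: powR_gt0.
pose w m : R := Num.sqrt (p / m.+2%:R).
have w0 : w @ \oo --> (0 : R).
  have h : (fun m => p / m.+2%:R : R) @ \oo --> (0 : R).
    rewrite -(mulr0 p); apply: cvgMl_tmp.
    by have /= := @cvg_harmonic R; rewrite -cvg_shiftS; exact.
  have := @continuous_cvg _ R R \oo _ _ Num.sqrt 0 (@sqrt_continuous R 0) h.
  by rewrite sqrtr0; exact.
pose lo (x : R) := Z `^ p * (1 - x ^+ 2 / p) * (expR 1 * (1 - x ^+ 2) * expR (- (2 * x))).
pose hi (x : R) := Z `^ p * (1 - x ^+ 2 / p) * (expR 1 * expR (x ^+ 2)).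
have limE : Psi_scale p `^ p = Z `^ p * expR 1.
  rewrite /Psi_scale powRM ?expR_ge0 ?(ltW Z0)//; congr (_ * _).
  by rewrite -expRM mulVf// gt_eqF.
have cts (f : R -> R) : continuous f -> (f \o w) @ \oo --> f 0.
  by move=> cf; apply: continuous_cvg => //; exact: cf.
have sqc : continuous (fun x : R => x ^+ 2) by exact: exprn_continuous.
have c1 : continuous (fun x : R => Z `^ p * (1 - x ^+ 2 / p)).
  move=> x; apply: cvgMl_tmp; apply: cvgB; first exact: cvg_cst.
  by apply: cvgMr_tmp; exact: sqc.
have lo_cvg : (lo \o w) @ \oo --> Psi_scale p `^ p.
  have -> : Psi_scale p `^ p = lo 0.
    by rewrite limE /lo mulr0 oppr0 expR0 expr0n/= mul0r subr0 !mulr1.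
  apply: cts => x; apply: cvgM; first exact: c1.
  apply: cvgM.
    by apply: cvgMl_tmp; apply: cvgB; [exact: cvg_cst|exact: sqc].
  apply: (@continuous_comp R R R (fun x : R => - (2 * x)) expR).
    by apply: cvgN; apply: cvgMl_tmp; exact: cvg_id.
  exact: continuous_expR.
have hi_cvg : (hi \o w) @ \oo --> Psi_scale p `^ p.
  have -> : Psi_scale p `^ p = hi 0.
    by rewrite limE /hi expr0n/= mul0r subr0 expR0 !mulr1.
  apply: cts => x; apply: cvgM; first exact: c1.
  apply: cvgMl_tmp; apply: (@continuous_comp R R R (fun x : R => x ^+ 2) expR).
    exact: sqc.
  exact: continuous_expR.
apply: (squeeze_cvgr _ lo_cvg hi_cvg).
exists 1%N => // m /= m1; pose N : R := m.+2%:R / p.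
have N0 : 0 < N by rewrite divr_gt0.
have N1 : 1 < N.
  rewrite ltr_pdivlMr// mul1r (@le_lt_trans _ _ 2)//; first by have /andP[] := hp.
  by rewrite ltr_nat.
have w2 : w m ^+ 2 = N^-1 by rewrite sqr_sqrtr ?invf_div// divr_ge0// ltW.
have wE : w m = Num.sqrt N^-1 by rewrite /w invf_div.
have G0 : 0 < Gamma (1 + N) `^ N^-1 by rewrite powR_gt0// Gamma_gt0.
have rE : slice_rate m = Z `^ p * (1 - w m ^+ 2 / p) * (N / Gamma (1 + N) `^ N^-1).
  have alg (x q g z : R) : x != 0 -> q != 0 -> g != 0 -> z != 0 ->
      (x - q^-1) / (g / z) = z * (1 - x^-1 / q) * (x / g).
    by move=> x0 q0 g0 z0; field; rewrite x0 q0 g0 z0.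
  have e1 : m.+1%:R / p = N - p^-1 by rewrite /N -[m.+2%:R]natr1 mulrDl mul1r addrK.
  by rewrite w2 -(alg N p (Gamma (1 + N) `^ N^-1)) ?gt_eqF// /slice_rate e1 omega_powp.
have f0 : 0 <= Z `^ p * (1 - w m ^+ 2 / p).
  have Np : N * p = m.+2%:R by rewrite /N divfK ?gt_eqF.
  by rewrite mulr_ge0 ?(ltW Zp0)// subr_ge0 w2 -invfM Np invf_le1 ?ltr0n// ler1n.
rewrite /= rE /lo /hi w2 wE.
rewrite !w2 in f0; have iN : 0 < 1 - N^-1 by rewrite subr_gt0 invf_lt1.
apply/andP; split; apply: ler_wpM2l => //.
  rewrite ler_pdivlMr//.
  apply: (le_trans (ler_wpM2l _ (Gamma_root_le N1))).
    by rewrite !mulr_ge0 ?expR_ge0// ltW.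
  rewrite expRN le_eqVlt; apply/orP; left; apply/eqP.
  by move: iN; set y := 1 - N^-1 => y0; field; rewrite !gt_eqF ?expR_gt0.
rewrite ler_pdivrMr//; have := Gamma_root_ge N0.
move=> /(ler_wpM2l (_ : 0 <= expR 1 * expR N^-1)) h.
apply: le_trans (h _); last by rewrite mulr_ge0 ?expR_ge0.
rewrite le_eqVlt; apply/orP; left; apply/eqP.
by rewrite mulrCA -!expRD subrr expR0 mulr1.
Qed.

Lemma slice_exponent_gt0 m : 0 < m.+1%:R / p :> R.
Proof. by rewrite divr_gt0// p_gt0. Qed.

Lemma slice_ge0 m t : 0 <= slice m t. Proof. exact: powR_ge0. Qed.

Lemma slice_rateM m (t : R) : m.+1%:R / p * (`|t| `^ p / omega p m.+2 `^ p) =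
  slice_rate m * `|t| `^ p.
Proof. by rewrite /slice_rate; ring. Qed.

Lemma slice_le m t : slice m t <= expR (- ((Z / 4) `^ p / 4 * `|t| `^ p)).
Proof.
apply: (le_trans (powR_expR_le _ (slice_exponent_gt0 m))).
by rewrite slice_rateM ler_expR lerN2 ler_wpM2r ?powR_ge0// slice_rate_ge.
Qed.

Lemma slice_le1 m t : slice m t <= 1.
Proof.
apply: (le_trans (slice_le m t)); rewrite -expR0 ler_expR oppr_le0.
by rewrite mulr_ge0 ?powR_ge0// divr_ge0 ?powR_ge0.
Qed.

Lemma sliceN m t : slice m (- t) = slice m t.
Proof. by rewrite /slice normrN. Qed.

Lemma measurable_slice m : measurable_fun setT (slice m).
Proof.
apply: (measurableT_comp (measurable_powR _)); apply: measurable_maxr => //.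
apply: measurable_funB => //; apply: measurable_funM => //.
exact: measurable_powR_norm.
Qed.

Lemma slice_cvg (t : R) : (fun m => slice m t) @ \oo --> expR (- (Psi_scale p * `|t|) `^ p).
Proof.
have pp := p_gt0 hp.
have c0 := Psi_scale_gt0 hp.
pose b m := slice_rate m * `|t| `^ p.
pose u m : R := `|t| `^ p / omega p m.+2 `^ p.
have b_cvg : b @ \oo --> (Psi_scale p * `|t|) `^ p.
  by rewrite powRM ?(ltW c0)//; apply: cvgMr_tmp; exact: slice_rate_cvg.
have uE m : u m = b m * (p / m.+1%:R).
  by rewrite /u /b /slice_rate; field; rewrite !gt_eqF ?powR_gt0 ?omega_gt0//= natr1.
have u_cvg : u @ \oo --> (0 : R).
  rewrite (_ : u = fun m => b m * (p / m.+1%:R)); last by apply/funext.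
  rewrite -(mulr0 ((Psi_scale p * `|t|) `^ p)); apply: cvgM => //.
  rewrite -(mulr0 p); apply: cvgMl_tmp; exact: cvg_harmonic.
have u1 : \forall m \near \oo, u m < 1.
  by have := cvgr_lt (0 : R) u_cvg; apply.
have lo_cvg : (fun m => expR (- (b m / (1 - u m)))) @ \oo -->
    expR (- (Psi_scale p * `|t|) `^ p).
  apply: continuous_cvg; first exact: continuous_expR.
  apply: cvgN; rewrite -[X in _ --> X]mulr1; apply: cvgM => //.
  rewrite -[X in _ --> X]invr1; apply: cvgV; first by [].
  by rewrite -[X in _ --> X](subr0 1); apply: cvgB => //; exact: cvg_cst.
have hi_cvg : (fun m => expR (- b m)) @ \oo --> expR (- (Psi_scale p * `|t|) `^ p).
  by apply: continuous_cvg; [exact: continuous_expR|exact: cvgN].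
apply: (squeeze_cvgr _ lo_cvg hi_cvg).
near=> m; have um : u m < 1 by near: m.
have um0 : 0 <= u m by rewrite divr_ge0 ?powR_ge0.
apply/andP; split; last first.
  by rewrite /b -slice_rateM; exact: (powR_expR_le _ (slice_exponent_gt0 m)).
rewrite /slice -/(u m) (max_idPr _); last by rewrite subr_ge0 ltW.
rewrite (_ : b m = m.+1%:R / p * u m); last by rewrite /u slice_rateM.
by apply: powR_expR_ge; [rewrite um0|exact: slice_exponent_gt0].
Unshelve. all: by end_near. Qed.

End slices.

(** * Opposite half-spaces and the lower bound *)

Section slabs.
Context {R : realType} (p : R) (hp : 1 <= p <= 2).
Local Notation mu := (@lebesgue_measure R).
Local Notation lam n := (@lebesgue_tuple R n).
Local Notation Z := (@rho_mass R p).

(** This set is invariant under scaling and has finite volume. *)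
Lemma lebesgue_lball0 n : lam n.+1 (lball p n.+1 0) = 0%E.
Proof.
have m0 : measurable (lball p n.+1 0 : set (n.+1.-tuple R)) by exact: measurable_lball.
have two0 : 0 < 2 :> R by [].
have := @lebesgue_tscale R n.+1 2 (lball p n.+1 0) two0 m0.
have := @tscale_lball R p n.+1 2 0 two0; rewrite mulr0 => ->.
have fin : lam n.+1 (lball p n.+1 0) \is a fin_num.
  rewrite ge0_fin_numE ?measure_ge0// (le_lt_trans _ (ltry 1))//.
  rewrite -(lebesgue_unit_lp_ball hp (ltn0Sn n)) unit_lp_ballE//.
  apply: le_measure; rewrite ?inE//; first exact: measurable_lball.
  by move=> x /le_trans; apply; exact: powR_ge0.
rewrite -(fineK fin) -EFinM => h; have {}h := EFin_inj h; congr EFin.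
have : 2 ^+ n.+1 * fine (lam n.+1 (lball p n.+1 0)) = fine (lam n.+1 (lball p n.+1 0)).
  by rewrite {1}h mulrA divff ?mul1r// expf_neq0.
have : 2 <= 2 ^+ n.+1 :> R by rewrite exprS ler_pMr// exprn_ege1// ler1n.
by move=> ? ?; nra.
Qed.

Definition slice_mass m : R :=
  omega p m.+2 ^+ m.+1 * fine (lam m.+1 (lball p m.+1 1)).

Lemma slice_mass_ge0 m : 0 <= slice_mass m.
Proof. by rewrite mulr_ge0 ?exprn_ge0 ?fine_ge0// ltW// omega_gt0. Qed.

(** The slice of the ball at height t is a ball of dimension one less. *)
Lemma lebesgue_ball_slice m (t : R) :
  lam m.+1 (lball p m.+1 (omega p m.+2 `^ p - `|t| `^ p)) =
  (slice_mass m * slice p m t)%:E.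
Proof.
have w0 : 0 < omega p m.+2 by exact: omega_gt0.
have wp0 : 0 < omega p m.+2 `^ p by exact: powR_gt0.
rewrite /slice; set W := omega p m.+2 `^ p; set u := `|t| `^ p.
have E0 : 0 < m.+1%:R / p by exact: slice_exponent_gt0.
have fin : lam m.+1 (lball p m.+1 1) \is a fin_num.
  rewrite ge0_fin_numE ?measure_ge0// ltey; apply/eqP => h.
  have := lebesgue_lball_Gamma hp (ltn0Sn m).
  by rewrite h gt0_mulye// lte_fin Gamma_gt0.
have [uW|uW] := leP W u.
  rewrite (max_idPl _); last by rewrite subr_le0 ler_pdivlMr// mul1r.
  rewrite powR0 ?gt_eqF// mulr0.
  move: uW; rewrite le_eqVlt => /predU1P[<-|uW].
    by rewrite subrr lebesgue_lball0.
  rewrite (_ : lball _ _ _ = set0) ?measure0//.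
  apply/seteqP; split => // x /= h; have := le_trans (lnorm_ge0 p x) h.
  by rewrite subr_ge0 leNgt uW.
rewrite (max_idPr _); last by rewrite subr_ge0 ler_pdivrMr// mul1r ltW.
rewrite lebesgue_lball ?subr_gt0// -(fineK fin) -EFinM; congr EFin.
have -> : W - u = W * (1 - u / W) by field; rewrite gt_eqF.
rewrite powRM ?(ltW wp0)//; last by rewrite subr_ge0 ler_pdivrMr// mul1r ltW.
by rewrite /W powR_norm_pn ?(ltW w0)// /slice_mass; ring.
Qed.

Definition slab m (A : set R) : set (m.+2.-tuple R) :=
  unit_lp_ball p m.+2 `&` [set x | A (tnth x ord0)].
Arguments slab : clear implicits.

Lemma measurable_slab m (A : set R) : measurable A -> measurable (slab m A).
Proof.
move=> mA; apply: measurableI; first by rewrite unit_lp_ballE//; exact: measurable_lball.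
rewrite -[X in measurable X]setTI; exact: (measurable_tnth ord0 measurableT mA).
Qed.

Lemma lebesgue_slab m (A : set R) : measurable A ->
  (lam m.+2 (slab m A) = \int[mu]_(t in A) (slice_mass m * slice p m t)%:E)%E.
Proof.
move=> mA; have mS := @measurable_slab m A mA.
rewrite -integral_setT_indic//.
have mi : measurable_fun setT (fun x : m.+2.-tuple R => (\1_(slab m A) x : R)%:E).
  by apply/measurable_EFinP; exact: measurable_indic.
rewrite integral_lebesgue_tupleS//.
rewrite [RHS]integral_mkcond; apply: eq_integral => t _; rewrite patchE.
have inS (x : m.+1.-tuple R) : slab m A (tcons t x) <->
    A t /\ lball p m.+1 (omega p m.+2 `^ p - `|t| `^ p) x.
  rewrite /slab/= unit_lp_ballE// /lball/= lnorm_cons tnth_tcons0.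
  by rewrite lerBrDl; split => -[].
case: ifPn => tA; last first.
  rewrite integral0_eq// => x _; rewrite indicE.
  case: (boolP (_ \in _)) => //; rewrite inE => /inS[At _].
  by move: tA; rewrite mem_set.
rewrite -lebesgue_ball_slice -integral_setT_indic; last exact: measurable_lball.
apply: eq_integral => x _; rewrite !indicE; congr (_%:R)%:E; congr nat_of_bool.
apply/idP/idP; rewrite !inE => h; first by have [] := (inS x).1 h.
by apply/inS; split => //; rewrite inE in tA.
Qed.

Lemma integral_slice_total m : (\int[mu]_t (slice_mass m * slice p m t)%:E = 1)%E.
Proof.
rewrite -lebesgue_slab// -(lebesgue_unit_lp_ball hp (ltn0Sn m.+1)); congr (lam _ _).
by apply/seteqP; split => x // [].
Qed.

Lemma slab_fin m (A : set R) : measurable A -> lam m.+2 (slab m A) \is a fin_num.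
Proof.
move=> mA; rewrite ge0_fin_numE ?measure_ge0// (le_lt_trans _ (ltry 1))//.
rewrite -(lebesgue_unit_lp_ball hp (ltn0Sn m.+1)).
apply: le_measure; rewrite ?inE//; first exact: measurable_slab.
  by rewrite unit_lp_ballE//; exact: measurable_lball.
by move=> x [].
Qed.

(** Dominated convergence; the bound is [slice_le], with a rate independent of m. *)
Lemma integral_slice_cvg (A : set R) : measurable A ->
  (\int[mu]_(t in A) (expR p^-1 * slice p m t)%:E)%E @[m --> \oo] -->
  (\int[mu]_(t in A) (Psi_density p t)%:E)%E.
Proof.
move=> mA; have pp := p_gt0 hp; have Z0 := rho_mass_gt0 hp.
pose k := (Z / 4) `^ p / 4.
have k0 : 0 < k by rewrite divr_gt0// powR_gt0// divr_gt0.
pose g (t : R) := (expR p^-1 * expR (- (k * `|t| `^ p)))%:E.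
have gE (t : R) : g t = ((expR p^-1)%:E * (rho p (k `^ p^-1 * t + 0))%:E)%E.
  rewrite -EFinM /rho addr0 normrM ger0_norm ?powR_ge0// powRM ?powR_ge0//.
  by rewrite (powRVK hp (ltW k0)).
have kp0 : 0 < k `^ p^-1 by exact: powR_gt0.
have mr : measurable_fun setT (fun x : R => (rho p x)%:E).
  by apply/measurable_EFinP; exact: measurable_rho.
have r0 (x : R) : (0 <= (rho p x)%:E)%E by rewrite lee_fin ltW// rho_gt0.
have mra : measurable_fun setT (fun x : R => (rho p (k `^ p^-1 * x + 0))%:E).
  apply/measurable_EFinP; apply: (measurableT_comp (measurable_rho hp)).
  exact: measurable_affine.
have e0 : (0 <= (expR p^-1)%:E :> \bar R)%E by rewrite lee_fin expR_ge0.
have gT : g = (fun t : R => (expR p^-1)%:E * (rho p (k `^ p^-1 * t + 0))%:E)%E.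
  by apply/funext.
have mg : measurable_fun setT g by rewrite gT; exact: measurable_funeM.
have ig : mu.-integrable A g.
  apply: (@integrableS _ _ _ mu setT) => //.
  apply/integrableP; split => //.
  have -> : (\int[mu]_x `|g x| = (expR p^-1 * ((k `^ p^-1)^-1 * Z))%:E)%E.
    rewrite [RHS]EFinM [in RHS]EFinM -(integral_rho hp).
    rewrite -(@ge0_integral_affine R _ 0 (fun x => (rho p x)%:E) kp0 mr r0).
    rewrite -(ge0_integralZl mu measurableT mra (fun x _ => r0 _) e0).
    apply: eq_integral => x _; rewrite -gE gee0_abs// /g lee_fin.
    by rewrite mulr_ge0 ?expR_ge0.
  by rewrite ltry.
apply: (@dominated_cvg _ _ _ mu A mA
  (fun m (t : R) => (expR p^-1 * slice p m t)%:E) _ g).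
- move=> m; apply/measurable_EFinP; apply: measurable_funTS.
  by apply: measurable_funM => //; exact: measurable_slice.
- move=> t _; apply: cvg_EFin; first by near=> m.
  by apply: cvgMl_tmp; exact: slice_cvg.
- by [].
- exact: ig.
- move=> m t _; rewrite gee0_abs ?lee_fin; last by rewrite mulr_ge0 ?expR_ge0// slice_ge0.
  by apply: ler_wpM2l; [exact: expR_ge0|exact: slice_le].
Unshelve. all: by end_near. Qed.

Definition slab_cdf m (a : R) : R := fine (lam m.+2 (slab m `]-oo, a]%classic)).

Lemma slab_cdfE m a : (slab_cdf m a)%:E = lam m.+2 (slab m `]-oo, a]%classic).
Proof. by rewrite fineK// slab_fin. Qed.

(** The volume is a quotient of two integrals of [slice], as the whole ball has
    volume 1; this avoids computing the limit of the factor [slice_mass]. *)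
Lemma slab_cdf_cvg (a : R) : slab_cdf m a @[m --> \oo] --> Psi p a.
Proof.
pose D m (A : set R) := (\int[mu]_(t in A) (expR p^-1 * slice p m t)%:E)%E.
have ms m (A : set R) : measurable_fun A (fun t : R => (slice p m t)%:E).
  by apply/measurable_EFinP; apply: measurable_funTS; exact: measurable_slice.
have s0 m (t : R) : (0 <= (slice p m t)%:E)%E by rewrite lee_fin slice_ge0.
have e0 : (0 <= (expR p^-1)%:E :> \bar R)%E by rewrite lee_fin expR_ge0.
have DE m (A : set R) : measurable A -> (D m A = lam m.+2 (slab m A) * D m setT)%E.
  move=> mA; have v0 : (0 <= (slice_mass m)%:E)%E by rewrite lee_fin slice_mass_ge0.
  have I (B : set R) : measurable B ->
      (D m B = (expR p^-1)%:E * \int[mu]_(t in B) (slice p m t)%:E)%E.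
    by move=> mB; rewrite /D -(ge0_integralZl mu mB (ms m B) (fun t _ => s0 m t) e0).
  have J (B : set R) : measurable B ->
      (lam m.+2 (slab m B) = (slice_mass m)%:E * \int[mu]_(t in B) (slice p m t)%:E)%E.
    move=> mB; rewrite lebesgue_slab//.
    by rewrite -(ge0_integralZl mu mB (ms m B) (fun t _ => s0 m t) v0).
  rewrite (I A mA) (I setT measurableT) (J A mA).
  have := integral_slice_total m.
  have -> : (\int[mu]_t (slice_mass m * slice p m t)%:E =
      (slice_mass m)%:E * \int[mu]_t (slice p m t)%:E)%E.
    by rewrite -(ge0_integralZl mu measurableT (ms m setT) (fun t _ => s0 m t) v0).
  move=> one; rewrite -[LHS]mule1 -one.
  by rewrite muleACA [RHS]muleACA (muleC (expR p^-1)%:E).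
have cA := integral_slice_cvg (measurable_itv `]-oo, a]).
have cT := integral_slice_cvg measurableT.
rewrite (integral_Psi_density_le hp) in cA.
rewrite (integral_Psi_densityT hp) in cT.
have fA : fine (D m `]-oo, a]%classic) @[m --> \oo] --> Psi p a by exact: fine_cvg cA.
have fT : fine (D m setT) @[m --> \oo] --> (1 : R) by exact: fine_cvg cT.
have fT0 : \forall m \near \oo, 0 < fine (D m setT).
  exact: (cvgr_gt _ fT _ ltr01).
have finT : \forall m \near \oo, D m setT \is a fin_num.
  have /fine_cvgP[] := cT; exact.
have : (fun m => fine (D m `]-oo, a]%classic) / fine (D m setT)) @ \oo --> Psi p a.
  rewrite -[X in _ --> X]mulr1; apply: cvgM; first exact: fA.
  by rewrite -[X in _ --> X]invr1; apply: cvgV => //; exact: oner_neq0.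
apply: cvg_trans; apply: near_eq_cvg; near=> m.
have Tn0 : 0 < fine (D m setT) by near: m.
have Tf : D m setT \is a fin_num by near: m.
rewrite DE// fineM//; last exact: slab_fin.
by rewrite mulfK// gt_eqF.
Unshelve. all: by end_near. Qed.

Lemma slab_cdf_incr m a b : a <= b ->
  0 <= slab_cdf m b - slab_cdf m a <= slice_mass m * (b - a).
Proof.
move=> ab.
have mI : measurable (`]a, b]%classic : set R) by exact: measurable_itv.
have ma : measurable (`]-oo, a]%classic : set R) by exact: measurable_itv.
have fI := slab_fin m mI; have fa := slab_fin m ma.
have slab_b : lam m.+2 (slab m `]-oo, b]%classic) =
    (lam m.+2 (slab m `]-oo, a]%classic) + lam m.+2 (slab m `]a, b]%classic))%E.
  rewrite -measureU; last 3 first.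
  - exact: measurable_slab.
  - exact: measurable_slab.
  - apply/seteqP; split => // x [[_ /=] + [_ /=]]; rewrite !in_itv/= => xa /andP[].
    by rewrite ltNge xa.
  congr (lam _ _); rewrite /slab -setIUr; congr (_ `&` _).
  apply/seteqP; split => x /=; rewrite !in_itv/=.
    by move=> xb; have [xa|xa] := leP (tnth x ord0) a; [left|right].
  by move=> [xa|/andP[_ //]]; exact: le_trans ab.
have -> : slab_cdf m b - slab_cdf m a = fine (lam m.+2 (slab m `]a, b]%classic)).
  apply/eqP; rewrite subr_eq addrC; apply/eqP.
  exact: (etrans (congr1 fine slab_b) (fineD fa fI)).
rewrite fine_ge0//= -lee_fin (fineK fI) (lebesgue_slab m mI).
have -> : (slice_mass m * (b - a))%:E =
    (\int[mu]_(t in `]a, b]%classic) (cst (slice_mass m)%:E t))%E.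
  rewrite integral_cst//= lebesgue_measure_itv/= lte_fin.
  move: ab; rewrite le_eqVlt => /predU1P[->|->]; last by rewrite EFinM EFinB.
  by rewrite ltxx subrr mulr0 mule0.
have v0 := slice_mass_ge0 m.
apply: (ge0_le_integral mu mI).
- by move=> t _; rewrite lee_fin mulr_ge0// slice_ge0.
- apply/measurable_EFinP; apply: measurable_funTS.
  by apply: measurable_funM => //; exact: measurable_slice.
- exact: measurable_cst.
- by move=> t _; rewrite lee_fin ler_piMr// slice_le1.
Qed.

Lemma slab_cdf_continuous m : continuous (slab_cdf m).
Proof.
move=> x; apply/cvgrPdist_le => /= e e0.
have v0 := slice_mass_ge0 m.
have v1 : 0 < slice_mass m + 1 by rewrite ltr_wpDl.
have eV : 0 < e / (slice_mass m + 1) by rewrite divr_gt0.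
have : \forall y \near x, `|x - y| < e / (slice_mass m + 1).
  by exists (e / (slice_mass m + 1)).
apply: filterS => y; rewrite ltr_pdivlMr// => h.
have lip a b : a <= b -> `|slab_cdf m a - slab_cdf m b| <= slice_mass m * (b - a).
  by move=> /(slab_cdf_incr m)/andP[h0 h1]; rewrite distrC ger0_norm.
apply: le_trans (ltW h).
have [xy|/ltW yx] := leP x y.
  apply: (le_trans (lip _ _ xy)); rewrite distrC ger0_norm ?subr_ge0//.
  by rewrite mulrC ler_wpM2l ?subr_ge0// lerDl.
rewrite distrC; apply: (le_trans (lip _ _ yx)); rewrite ger0_norm ?subr_ge0//.
by rewrite mulrC ler_wpM2l ?subr_ge0// lerDl.
Qed.

Lemma slab_cdf_out m b : b <= - omega p m.+2 -> slab_cdf m b = 0.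
Proof.
move=> bw; have w0 : 0 < omega p m.+2 by exact: omega_gt0.
have wp0 : 0 < omega p m.+2 `^ p by exact: powR_gt0.
apply: EFin_inj; rewrite slab_cdfE lebesgue_slab// integral0_eq// => t.
rewrite /= in_itv/= => tb; congr EFin; rewrite /slice.
rewrite (max_idPl _) ?powR0 ?mulr0 ?gt_eqF ?slice_exponent_gt0//.
rewrite subr_le0 ler_pdivlMr// mul1r ge0_ler_powR ?nnegrE ?(ltW w0)//.
  exact/ltW/p_gt0.
rewrite ler0_norm; last by rewrite (le_trans tb)// (le_trans bw)// oppr_le0 ltW.
by rewrite lerNr (le_trans tb).
Qed.

Lemma slab_cdf_ivt m a e : 0 < e < slab_cdf m a ->
  exists2 b, b <= a & slab_cdf m b = e.
Proof.
move=> /andP[e0 ea]; pose b := Num.min a (- omega p m.+2).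
have ba : b <= a by rewrite ge_min lexx.
have b0 : slab_cdf m b = 0 by rewrite slab_cdf_out// ge_min lexx orbT.
have cF : {within `[b, a], continuous (slab_cdf m)}.
  by apply: continuous_subspaceT; exact: slab_cdf_continuous.
have he : Num.min (slab_cdf m b) (slab_cdf m a) <= e <= Num.max (slab_cdf m b) (slab_cdf m a).
  by rewrite b0 ge_min (ltW e0)/= le_max (ltW ea) orbT.
have [c + <-] := IVT ba cF he.
by rewrite in_itv/= => /andP[_ ca]; exists c.
Qed.

Lemma slab_reflect m a :
  lam m.+2 (slab m `[(- a)%R, +oo[%classic) = lam m.+2 (slab m `]-oo, a]%classic).
Proof.
rewrite !lebesgue_slab// integral_mkcond [RHS]integral_mkcond.
have mf : measurable_fun setT ((fun t : R => (slice_mass m * slice p m t)%:E) \_ `]-oo, a]).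
  apply/(measurable_restrictT _ _).1 => //.
  apply/measurable_EFinP; apply: measurable_funTS.
  by apply: measurable_funM => //; exact: measurable_slice.
rewrite -(ge0_integral_oppr mf); last first.
  move=> t; rewrite patchE; case: ifPn => // _.
  by rewrite lee_fin mulr_ge0 ?slice_mass_ge0 ?slice_ge0.
apply: eq_integral => t _; rewrite !patchE !mem_setE !in_itv/= andbT lerNl sliceN.
by [].
Qed.

Lemma eucl_dist_ge_tnth n (x y : n.-tuple R) i : tnth y i - tnth x i <= eucl_dist x y.
Proof.
apply: (le_trans (ler_norm _)); rewrite -sqrtr_sqr ler_sqrt.
  rewrite (bigD1 i)//= -[X in X <= _]addr0 -sqrrN opprB lerD2l.
  by apply: sumr_ge0 => j _; exact: sqr_ge0.
by apply: sumr_ge0 => j _; exact: sqr_ge0.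
Qed.

(** Two opposite half-spaces, cut at - b and b, with b adjusted by continuity so
    that each has volume exactly e. *)
Lemma max_dist_ge m a e : 0 < e < slab_cdf m a -> ((- 2 * a)%:E <= max_dist p e m.+2)%E.
Proof.
move=> /slab_cdf_ivt[b ba vb].
pose A := slab m `]-oo, b]%classic; pose B := slab m `[(- b)%R, +oo[%classic.
have mA : measurable A by exact: measurable_slab.
have mB : measurable B by exact: measurable_slab.
have lA : lam m.+2 A = e%:E by rewrite -vb slab_cdfE.
have lB : lam m.+2 B = e%:E by rewrite /B slab_reflect.
apply: (@le_trans _ _ (set_dist A B)); last first.
  apply: ereal_sup_ubound; exists A, B; split; last split; last by [].
    split; [exact: measurable_lebesgue mA|by move=> x []|].
    exact: (etrans (volume_measurable mA) lA).
  split; [exact: measurable_lebesgue mB|by move=> x []|].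
  exact: (etrans (volume_measurable mB) lB).
apply: le_ereal_inf_tmp => _ [x [_ +] [y [_ +] <-]]; rewrite /= !in_itv/= andbT.
move=> xb yb; rewrite lee_fin; apply: le_trans (eucl_dist_ge_tnth x y ord0); lra.
Qed.

Lemma limn_einf_max_dist e : 0 < e < 1 ->
  ((- 2 * Psi_inv p e)%:E <= limn_einf (max_dist p e))%E.
Proof.
move=> he; apply/lee_addgt0Pr => d d0.
rewrite -leeBlDr// -EFinB.
pose a := Psi_inv p e + d / 2.
have -> : - 2 * Psi_inv p e - d = - 2 * a by rewrite /a; field.
have ea : e < Psi p a.
  rewrite (PsiE hp) -[X in X < _](Psi_invE hp he) lp_cdf_ltE ltr_pM2l ?Psi_scale_gt0//.
  by rewrite ltrDl divr_gt0.
have [m0 _ hm0] := cvgr_gt _ (@slab_cdf_cvg a) _ ea.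
apply: (@limn_einf_ge _ _ _ m0.+2) => -[//|[//|m]]; rewrite !ltnS => m0m.
by apply: max_dist_ge; have /andP[-> _] := he; exact: hm0.
Qed.

End slabs.

(** * The distance between two sets of given volume *)

Theorem mainTheorem4 (R : realType) (p : R) (hp : 1 <= p <= 2) :
  (exists C : R, forall e : R, 0 < e < 2^-1 ->
    [/\ ((- 2 * Psi_inv p e)%:E <= limn_einf (max_dist p e))%E,
        (limn_einf (max_dist p e) <= limn_esup (max_dist p e))%E &
        (limn_esup (max_dist p e) <= (C * (- ln e) `^ p^-1)%:E)%E]) /\
  (fun e : R => - 2 * Psi_inv p e /
      ((expR p^-1 * Gamma (1 + p^-1))^-1 * (- ln e) `^ p^-1))
    @ 0^'+ --> (1 : R).
Proof.
split; last exact: Psi_inv_asymptotics hp.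
have [C hC] := limn_esup_max_dist hp; exists C => e he.
split; [|exact: limn_einf_sup|exact: hC].
apply: (limn_einf_max_dist hp); have /andP[-> e2] := he.
by rewrite (lt_trans e2)// invf_lt1// ltr1n.
Qed.
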